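(* For every $\mu\in\mathbb{C}$ and $z\in\mathbb{C}\setminus(-\infty,0]$, the Hankel function of the second kind satisfies $$\mathrm{i}\,H^{(2)}_\mu(z)=\mathcal{H}^{(2)}_\mu(z)+T_+(\mu)\,\frac{\chi_{[-\mu\,\mathrm{sgn}(\mathrm{Re}\,\mu)]}(z)}{\sin\mu\pi},$$ where $T_+(\mu)=e^{\mathrm{i}\mu\pi}$ if $\mathrm{Re}\,\mu<0$, $T_+(\mu)=-1$ if $\mathrm{Re}\,\mu\geq0$, and the integral term is $$\mathcal{H}^{(2)}_\mu(z):=\frac{e^{\mathrm{i}\mu\pi}B_\mu(z)-B_{-\mu}(z)}{\sin\mu\pi}=\frac{\mathrm{i}^{\mu}}{\pi\sin\mu\pi}\int_0^\pi e^{-\mathrm{i}z\cos\theta}\Big[e^{\mathrm{i}\mu\pi}P\big(\{\mu\},-\mathrm{i}z(1+\cos\theta)\big)-e^{-\mathrm{i}\mu\pi}P\big(-\{\mu\},-\mathrm{i}z(1+\cos\theta)\big)\Big]\cos(\mu\theta)\,\mathrm{d}\theta$$ (for $\mu\in\mathbb{Z}$ the right-hand sides are understood as limits).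
   Context: Integral and fractional parts: for $\mu\in\mathbb{C}$, $\langle\mathrm{Re}\,\mu\rangle$ is the nearest integer to $\mathrm{Re}\,\mu$, with $\langle n+\frac12\rangle=n$ for $n\in\mathbb{Z}$; $\{\mu\}:=\mu-\langle\mathrm{Re}\,\mu\rangle$, so $-\frac12<\mathrm{Re}\{\mu\}\leq\frac12$. $\mathrm{sgn}$ is the sign function with $\mathrm{sgn}(0)=0$. $J_\mu(z)=(z/2)^\mu\sum_{k\ge0}\frac{(-1)^k(z/2)^{2k}}{k!\,\Gamma(\mu+k+1)}$; $Y_\mu(z)=\frac{J_\mu(z)\cos\mu\pi-J_{-\mu}(z)}{\sin\mu\pi}$ (limit for integer $\mu$); $H^{(2)}_\mu=J_\mu-\mathrm{i}Y_\mu$, equivalently $H_\mu^{(2)}(z)=-\mathrm{i}\,\frac{e^{\mathrm{i}\mu\pi}J_\mu(z)-J_{-\mu}(z)}{\sin\mu\pi}$ (limit for integer $\mu$). $P(a,w)=w^a\gamma^*(a,w)$ with $\gamma^*(a,w)=e^{-w}\sum_{k\ge0}\frac{w^k}{\Gamma(a+k+1)}$ (normalised lower incomplete gamma function). $z^a$ is the principal power, $\mathrm{i}^a=e^{\mathrm{i}\pi a/2}$, and for $c>0$ the power $(-\mathrm{i}cz)^a$ (including in $P(a,-\mathrm{i}cz)$) means $e^{-\mathrm{i}\pi a/2}c^az^a$. For $\mu\in\mathbb{C}$: $B_\mu(z):=\frac{\mathrm{i}^{\mu}}{\pi}\int_{0}^\pi e^{-\mathrm{i} z\cos\theta}P(\{\mu\},-\mathrm{i}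 z(1+\cos\theta))\cos(\mu\theta)\,\mathrm{d}\theta$; and $\chi_\mu(z):=\frac{\mathrm{i}^\mu}{\sqrt{\pi}}e^{\mathrm{i} z}\sum_{j=1}^{-\langle\mathrm{Re}\,\mu\rangle}\frac{\Gamma(j+\mu-\frac12)}{\Gamma(j)\Gamma(j+2\mu)}(-2\mathrm{i} z)^{j+\mu-1}$ if $\mathrm{Re}\,\mu\leq-\frac12$, $\chi_\mu(z):=0$ if $\mathrm{Re}\,\mu>-\frac12$. For $\mu=m+\frac12$ with $m$ a negative integer, $\Gamma(j+\mu-\frac12)/\Gamma(j+2\mu)$ is understood as its limit $2(-1)^{m+1}\Gamma(-j-2m)/\Gamma(-j-m+1)$.
   Formalization: The second displayed form of the integral term, with P(-{μ}, ·), is asserted only when Re{μ} ≠ 1/2: for real half-odd μ it is false (e.g. μ = 1/2, since {-μ} = 1-{μ}), and for nonreal μ with Re{μ} = 1/2 its integral diverges; the main identity is stated for all μ. *)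

(* Defs.v *)
From Stdlib Require Import Reals ZArith.
From Coquelicot Require Import Coquelicot.
Open Scope C_scope.

(** ** Elementary complex functions *)

Definition Cexp (z : C) : C := (exp (Re z) * cos (Im z), exp (Re z) * sin (Im z))%R.

Definition Ccos (z : C) : C := (Cexp (Ci * z) + Cexp (- (Ci * z))) / 2.
Definition Csin (z : C) : C := (Cexp (Ci * z) - Cexp (- (Ci * z))) / (2 * Ci).

(** Principal argument, in (-PI, PI] for z <> 0. *)
Definition Carg (z : C) : R :=
  if Rle_dec 0 (Im z) then acos (Re z / Cmod z) else (- acos (Re z / Cmod z))%R.

Definition Cln (z : C) : C := (ln (Cmod z), Carg z).

(** Principal power z^a; it is meant for z <> 0 only. *)
Definition Cpower (z a : C) : C := Cexp (a * Cln z).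

Definition ipow (a : C) : C := Cexp (Ci * PI * a / 2).

(** The power (-icz)^a for real c > 0, by convention e^(-i PI a/2) c^a z^a with
    principal powers c^a and z^a.  This is the continuation to the whole slit
    plane from the positive z-axis, so it need not be the principal power
    of the number -icz. *)
Definition mipow (c : R) (z a : C) : C := ipow (- a) * Cpower c a * Cpower z a.

(** ** Limits of complex sequences and series *)

Definition CLim_seq (u : nat -> C) : C :=
  (real (Lim_seq (fun n => Re (u n))), real (Lim_seq (fun n => Im (u n)))).

Definition CSeries (a : nat -> C) : C :=
  (Series (fun n => Re (a n)), Series (fun n => Im (a n))).

(** ** Gamma function *)

(** z (z+1) ... (z+n-1) *)
Fixpoint Crising (z : C) (n : nat) : C :=
  match n with
  | O => 1
  | S p => Crising z p * (z + INR p)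
  end.

(** 1/Gamma as an entire function, by Gauss's formula
      1/Gamma(z) = lim z (z+1) ... (z+n) / (n! n^z);
    it vanishes at the poles 0, -1, -2, ... of Gamma. *)
Definition rGamma (z : C) : C :=
  CLim_seq (fun n => Crising z (S n) / (INR (fact n) * Cpower (INR n) z)).

(** At a pole this is the junk value / 0 = 0. *)
Definition Gamma (z : C) : C := / rGamma z.

(** ** Integral and fractional parts *)

(** Nearest integer, ties going down: it is the ceiling of x - 1/2. *)
Definition nearest (x : R) : Z := (- Int_part (1 / 2 - x))%Z.

Definition fpart (mu : C) : C := mu - IZR (nearest (Re mu)).

(** ** Values at the integers by continuity *)

(** Used for quotients by sin(mu PI), whose zeros are exactly the integers, i.e.
    the mu with fpart mu = 0.  [C_lim] is the actual limit only if that limit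
    exists, which [ex_int_ext] expresses. *)
Definition int_ext (f : C -> C) (mu : C) : C :=
  if Ceq_dec (fpart mu) 0 then C_lim f mu else f mu.

Definition ex_int_ext (f : C -> C) (mu : C) : Prop :=
  fpart mu = 0 -> exists l : C, filterlim f (locally' mu) (locally l).

(** ** Bessel and Hankel functions *)

Definition BesselJ (mu z : C) : C :=
  Cpower (z / 2) mu *
  CSeries (fun k => (- (1)) ^ k * (z / 2) ^ (2 * k) / INR (fact k)
                    * rGamma (mu + INR k + 1)).

Definition BesselY (mu z : C) : C :=
  int_ext (fun nu => (BesselJ nu z * Ccos (nu * PI) - BesselJ (- nu) z)
                     / Csin (nu * PI)) mu.

Definition HankelH2 (mu z : C) : C := BesselJ mu z - Ci * BesselY mu z.

(** ** The normalised lower incomplete gamma function *)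

Definition gammastar (a w : C) : C :=
  Cexp (- w) * CSeries (fun k => w ^ k * rGamma (a + INR k + 1)).

(** P(a, -icz) for real c > 0. *)
Definition Pgamma_mi (a : C) (c : R) (z : C) : C :=
  mipow c z a * gammastar a (- Ci * c * z).

(** ** The functions B and chi *)

(** Integral over (0, PI): the integrands below may be unbounded at PI, where
    1 + cos theta vanishes, so that the integral is improper there. *)
Definition CInt_0_PI (f : R -> C) : C :=
  RInt_gen (V := C_R_CompleteNormedModule) f (at_point 0) (at_left PI).

Definition B (mu z : C) : C :=
  ipow mu / PI *
  CInt_0_PI (fun theta =>
    Cexp (- Ci * z * cos theta) * Pgamma_mi (fpart mu) (1 + cos theta) z
    * Ccos (mu * theta)).

(** Gamma(j + mu - 1/2) / Gamma(j + 2 mu) for 1 <= j <= - nearest (Re mu) and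
    Re mu <= -1/2.  Here fpart mu = 1/2 means that mu = m + 1/2 with m a
    (negative) integer; then both factors have poles and the quotient is its limit. *)
Definition chi_ratio (mu : C) (j : nat) : C :=
  if Ceq_dec (fpart mu) (1 / 2) then
    let m := nearest (Re mu) in
    2 * powerRZ (-1) (m + 1)
      * Gamma (- INR j - 2 * IZR m) / Gamma (- INR j - IZR m + 1)
  else Gamma (INR j + mu - 1 / 2) * rGamma (INR j + 2 * mu).

Definition chi (mu z : C) : C :=
  if Rle_dec (Re mu) (- (1 / 2)) then
    ipow mu / sqrt PI * Cexp (Ci * z) *
    sum_n_m (fun j => chi_ratio mu j / Gamma (INR j) * mipow 2 z (INR j + mu - 1))
            1 (Z.to_nat (- nearest (Re mu)))
  else 0.

Definition T_plus (mu : C) : C :=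
  if Rlt_dec (Re mu) 0 then Cexp (Ci * mu * PI) else - (1).

(** ** The two terms of the representation *)

Definition calH2_quot (z nu : C) : C :=
  (Cexp (Ci * nu * PI) * B nu z - B (- nu) z) / Csin (nu * PI).

Definition calH2 (mu z : C) : C := int_ext (calH2_quot z) mu.

Definition chi_quot (z nu : C) : C :=
  T_plus nu * (chi (- nu * sign (Re nu)) z / Csin (nu * PI)).

Definition calH2_integral (z nu : C) : C :=
  ipow nu / (PI * Csin (nu * PI)) *
  CInt_0_PI (fun theta =>
    Cexp (- Ci * z * cos theta)
    * (Cexp (Ci * nu * PI) * Pgamma_mi (fpart nu) (1 + cos theta) z
       - Cexp (- Ci * nu * PI) * Pgamma_mi (- fpart nu) (1 + cos theta) z)
    * Ccos (nu * theta)).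

(* Main.v *)
(** The heart of the proof is the identity [J_mu = B_mu + chi_mu], valid for all [mu] and
    all [z <> 0]. It is inserted in [i H2_mu = (e^(i mu pi) J_mu - J_(-mu)) / sin (mu pi)],
    where [T_plus] picks out the one of [chi_mu] and [chi_(-mu)] that need not vanish.

    Expanding [P] in powers of [z] and integrating termwise by Cauchy's formula for the
    integral of [(1 + cos t)^s cos (mu t)] over [(0, pi)] turns [B_mu] into the terms with
    [l >= - <Re mu>] of Kummer's second formula
      [J_mu(z) = (2z)^mu e^(iz) / sqrt pi
                 * sum_(l >= 0) Gamma(mu+l+1/2) / Gamma(2mu+l+1) (-2iz)^l / l!],
    and [chi_mu] consists of the other terms. Cauchy's formula follows from the
    recurrence [s -> s + 1] given by integration by parts, from the concentration of
    [(1 + cos t)^N] at [t = 0], and from Gauss's limit for [1 / Gamma]. Kummer's formula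
    follows from a recurrence in [mu] of its coefficients that has no exceptional [mu].

    At the integers the numerators vanish, so that the limits exist once the numerators are
    differentiable in [mu]; this is inherited from [1 / Gamma] through expansions with a
    quadratic remainder that are stable under products and series. *)

Require Import Defs.
From Stdlib Require Import Reals ZArith.
From Coquelicot Require Import Coquelicot.
From Stdlib Require Import Lra Lia.
Open Scope C_scope.

(** Two kinds of exceptional [mu] shape the proof. At negative half-integers the Gamma quotients in
    Kummer's formula become indeterminate, and at negative integers the power series of [J_mu] loses
    its first terms. Identities are therefore stated with the entire function [rGamma] and with
    denominators multiplied out, and by the duplication formula each Kummer coefficient is a
    polynomial in [mu] times one value of [rGamma]. All powers of [-iz] are exponentials of the
    single logarithm [log_mi], so that no branches have to be compared between [B] and [chi].
    Convergence of the integrals rests on [Re {mu} > -1/2]: near [PI] the integrand is dominated by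
    a multiple of [(PI - t)^(2 Re {mu})]. The form with [-{mu}] meets the same condition only if
    [Re {mu} <> 1/2], and only then is [{-mu} = -{mu}]. At an integer the limit of the integral term
    is obtained as the limit of the Hankel quotient minus that of the [chi] quotient, so that [mu]
    is never varied under the integral sign: only a power series and finite sums have to be expanded
    in [mu]. *)

Lemma RtoC_neq_0 (x : R) : x <> 0%R -> RtoC x <> 0.
Proof. intros H E. apply H. now apply RtoC_inj. Qed.

Lemma INR_C_neq_0 (n : nat) : n <> 0%nat -> RtoC (INR n) <> 0.
Proof. intros H. apply RtoC_neq_0. now apply not_0_INR. Qed.

Lemma fact_C_neq_0 (n : nat) : RtoC (INR (fact n)) <> 0.
Proof. apply INR_C_neq_0, fact_neq_0. Qed.

Lemma INR_C_S (n : nat) : RtoC (INR (S n)) = INR n + 1.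
Proof. now rewrite S_INR, RtoC_plus. Qed.

Lemma fact_C_S (n : nat) : RtoC (INR (fact (S n))) = (INR n + 1) * INR (fact n).
Proof.
  rewrite <- INR_C_S, <- RtoC_mult, <- mult_INR. reflexivity.
Qed.

Lemma exp_mono (x y : R) : (x <= y)%R -> (exp x <= exp y)%R.
Proof. intros [H| ->]; [left; now apply exp_increasing|right; easy]. Qed.

Lemma Cminus_0_r (x : C) : x - 0 = x.
Proof. ring. Qed.

Lemma Cmod_minus_sym (x y : C) : Cmod (x - y) = Cmod (y - x).
Proof. rewrite <- Cmod_opp. f_equal. ring. Qed.

Lemma Cmod_triangle_minus (x y : C) : (Cmod (x - y) <= Cmod x + Cmod y)%R.
Proof. unfold Cminus. rewrite <- (Cmod_opp y). apply Cmod_triangle. Qed.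

Lemma Cmod_triangle_rev (x y : C) : (Cmod x - Cmod y <= Cmod (x - y))%R.
Proof.
  assert (H := Cmod_triangle (x - y) y).
  replace (x - y + y) with x in H by ring. lra.
Qed.

Lemma Cmod_triangle3 (x y z : C) : (Cmod (x - z) <= Cmod (x - y) + Cmod (y - z))%R.
Proof. replace (x - z) with ((x - y) + (y - z)) by ring. apply Cmod_triangle. Qed.

Lemma im_le_Cmod (c : C) : (Rabs (Im c) <= Cmod c)%R.
Proof.
  eapply Rle_trans; [|apply Rmax_Cmod]. apply Rmax_r.
Qed.

Lemma Cmod_le_Re_Im (c : C) : (Cmod c <= Rabs (Re c) + Rabs (Im c))%R.
Proof.
  destruct c as [a b]; simpl.
  replace (a, b) with (RtoC a + Ci * RtoC b).
  - eapply Rle_trans; [apply Cmod_triangle|].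
    rewrite Cmod_mult, Cmod_Ci, !Cmod_R. lra.
  - apply injective_projections; simpl; ring.
Qed.

(** * Limits of complex functions along a filter *)

(** Stated with [Cmod], whereas the uniform structure of [C] has componentwise balls;
    [tends_filterlim] passes between the two at the cost of a factor [sqrt 2]. *)
Definition tends {T : Type} (F : (T -> Prop) -> Prop) (f : T -> C) (l : C) : Prop :=
  forall eps : R, (0 < eps)%R -> F (fun x => (Cmod (f x - l) < eps)%R).

Lemma tends_const {T} (F : (T -> Prop) -> Prop) {FF : Filter F} (l : C) :
  tends F (fun _ => l) l.
Proof.
  intros eps He. apply filter_forall. intros _.
  replace (l - l) with (RtoC 0) by ring. now rewrite Cmod_0.
Qed.

Lemma tends_eq {T} (F : (T -> Prop) -> Prop) (f : T -> C) (l l' : C) :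
  l = l' -> tends F f l -> tends F f l'.
Proof. now intros <-. Qed.

Lemma tends_ext {T} (F : (T -> Prop) -> Prop) {FF : Filter F} (f g : T -> C) (l : C) :
  F (fun x => f x = g x) -> tends F f l -> tends F g l.
Proof.
  intros E H eps He. specialize (H eps He).
  generalize (filter_and _ _ E H). apply filter_imp.
  intros x [E1 H1]. now rewrite <- E1.
Qed.

Lemma tends_ext_all {T} (F : (T -> Prop) -> Prop) {FF : Filter F} (f g : T -> C) (l : C) :
  (forall x, f x = g x) -> tends F f l -> tends F g l.
Proof. intros E. apply tends_ext; auto. now apply filter_forall. Qed.

Lemma tends_plus {T} (F : (T -> Prop) -> Prop) {FF : Filter F} (f g : T -> C) (a b : C) :
  tends F f a -> tends F g b -> tends F (fun x => f x + g x) (a + b).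
Proof.
  intros Hf Hg eps He.
  assert (He2 : (0 < eps / 2)%R) by lra.
  generalize (filter_and _ _ (Hf _ He2) (Hg _ He2)). apply filter_imp.
  intros x [H1 H2].
  replace (f x + g x - (a + b)) with ((f x - a) + (g x - b)) by ring.
  eapply Rle_lt_trans; [apply Cmod_triangle|]. lra.
Qed.

Lemma tends_opp {T} (F : (T -> Prop) -> Prop) {FF : Filter F} (f : T -> C) (a : C) :
  tends F f a -> tends F (fun x => - f x) (- a).
Proof.
  intros Hf eps He. generalize (Hf _ He). apply filter_imp.
  intros x H1. replace (- f x - - a) with (- (f x - a)) by ring. now rewrite Cmod_opp.
Qed.

Lemma tends_minus {T} (F : (T -> Prop) -> Prop) {FF : Filter F} (f g : T -> C) (a b : C) :
  tends F f a -> tends F g b -> tends F (fun x => f x - g x) (a - b).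
Proof. intros Hf Hg. apply tends_plus; auto. now apply tends_opp. Qed.

Lemma tends_bounded {T} (F : (T -> Prop) -> Prop) {FF : Filter F} (f : T -> C) (a : C) :
  tends F f a -> F (fun x => (Cmod (f x) < Cmod a + 1)%R).
Proof.
  intros Hf. generalize (Hf 1%R Rlt_0_1). apply filter_imp.
  intros x H. assert (H1 := Cmod_triangle_rev (f x) a). lra.
Qed.

Lemma tends_mult {T} (F : (T -> Prop) -> Prop) {FF : Filter F} (f g : T -> C) (a b : C) :
  tends F f a -> tends F g b -> tends F (fun x => f x * g x) (a * b).
Proof.
  intros Hf Hg eps He.
  assert (Ha := Cmod_ge_0 a). assert (Hb := Cmod_ge_0 b).
  set (M := (Cmod a + Cmod b + 1)%R).
  assert (HM : (0 < M)%R) by (unfold M; lra).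
  assert (He2 : (0 < eps / (2 * M))%R) by (apply Rdiv_lt_0_compat; lra).
  generalize (filter_and _ _ (tends_bounded F g b Hg) (filter_and _ _ (Hf _ He2) (Hg _ He2))).
  apply filter_imp. intros x [H0 [H1 H2]].
  replace (f x * g x - a * b) with ((f x - a) * g x + a * (g x - b)) by ring.
  eapply Rle_lt_trans; [apply Cmod_triangle|]. rewrite !Cmod_mult.
  assert (Hg0 := Cmod_ge_0 (g x)). assert (Hf0 := Cmod_ge_0 (f x - a)).
  assert (Hgb := Cmod_ge_0 (g x - b)).
  apply Rle_lt_trans with (Cmod (f x - a) * M + M * Cmod (g x - b))%R.
  - unfold M in *. nra.
  - replace eps with (eps / (2 * M) * M + M * (eps / (2 * M)))%R by (field; lra). nra.
Qed.

Lemma tends_inv {T} (F : (T -> Prop) -> Prop) {FF : Filter F} (f : T -> C) (a : C) :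
  a <> 0 -> tends F f a -> tends F (fun x => / f x) (/ a).
Proof.
  intros Ha Hf eps He.
  assert (Hm : (0 < Cmod a)%R) by now apply Cmod_gt_0.
  assert (H1 : (0 < Cmod a / 2)%R) by lra.
  assert (H2 : (0 < eps * (Cmod a * Cmod a / 2))%R) by (apply Rmult_lt_0_compat; nra).
  generalize (filter_and _ _ (Hf _ H1) (Hf _ H2)). apply filter_imp.
  intros x [K1 K2].
  assert (K3 := Cmod_triangle_rev a (f x)). rewrite Cmod_minus_sym in K3.
  assert (Hfx : f x <> 0) by (apply Cmod_gt_0; lra).
  replace (/ f x - / a) with ((a - f x) * / (f x * a)) by (field; auto).
  rewrite Cmod_mult, Cmod_inv, Cmod_mult, (Cmod_minus_sym a) by now apply Cmult_neq_0.
  assert (K4 : (0 < Cmod (f x) * Cmod a)%R) by nra.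
  apply Rmult_lt_reg_r with (Cmod (f x) * Cmod a)%R; [easy|].
  rewrite Rmult_assoc, Rinv_l, Rmult_1_r by lra.
  eapply Rlt_le_trans; [exact K2|]. apply Rmult_le_compat_l; nra.
Qed.

Lemma tends_div {T} (F : (T -> Prop) -> Prop) {FF : Filter F} (f g : T -> C) (a b : C) :
  b <> 0 -> tends F f a -> tends F g b -> tends F (fun x => f x / g x) (a / b).
Proof. intros Hb Hf Hg. apply tends_mult; auto. now apply tends_inv. Qed.

Lemma tends_unique {T} (F : (T -> Prop) -> Prop) {FF : ProperFilter F} (f : T -> C) (a b : C) :
  tends F f a -> tends F f b -> a = b.
Proof.
  intros Ha Hb. destruct (Ceq_dec a b) as [E|E]; [easy|exfalso].
  assert (H : (0 < Cmod (a - b) / 2)%R).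
  { assert (0 < Cmod (a - b))%R; [|lra]. apply Cmod_gt_0. now apply Cminus_eq_contra. }
  destruct (filter_ex _ (filter_and _ _ (Ha _ H) (Hb _ H))) as [x [H1 H2]].
  assert (H3 := Cmod_triangle3 a (f x) b). rewrite (Cmod_minus_sym a (f x)) in H3. lra.
Qed.

Lemma tends_le {T} (F : (T -> Prop) -> Prop) {FF : ProperFilter F} (f : T -> C) (a b : C) (M : R) :
  tends F f a -> F (fun x => (Cmod (f x - b) <= M)%R) -> (Cmod (a - b) <= M)%R.
Proof.
  intros Ha Hb. apply Rnot_lt_le. intros H.
  assert (H' : (0 < Cmod (a - b) - M)%R) by lra.
  destruct (filter_ex _ (filter_and _ _ (Ha _ H') Hb)) as [x [H1 H2]].
  assert (H3 := Cmod_triangle3 a (f x) b). rewrite (Cmod_minus_sym a (f x)) in H3. lra.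
Qed.

Lemma tends_squeeze {T} (F : (T -> Prop) -> Prop) {FF : Filter F} (f : T -> C) (g : T -> R) (l : C) :
  F (fun x => (Cmod (f x - l) <= g x)%R) -> filterlim g F (locally 0%R) -> tends F f l.
Proof.
  intros H Hg eps He.
  assert (K : F (fun x => ball 0%R (mkposreal eps He) (g x))) by (apply Hg; now apply locally_ball).
  generalize (filter_and _ _ H K). apply filter_imp. intros x [H1 H2].
  change (Rabs (g x - 0) < eps)%R in H2.
  assert (H3 := Rle_abs (g x - 0)). lra.
Qed.

Lemma tends_filterlim {T} (F : (T -> Prop) -> Prop) {FF : Filter F} (f : T -> C) (l : C) :
  tends F f l <-> filterlim f F (locally l).
Proof.
  split.
  - intros H. apply filterlim_locally. intros eps.
    generalize (H eps (cond_pos eps)). apply filter_imp. intros x Hx.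
    apply C_NormedModule_mixin_compat1. exact Hx.
  - intros H eps He.
    assert (H2 : (0 < eps / sqrt 2)%R) by (apply Rdiv_lt_0_compat; [easy|apply Rlt_sqrt2_0]).
    assert (K := proj1 (filterlim_locally f l) H (mkposreal _ H2)).
    revert K. apply filter_imp. intros x Hx.
    assert (K := C_NormedModule_mixin_compat2 _ _ _ Hx). simpl in K.
    replace (sqrt 2 * (eps / sqrt 2))%R with eps in K; [exact K|].
    field. apply Rgt_not_eq, Rlt_sqrt2_0.
Qed.

Lemma locally_Cmod (a : C) (P : C -> Prop) :
  (exists d : R, (0 < d)%R /\ forall x, (Cmod (x - a) < d)%R -> P x) -> locally a P.
Proof.
  intros [d [Hd H]].
  assert (K := proj2 (tends_filterlim (locally a) (fun x => x) a) (filterlim_id _ _) d Hd).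
  revert K. apply filter_imp. exact H.
Qed.

Lemma locally_of_Cmod (a : C) (P : C -> Prop) :
  locally a P -> exists d : R, (0 < d)%R /\ forall x, (Cmod (x - a) < d)%R -> P x.
Proof.
  intros [d H]. exists d. split; [apply cond_pos|]. intros x Hx. apply H.
  now apply C_NormedModule_mixin_compat1.
Qed.

Lemma locally'_Cmod (a : C) (P : C -> Prop) :
  (exists d : R, (0 < d)%R /\ forall x, (Cmod (x - a) < d)%R -> x <> a -> P x) -> locally' a P.
Proof.
  intros [d [Hd H]]. unfold locally', within. apply locally_Cmod. now exists d.
Qed.

Lemma tends_comp {T U} (F : (T -> Prop) -> Prop) (G : (U -> Prop) -> Prop) {FF : Filter F}
    (f : T -> U) (g : U -> C) (l : C) :
  filterlim f F G -> tends G g l -> tends F (fun x => g (f x)) l.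
Proof. intros Hf Hg eps He. exact (Hf _ (Hg eps He)). Qed.

Lemma tends_Re {T} (F : (T -> Prop) -> Prop) {FF : Filter F} (f : T -> C) (l : C) :
  tends F f l -> filterlim (fun x => Re (f x)) F (locally (Re l)).
Proof.
  intros H. apply filterlim_locally. intros eps.
  generalize (H eps (cond_pos eps)). apply filter_imp. intros x Hx.
  change (Rabs (Re (f x) - Re l) < eps)%R. eapply Rle_lt_trans; [|exact Hx].
  apply (re_le_Cmod (f x - l)).
Qed.

Lemma tends_Im {T} (F : (T -> Prop) -> Prop) {FF : Filter F} (f : T -> C) (l : C) :
  tends F f l -> filterlim (fun x => Im (f x)) F (locally (Im l)).
Proof.
  intros H. apply filterlim_locally. intros eps.
  generalize (H eps (cond_pos eps)). apply filter_imp. intros x Hx.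
  change (Rabs (Im (f x) - Im l) < eps)%R. eapply Rle_lt_trans; [|exact Hx].
  apply (im_le_Cmod (f x - l)).
Qed.

Lemma tends_pair {T} (F : (T -> Prop) -> Prop) {FF : Filter F} (f g : T -> R) (a b : R) :
  filterlim f F (locally a) -> filterlim g F (locally b) -> tends F (fun x => (f x, g x)) (a, b).
Proof.
  intros Hf Hg eps He. assert (He2 : (0 < eps / 2)%R) by lra.
  assert (K1 := proj1 (filterlim_locally f a) Hf (mkposreal _ He2)).
  assert (K2 := proj1 (filterlim_locally g b) Hg (mkposreal _ He2)).
  generalize (filter_and _ _ K1 K2). apply filter_imp. intros x [H1 H2].
  change (Rabs (f x - a) < eps / 2)%R in H1. change (Rabs (g x - b) < eps / 2)%R in H2.
  eapply Rle_lt_trans; [apply Cmod_le_Re_Im|]. simpl.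
  unfold Rminus in *. lra.
Qed.

Lemma tends_RtoC {T} (F : (T -> Prop) -> Prop) {FF : Filter F} (f : T -> R) (a : R) :
  filterlim f F (locally a) -> tends F (fun x => RtoC (f x)) a.
Proof. intros H. apply tends_pair; auto. apply filterlim_const. Qed.

(** * Limits and series of complex numbers, by real and imaginary parts *)

Lemma tends_CLim_seq (u : nat -> C) (l : C) : tends eventually u l -> CLim_seq u = l.
Proof.
  intros H. unfold CLim_seq.
  rewrite (is_lim_seq_unique _ (Re l)) by exact (tends_Re _ _ _ H).
  rewrite (is_lim_seq_unique _ (Im l)) by exact (tends_Im _ _ _ H).
  destruct l; reflexivity.
Qed.

Lemma is_series_tends (a : nat -> C) (l : C) : is_series a l <-> tends eventually (sum_n a) l.
Proof. symmetry. apply tends_filterlim. apply _. Qed.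

Lemma sum_n_S_R (a : nat -> R) (n : nat) : sum_n a (S n) = (sum_n a n + a (S n))%R.
Proof. exact (sum_Sn a n). Qed.

Lemma sum_n_S_C (a : nat -> C) (n : nat) : sum_n a (S n) = sum_n a n + a (S n).
Proof. exact (sum_Sn a n). Qed.

Lemma sum_n_0_R (a : nat -> R) : sum_n a 0 = a 0%nat.
Proof. exact (sum_O a). Qed.

Lemma sum_n_0_C (a : nat -> C) : sum_n a 0 = a 0%nat.
Proof. exact (sum_O a). Qed.

Lemma Re_sum_n (a : nat -> C) n : Re (sum_n a n) = sum_n (fun k => Re (a k)) n.
Proof.
  induction n; [now rewrite sum_n_0_C, sum_n_0_R|].
  now rewrite sum_n_S_C, sum_n_S_R, <- IHn.
Qed.

Lemma Im_sum_n (a : nat -> C) n : Im (sum_n a n) = sum_n (fun k => Im (a k)) n.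
Proof.
  induction n; [now rewrite sum_n_0_C, sum_n_0_R|].
  now rewrite sum_n_S_C, sum_n_S_R, <- IHn.
Qed.

Lemma is_series_Re (a : nat -> C) (l : C) : is_series a l -> is_series (fun k => Re (a k)) (Re l).
Proof.
  intros H%is_series_tends%tends_Re; [|apply _].
  eapply filterlim_ext; [|exact H]. intros n. apply Re_sum_n.
Qed.

Lemma is_series_Im (a : nat -> C) (l : C) : is_series a l -> is_series (fun k => Im (a k)) (Im l).
Proof.
  intros H%is_series_tends%tends_Im; [|apply _].
  eapply filterlim_ext; [|exact H]. intros n. apply Im_sum_n.
Qed.

Lemma is_series_pair (a : nat -> C) (x y : R) :
  is_series (fun k => Re (a k)) x -> is_series (fun k => Im (a k)) y -> is_series a (x, y).
Proof.
  intros H1 H2. apply is_series_tends.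
  eapply tends_ext_all; [apply _| |apply (tends_pair _ _ _ _ _ H1 H2)].
  intros n. simpl. rewrite <- Re_sum_n, <- Im_sum_n. now destruct (sum_n a n).
Qed.

Lemma is_series_CSeries (a : nat -> C) (l : C) : is_series a l -> CSeries a = l.
Proof.
  intros H. unfold CSeries.
  rewrite (is_series_unique _ _ (is_series_Re _ _ H)).
  rewrite (is_series_unique _ _ (is_series_Im _ _ H)). now destruct l.
Qed.

Lemma ex_series_C_le (a : nat -> C) (b : nat -> R) :
  (forall n, (Cmod (a n) <= b n)%R) -> ex_series b -> exists l : C, is_series a l.
Proof.
  intros H Hb. apply (@ex_series_le C_AbsRing C_CompleteNormedModule a b); auto.
Qed.

Lemma is_series_C_unique (a : nat -> C) (l l' : C) : is_series a l -> is_series a l' -> l = l'.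
Proof. intros H H'. rewrite <- (is_series_CSeries _ _ H). now apply is_series_CSeries. Qed.

(** * The complex exponential *)

Lemma C_ext (a b : C) : Re a = Re b -> Im a = Im b -> a = b.
Proof. intros; now apply injective_projections. Qed.

Lemma Cexp_plus (a b : C) : Cexp (a + b) = Cexp a * Cexp b.
Proof.
  destruct a as [a1 a2], b as [b1 b2]. unfold Cexp; simpl.
  rewrite exp_plus, cos_plus, sin_plus. apply C_ext; simpl; ring.
Qed.

Lemma Cexp_RtoC (x : R) : Cexp x = exp x.
Proof. unfold Cexp; simpl. rewrite cos_0, sin_0. apply C_ext; simpl; ring. Qed.

Lemma Cexp_0 : Cexp 0 = 1.
Proof. now rewrite Cexp_RtoC, exp_0. Qed.

Lemma Cmod_Cexp (a : C) : Cmod (Cexp a) = exp (Re a).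
Proof.
  replace (Cexp a) with (RtoC (exp (Re a)) * (cos (Im a), sin (Im a))).
  2:{ unfold Cexp. apply C_ext; simpl; ring. }
  rewrite Cmod_mult, Cmod_R, Rabs_pos_eq by (left; apply exp_pos).
  assert (E : Cmod (cos (Im a), sin (Im a)) = 1%R); [|rewrite E; ring].
  unfold Cmod; simpl.
  rewrite !Rmult_1_r. assert (H := sin2_cos2 (Im a)). unfold Rsqr in H.
  replace (cos (Im a) * cos (Im a) + sin (Im a) * sin (Im a))%R with 1%R by lra.
  apply sqrt_1.
Qed.

Lemma Cexp_neq_0 (a : C) : Cexp a <> 0.
Proof. apply Cmod_gt_0. rewrite Cmod_Cexp. apply exp_pos. Qed.

Lemma Cexp_opp (a : C) : Cexp (- a) = / Cexp a.
Proof.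
  assert (H : Cexp a * Cexp (- a) = 1).
  { rewrite <- Cexp_plus. replace (a + - a) with (RtoC 0) by ring. apply Cexp_0. }
  replace (Cexp (-a)) with (/ Cexp a * (Cexp a * Cexp (-a))) by (field; apply Cexp_neq_0).
  rewrite H. ring.
Qed.

Lemma Cexp_minus (a b : C) : Cexp (a - b) = Cexp a / Cexp b.
Proof. unfold Cminus, Cdiv. now rewrite Cexp_plus, Cexp_opp. Qed.

Lemma Cexp_pow (a : C) (n : nat) : Cexp a ^ n = Cexp (INR n * a).
Proof.
  induction n.
  - simpl. rewrite Cmult_0_l, Cexp_0. reflexivity.
  - rewrite Cpow_S, IHn, <- Cexp_plus. f_equal. rewrite INR_C_S. ring.
Qed.

Lemma Cmod_Cexp_le (a : C) : (Cmod (Cexp a) <= exp (Cmod a))%R.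
Proof.
  rewrite Cmod_Cexp. apply exp_mono. eapply Rle_trans; [apply Rle_abs|apply re_le_Cmod].
Qed.

(** * Functions of a real variable with complex values *)

Lemma is_derive_Rplus (u v : R -> R) (t du dv : R) :
  is_derive u t du -> is_derive v t dv -> is_derive (fun x => (u x + v x)%R) t (du + dv)%R.
Proof. intros Hu Hv. now apply @is_derive_plus. Qed.

Lemma is_derive_Rminus (u v : R -> R) (t du dv : R) :
  is_derive u t du -> is_derive v t dv -> is_derive (fun x => (u x - v x)%R) t (du - dv)%R.
Proof. intros Hu Hv. now apply @is_derive_minus. Qed.

Lemma is_derive_Rmult (u v : R -> R) (t du dv : R) :
  is_derive u t du -> is_derive v t dv ->
  is_derive (fun x => (u x * v x)%R) t (du * v t + u t * dv)%R.
Proof. intros Hu Hv. apply @is_derive_mult; auto. intros; apply Rmult_comm. Qed.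

(** Taken componentwise, which reduces the rules of calculation to the real ones. The mean value
    theorem does not pass to complex values in this way, hence the inequality
    [Cderiv_increment_le]. *)
Definition Cderiv (f : R -> C) (t : R) (d : C) : Prop :=
  is_derive (fun x => Re (f x)) t (Re d) /\ is_derive (fun x => Im (f x)) t (Im d).

Lemma Cderiv_eq (f : R -> C) (t : R) (d d' : C) : d = d' -> Cderiv f t d -> Cderiv f t d'.
Proof. now intros <-. Qed.

Lemma Cderiv_ext (f g : R -> C) (t : R) (d : C) :
  (forall x, f x = g x) -> Cderiv f t d -> Cderiv g t d.
Proof.
  intros E [H1 H2]; split; (eapply is_derive_ext; [|eassumption]); intros x; simpl; now rewrite E.
Qed.

Lemma Cderiv_const (c : C) (t : R) : Cderiv (fun _ => c) t 0.
Proof. split; simpl; apply @is_derive_const. Qed.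

Lemma Cderiv_RtoC (f : R -> R) (t d : R) : is_derive f t d -> Cderiv (fun x => RtoC (f x)) t d.
Proof. intros H; split; simpl; [exact H|]. apply @is_derive_const. Qed.

Lemma Cderiv_plus (f g : R -> C) (t : R) (a b : C) :
  Cderiv f t a -> Cderiv g t b -> Cderiv (fun x => f x + g x) t (a + b).
Proof. intros [H1 H2] [H3 H4]; split; simpl; now apply is_derive_Rplus. Qed.

Lemma Cderiv_opp (f : R -> C) (t : R) (a : C) :
  Cderiv f t a -> Cderiv (fun x => - f x) t (- a).
Proof. intros [H1 H2]; split; simpl; now apply @is_derive_opp. Qed.

Lemma Cderiv_minus (f g : R -> C) (t : R) (a b : C) :
  Cderiv f t a -> Cderiv g t b -> Cderiv (fun x => f x - g x) t (a - b).
Proof. intros Hf Hg. apply Cderiv_plus; auto. now apply Cderiv_opp. Qed.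

Lemma Cderiv_mult (f g : R -> C) (t : R) (a b : C) :
  Cderiv f t a -> Cderiv g t b -> Cderiv (fun x => f x * g x) t (a * g t + f t * b).
Proof.
  intros [H1 H2] [H3 H4]; split.
  - replace (Re (a * g t + f t * b))
      with ((Re a * Re (g t) + Re (f t) * Re b) - (Im a * Im (g t) + Im (f t) * Im b))%R
      by (unfold Re, Im; simpl; ring).
    apply (is_derive_Rminus (fun x => Re (f x) * Re (g x))%R (fun x => Im (f x) * Im (g x))%R);
      now apply is_derive_Rmult.
  - replace (Im (a * g t + f t * b))
      with ((Re a * Im (g t) + Re (f t) * Im b) + (Im a * Re (g t) + Im (f t) * Re b))%R
      by (unfold Re, Im; simpl; ring).
    apply (is_derive_Rplus (fun x => Re (f x) * Im (g x))%R (fun x => Im (f x) * Re (g x))%R);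
      now apply is_derive_Rmult.
Qed.

Lemma Cderiv_Cexp (f : R -> C) (t : R) (a : C) :
  Cderiv f t a -> Cderiv (fun x => Cexp (f x)) t (a * Cexp (f t)).
Proof.
  assert (E : forall (u v : R -> R) du dv, is_derive u t du -> is_derive v t dv ->
     is_derive (fun x => exp (u x) * cos (v x))%R t
       (du * (exp (u t) * cos (v t)) - dv * (exp (u t) * sin (v t)))%R /\
     is_derive (fun x => exp (u x) * sin (v x))%R t
       (du * (exp (u t) * sin (v t)) + dv * (exp (u t) * cos (v t)))%R).
  { intros u v du dv Hu Hv.
    split; (auto_derive; [split; [now exists du|]; split; [now exists dv|easy]|]);
      assert (Eu : Derive (fun x => u x) t = du) by exact (is_derive_unique _ _ _ Hu);
      assert (Ev : Derive (fun x => v x) t = dv) by exact (is_derive_unique _ _ _ Hv);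
      rewrite Eu, Ev; ring. }
  intros [H1 H2]. destruct (E _ _ _ _ H1 H2) as [K1 K2]. split.
  - exact K1.
  - replace (Im (a * Cexp (f t))) with (Re a * (exp (Re (f t)) * sin (Im (f t)))
       + Im a * (exp (Re (f t)) * cos (Im (f t))))%R; [exact K2|].
    unfold Cexp, Re, Im; simpl; ring.
Qed.

(** * The mean value inequality and the Taylor remainders of the exponential *)

Lemma Cmod_dot_le (a b : C) : (Re a * Re b + Im a * Im b <= Cmod a * Cmod b)%R.
Proof.
  assert (K := re_le_Cmod (Cconj a * b)). rewrite Cmod_mult, Cmod_conj in K.
  assert (K2 := Rle_abs (Re (Cconj a * b))).
  replace (Re a * Re b + Im a * Im b)%R with (Re (Cconj a * b)); [lra|].
  unfold Re, Im; simpl; ring.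
Qed.

Lemma is_derive_nonneg_le (g dg : R -> R) (a b : R) : (a <= b)%R ->
  (forall t, (a <= t <= b)%R -> is_derive g t (dg t)) ->
  (forall t, (a <= t <= b)%R -> (0 <= dg t)%R) -> (g a <= g b)%R.
Proof.
  intros Hab Hg Hd.
  destruct (MVT_gen g a b dg) as [c [Hc1 Hc2]]; rewrite Rmin_left, Rmax_right in * by easy.
  - intros x Hx. apply Hg. lra.
  - intros x Hx. apply derivable_continuous_pt. exists (dg x). apply is_derive_Reals, Hg. lra.
  - specialize (Hd c Hc1). assert (0 <= dg c * (b - a))%R by (apply Rmult_le_pos; lra). lra.
Qed.

(* Project on the direction of [f b - f a] to reduce to a real function. *)
Lemma Cderiv_increment_le (f df : R -> C) (g dg : R -> R) (a b : R) :
  (a <= b)%R ->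
  (forall t, (a <= t <= b)%R -> Cderiv f t (df t)) ->
  (forall t, (a <= t <= b)%R -> is_derive g t (dg t)) ->
  (forall t, (a <= t <= b)%R -> (Cmod (df t) <= dg t)%R) ->
  (Cmod (f b - f a) <= g b - g a)%R.
Proof.
  intros Hab Hf Hg Hle. set (D := f b - f a).
  destruct (Rle_lt_or_eq_dec 0 (Cmod D) (Cmod_ge_0 _)) as [HD|HD].
  - assert (K : (Cmod D * g a - (Re D * Re (f a) + Im D * Im (f a)) <=
                 Cmod D * g b - (Re D * Re (f b) + Im D * Im (f b)))%R).
    { apply (is_derive_nonneg_le (fun t => Cmod D * g t - (Re D * Re (f t) + Im D * Im (f t)))%R
        (fun t => Cmod D * dg t - (Re D * Re (df t) + Im D * Im (df t)))%R); [easy| |].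
      - intros t Ht. destruct (Hf t Ht) as [H1 H2]. specialize (Hg t Ht).
        apply is_derive_Rminus; [|apply is_derive_Rplus]; now apply is_derive_scal.
      - intros t Ht. assert (K := Cmod_dot_le D (df t)). specialize (Hle t Ht).
        assert (Cmod D * Cmod (df t) <= Cmod D * dg t)%R by (apply Rmult_le_compat_l; lra). lra. }
    assert (Q := Cmod2_alt D).
    replace (Re D ^ 2 + Im D ^ 2)%R with
      ((Re D * Re (f b) + Im D * Im (f b)) - (Re D * Re (f a) + Im D * Im (f a)))%R in Q
      by (unfold D, Re, Im; simpl; ring).
    nra.
  - rewrite <- HD. assert (g a <= g b)%R; [|lra]. apply (is_derive_nonneg_le g dg); [easy|easy|].
    intros t Ht. eapply Rle_trans; [|apply (Hle t Ht)]. apply Cmod_ge_0.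
Qed.

(* [Cexp_poly n] has [n] terms, hence degree [n - 1]. *)
Fixpoint Cexp_poly (n : nat) (w : C) : C :=
  match n with
  | O => 0
  | S p => Cexp_poly p w + w ^ p / INR (fact p)
  end.

Lemma Cexp_poly_sum_n (n : nat) (w : C) :
  Cexp_poly (S n) w = sum_n (fun k => w ^ k / INR (fact k)) n.
Proof.
  induction n.
  - rewrite sum_O. cbn [Cexp_poly]. ring.
  - rewrite sum_Sn, <- IHn. reflexivity.
Qed.

Lemma Cderiv_pow_scal (w : C) (n : nat) (t : R) :
  Cderiv (fun x => (x * w) ^ n) t (INR n * w * (t * w) ^ (pred n)).
Proof.
  induction n.
  - simpl. eapply Cderiv_eq; [|apply Cderiv_const]. ring.
  - eapply Cderiv_ext; [intros x; symmetry; apply Cpow_S|].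
    eapply Cderiv_eq;
      [|apply Cderiv_mult; [apply Cderiv_mult;
         [apply Cderiv_RtoC, @is_derive_id|apply Cderiv_const]|exact IHn]].
    change (one : R) with 1%R. destruct n; [cbn [pred Cpow INR]; ring|].
    simpl pred. rewrite !INR_C_S. rewrite (Cpow_S (t * w) n). cbv beta; ring.
Qed.

Lemma Cderiv_Cexp_poly (w : C) (n : nat) (t : R) :
  Cderiv (fun x => Cexp_poly (S n) (x * w)) t (w * Cexp_poly n (t * w)).
Proof.
  induction n.
  - apply (Cderiv_ext (fun _ => RtoC 1)).
    + intros x; simpl. field.
    + eapply Cderiv_eq; [|apply Cderiv_const]. simpl. ring.
  - eapply Cderiv_ext with (f := fun x => Cexp_poly (S n) (x * w) + (x * w) ^ (S n) * / INR (fact (S n))).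
    { intros x. reflexivity. }
    eapply Cderiv_eq; [|apply Cderiv_plus; [exact IHn|apply Cderiv_mult; [apply Cderiv_pow_scal|apply Cderiv_const]]].
    cbn [Cexp_poly pred]. rewrite fact_C_S, <- INR_C_S. field.
    split; [apply fact_C_neq_0|apply INR_C_neq_0; lia].
Qed.

(** Induction on [n] along the segment from [0] to [w]: the derivative in [t] of a remainder is [w]
    times the preceding remainder, and the mean value inequality integrates the bound. *)
Lemma Cexp_taylor_segment (w : C) (n : nat) (t : R) : (0 <= t <= 1)%R ->
  (Cmod (Cexp (t * w) - Cexp_poly n (t * w))
    <= (t * Cmod w) ^ n / INR (fact n) * exp (Cmod w))%R.
Proof.
  revert t. induction n; intros t Ht.
  - simpl. replace (Cexp (t * w) - 0) with (Cexp (t * w)) by ring.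
    replace (1 / 1 * exp (Cmod w))%R with (exp (Cmod w)) by field.
    eapply Rle_trans; [apply Cmod_Cexp_le|]. apply exp_mono.
    rewrite Cmod_mult, Cmod_R, Rabs_pos_eq by lra. assert (H := Cmod_ge_0 w). nra.
  - assert (H0 : Cexp (RtoC 0 * w) - Cexp_poly (S n) (RtoC 0 * w) = 0).
    { rewrite Cmult_0_l, Cexp_0. clear. induction n.
      - simpl. field.
      - cbn [Cexp_poly] in *. rewrite Cpow_S.
        replace (1 - (Cexp_poly n 0 + 0 ^ n / INR (fact n) + 0 * 0 ^ n / INR (fact (S n))))
          with (1 - (Cexp_poly n 0 + 0 ^ n / INR (fact n))).
        exact IHn. field; split; apply fact_C_neq_0. }
    assert (K := Cderiv_increment_le
       (fun x => Cexp (x * w) - Cexp_poly (S n) (x * w))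
       (fun x => w * (Cexp (x * w) - Cexp_poly n (x * w)))
       (fun x => (x * Cmod w) ^ (S n) / INR (fact (S n)) * exp (Cmod w))%R
       (fun x => Cmod w * ((x * Cmod w) ^ n / INR (fact n) * exp (Cmod w)))%R 0 t).
    cbv beta in K. rewrite H0 in K.
    replace ((0 * Cmod w) ^ S n / INR (fact (S n)) * exp (Cmod w))%R with 0%R in K
      by (rewrite Rmult_0_l, pow_i by lia; unfold Rdiv; ring).
    rewrite Rminus_0_r in K.
    replace (Cexp (t * w) - Cexp_poly (S n) (t * w) - 0)
      with (Cexp (t * w) - Cexp_poly (S n) (t * w)) in K by ring.
    apply K; [lra| | |].
    + intros x Hx. eapply Cderiv_eq; [|apply Cderiv_minus;
        [apply Cderiv_Cexp, Cderiv_mult; [apply Cderiv_RtoC, @is_derive_id|apply Cderiv_const]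
        |apply Cderiv_Cexp_poly]].
      change (one : R) with 1%R. cbv beta. ring.
    + intros x Hx. auto_derive; [easy|].
      change (fact n + n * fact n)%nat with (fact (S n)).
      replace (INR (fact (S n))) with ((INR n + 1) * INR (fact n))%R
        by (rewrite <- S_INR, <- mult_INR; reflexivity).
      change (match n with 0%nat => 1 | S _ => INR n + 1 end)%R with (INR (S n)).
      rewrite S_INR. field. split; [apply not_0_INR, fact_neq_0|].
      rewrite <- S_INR. apply not_0_INR; lia.
    + intros x Hx. rewrite Cmod_mult. apply Rmult_le_compat_l; [apply Cmod_ge_0|].
      apply IHn. lra.
Qed.

Lemma Cexp_taylor (w : C) (n : nat) :
  (Cmod (Cexp w - Cexp_poly n w) <= Cmod w ^ n / INR (fact n) * exp (Cmod w))%R.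
Proof.
  assert (H := Cexp_taylor_segment w n 1). rewrite Cmult_1_l, Rmult_1_l in H. apply H; lra.
Qed.

Lemma Cexp_series (w : C) : is_series (fun k => w ^ k / INR (fact k)) (Cexp w).
Proof.
  apply is_series_tends.
  apply tends_squeeze with (g := fun n => (Cmod w ^ S n / INR (fact (S n)) * exp (Cmod w))%R); [apply _| |].
  - apply filter_forall. intros n. rewrite <- Cexp_poly_sum_n, Cmod_minus_sym. apply Cexp_taylor.
  - change (is_lim_seq (fun n => (Cmod w ^ S n / INR (fact (S n)) * exp (Cmod w))%R) 0).
    apply (is_lim_seq_incr_1 (fun n => (Cmod w ^ n / INR (fact n) * exp (Cmod w))%R)).
    replace (Finite 0) with (Rbar_mult 0 (exp (Cmod w))) by (simpl; f_equal; ring).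
    apply is_lim_seq_scal_r. apply is_lim_seq_Reals. apply cv_speed_pow_fact.
Qed.

Lemma Cexp_minus_1_le (w : C) : (Cmod (Cexp w - 1) <= Cmod w * exp (Cmod w))%R.
Proof.
  assert (H := Cexp_taylor w 1). simpl in H.
  replace (Cexp w - (0 + 1 / 1)) with (Cexp w - 1) in H by field.
  replace (Cmod w * 1 / 1)%R with (Cmod w) in H by field. exact H.
Qed.

Lemma Cexp_minus_2_le (w : C) :
  (Cmod (Cexp w - 1 - w) <= Cmod w ^ 2 / 2 * exp (Cmod w))%R.
Proof.
  assert (H := Cexp_taylor w 2). simpl in H.
  replace (Cexp w - (0 + 1 / 1 + w * 1 / 1)) with (Cexp w - 1 - w) in H by field.
  simpl. exact H.
Qed.

Lemma Cexp_continuous (a : C) : tends (locally a) Cexp (Cexp a).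
Proof.
  intros eps He. apply locally_Cmod.
  set (M := (Cmod (Cexp a) * exp 1)%R).
  assert (HM : (0 < M)%R) by (unfold M; rewrite Cmod_Cexp; apply Rmult_lt_0_compat; apply exp_pos).
  exists (Rmin 1 (eps / M)). split.
  - apply Rmin_pos; [lra|]. now apply Rdiv_lt_0_compat.
  - intros x Hx. assert (H1 := Rmin_l 1 (eps / M)). assert (H2 := Rmin_r 1 (eps / M)).
    replace (Cexp x - Cexp a) with (Cexp a * (Cexp (x - a) - 1)).
    2:{ rewrite Cexp_minus. field. apply Cexp_neq_0. }
    rewrite Cmod_mult.
    assert (K := Cexp_minus_1_le (x - a)).
    assert (K2 : (exp (Cmod (x - a)) <= exp 1)%R) by (apply exp_mono; lra).
    assert (K3 := Cmod_ge_0 (x - a)). assert (K4 := exp_pos (Cmod (x - a))).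
    assert (K5 := Cmod_ge_0 (Cexp a)).
    apply Rle_lt_trans with (M * Cmod (x - a))%R.
    + unfold M. rewrite Rmult_assoc. apply Rmult_le_compat_l; [easy|].
      eapply Rle_trans; [exact K|]. rewrite Rmult_comm. apply Rmult_le_compat_r; easy.
    + replace eps with (M * (eps / M))%R by (field; lra). apply Rmult_lt_compat_l; lra.
Qed.

Lemma tends_Cexp {T} (F : (T -> Prop) -> Prop) {FF : Filter F} (f : T -> C) (a : C) :
  tends F f a -> tends F (fun x => Cexp (f x)) (Cexp a).
Proof.
  intros H. apply (tends_comp F (locally a)); [|apply Cexp_continuous].
  now apply (proj1 (tends_filterlim F f a)).
Qed.

(** * Infinite products *)

Fixpoint Cprod (a : nat -> C) (n : nat) : C :=
  match n with
  | O => 1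
  | S p => Cprod a p * (1 + a p)
  end.

Lemma ex_series_scal_R (c : R) (a : nat -> R) : ex_series a -> ex_series (fun k => c * a k)%R.
Proof. exact (ex_series_scal c a). Qed.

(** Compared with the telescoping series of [2 / ((j + 1) (j + 2))]. *)
Lemma ex_series_inv_sq : ex_series (fun j => / (INR j + 1) ^ 2)%R.
Proof.
  apply (@ex_series_le R_AbsRing R_CompleteNormedModule) with
    (b := fun j => (2 * (/ (INR j + 1) - / (INR j + 2)))%R).
  - intros n. assert (H := pos_INR n). change norm with Rabs.
    rewrite Rabs_pos_eq.
    + assert (E : (2 * (/ (INR n + 1) - / (INR n + 2)) - / (INR n + 1) ^ 2
          = INR n * / ((INR n + 1) ^ 2 * (INR n + 2)))%R) by (field; lra).
      assert (0 <= INR n * / ((INR n + 1) ^ 2 * (INR n + 2)))%R; [|lra].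
      apply Rmult_le_pos; [easy|]. left. apply Rinv_0_lt_compat.
      apply Rmult_lt_0_compat; [apply pow_lt|]; lra.
    + left. apply Rinv_0_lt_compat, pow_lt. lra.
  - exists 2%R.
    assert (E : forall n, sum_n (fun j => (2 * (/ (INR j + 1) - / (INR j + 2)))%R) n
              = (2 - 2 * / (INR n + 2))%R).
    { intros n. induction n.
      - rewrite sum_n_0_R. simpl. field.
      - rewrite sum_n_S_R, IHn, S_INR. match goal with |- ?a = ?b => change (@eq R a b) end.
        assert (H := pos_INR n). field. lra. }
    unfold is_series.
    apply (filterlim_ext (fun n => (2 - 2 * / (INR n + 2))%R)); [intros; now rewrite E|].
    change (is_lim_seq (fun n => (2 - 2 * / (INR n + 2))%R) 2).
    replace (Finite 2) with (Rbar_minus 2 (Rbar_mult 2 0)) by (simpl; f_equal; ring).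
    eapply is_lim_seq_minus'; [apply is_lim_seq_const|].
    replace (2 * 0)%R with (real (Rbar_mult 2 0)) by reflexivity.
    apply (is_lim_seq_scal_l (fun n => / (INR n + 2))%R 2 0).
    replace (Finite 0) with (Rbar_inv p_infty) by reflexivity.
    apply is_lim_seq_inv; [|easy].
    eapply is_lim_seq_plus; [apply is_lim_seq_INR|apply is_lim_seq_const|reflexivity].
Qed.

Lemma sum_n_le_series (b : nat -> R) (n : nat) :
  (forall k, (0 <= b k)%R) -> ex_series b -> (sum_n b n <= Series b)%R.
Proof.
  intros Hb H. apply (is_lim_seq_incr_compare (sum_n b)).
  - exact (Series_correct _ H).
  - intros k. rewrite sum_n_S_R. specialize (Hb (S k)). lra.
Qed.

(** Each factor satisfies [|1 + a| <= exp |a|], so that all partial products share one bound. *)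
Lemma Cprod_bound (a : nat -> C) : ex_series (fun k => Cmod (a k)) ->
  forall n, (Cmod (Cprod a n) <= exp (Series (fun k => Cmod (a k))))%R.
Proof.
  intros H n.
  assert (K : forall m, (Cmod (Cprod a (S m)) <= exp (sum_n (fun k => Cmod (a k)) m))%R).
  { assert (Q : forall k, (Cmod (1 + a k) <= exp (Cmod (a k)))%R).
    { intros k. eapply Rle_trans; [apply Cmod_triangle|]. rewrite Cmod_1. apply exp_ineq1_le. }
    induction m.
    - simpl. rewrite sum_n_0_R, Cmult_1_l. apply Q.
    - rewrite sum_n_S_R, exp_plus. simpl Cprod. rewrite Cmod_mult.
      apply Rmult_le_compat; try apply Cmod_ge_0; [exact IHm|apply Q]. }
  assert (N : forall k, (0 <= Cmod (a k))%R) by (intros; apply Cmod_ge_0).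
  destruct n.
  - simpl. rewrite Cmod_1. rewrite <- exp_0. apply exp_mono.
    eapply Rle_trans; [|apply (sum_n_le_series _ 0 N H)]. rewrite sum_n_0_R. apply N.
  - eapply Rle_trans; [apply K|]. apply exp_mono, sum_n_le_series; auto.
Qed.

Lemma tends_eventually_S (u : nat -> C) (l : C) :
  tends eventually (fun n => u (S n)) l -> tends eventually u l.
Proof.
  intros H eps He. destruct (H eps He) as [N HN]. exists (S N). intros n Hn.
  destruct n; [lia|]. apply HN. lia.
Qed.

Lemma tends_eventually_shift (u : nat -> C) (l : C) (m : nat) :
  tends eventually u l -> tends eventually (fun n => u (n + m)%nat) l.
Proof.
  intros H eps He. destruct (H eps He) as [N HN]. exists N. intros n Hn. apply HN. lia.
Qed.

Lemma filterlim_eventually_ge (f : nat -> nat) :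
  (forall n, (n <= f n)%nat) -> filterlim f eventually eventually.
Proof. intros H P [N HN]. exists N. intros n Hn. apply HN. specialize (H n). lia. Qed.

(** Consecutive partial products differ by [Cprod a k * a k]; as the partial products are bounded,
    the series of these differences converges absolutely. *)
Lemma Cprod_cv (a : nat -> C) : ex_series (fun k => Cmod (a k)) ->
  exists l, tends eventually (Cprod a) l.
Proof.
  intros H. set (M := exp (Series (fun k => Cmod (a k)))).
  destruct (ex_series_C_le (fun k => Cprod a k * a k) (fun k => M * Cmod (a k))%R) as [l Hl].
  - intros n. rewrite Cmod_mult. apply Rmult_le_compat_r; [apply Cmod_ge_0|].
    now apply Cprod_bound.
  - now apply (ex_series_scal_R M).
  - exists (1 + l). apply tends_eventually_S.
    apply is_series_tends in Hl.
    eapply tends_ext_all; [apply _| |apply tends_plus; [apply _|apply (tends_const _ 1)|exact Hl]].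
    intros n. cbv beta. clear. induction n.
    + rewrite sum_n_0_C. simpl. ring.
    + rewrite sum_n_S_C, Cplus_assoc, IHn. simpl. ring.
Qed.

Lemma ex_series_eventually_le (a b : nat -> R) (N : nat) :
  (forall n, (N <= n)%nat -> (Rabs (a n) <= b n)%R) -> ex_series b -> ex_series a.
Proof.
  intros H Hb. apply (ex_series_incr_n a N).
  apply (@ex_series_le R_AbsRing R_CompleteNormedModule) with (b := fun k => b (N + k)%nat).
  - intros n. apply H. lia.
  - now apply (ex_series_incr_n b N).
Qed.

(* The inverse product also converges. *)
Lemma Cprod_cv_neq_0 (a : nat -> C) (l : C) : ex_series (fun k => Cmod (a k)) ->
  (forall k, 1 + a k <> 0) -> tends eventually (Cprod a) l -> l <> 0.
Proof.
  intros H Hnz Hl. set (b := fun k => / (1 + a k) - 1).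
  destruct (Cprod_cv b) as [l' Hl'].
  - assert (H0 := ex_series_lim_0 _ H).
    apply is_lim_seq_spec in H0.
    assert (Hh : (0 < 1 / 2)%R) by lra.
    destruct (H0 (mkposreal _ Hh)) as [N HN]. simpl in HN.
    apply (ex_series_eventually_le _ (fun k => 2 * Cmod (a k))%R N).
    + intros n Hn. specialize (HN n Hn). rewrite Rminus_0_r, Rabs_pos_eq in HN by apply Cmod_ge_0.
      rewrite Rabs_pos_eq by apply Cmod_ge_0.
      unfold b. replace (/ (1 + a n) - 1) with (- a n * / (1 + a n)) by (field; apply Hnz).
      rewrite Cmod_mult, Cmod_opp, Cmod_inv by apply Hnz.
      assert (K := Cmod_triangle_rev 1 (- a n)). rewrite Cmod_1, Cmod_opp in K.
      replace (1 - - a n) with (1 + a n) in K by ring.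
      rewrite (Rmult_comm 2). apply Rmult_le_compat_l; [apply Cmod_ge_0|].
      replace 2%R with (/ (1 / 2))%R by field. apply Rinv_le_contravar; lra.
    + now apply (ex_series_scal_R 2).
  - intros E. apply C1_nz.
    apply (tends_unique (FF := eventually_filter) eventually (fun n => Cprod a n * Cprod b n)).
    + eapply tends_ext_all; [apply _| |apply (tends_const _ 1)].
      intros n. cbv beta. clear - Hnz. induction n; simpl; [ring|].
      replace (Cprod a n * (1 + a n) * (Cprod b n * (1 + b n)))
        with ((Cprod a n * Cprod b n) * ((1 + a n) * (1 + b n))) by ring.
      rewrite <- IHn. unfold b. field. apply Hnz.
    + rewrite <- (Cmult_0_l l'), <- E. now apply tends_mult; [apply _| |].
Qed.

(** * The reciprocal Gamma function *)

(** The lower bound is [ln y <= y - 1] at [y = 1 / (1 + x)], where [1 / (1 + x) <= 1 - x + x^2]. *)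
Lemma ln_1_inv_bounds (x : R) : (0 < x)%R -> (0 < ln (1 + x) <= x /\ x - x ^ 2 <= ln (1 + x))%R.
Proof.
  intros Hx. split; [split|].
  - rewrite <- ln_1. apply ln_increasing; lra.
  - rewrite <- (ln_exp x) at 2. left. apply ln_increasing; [lra|]. apply exp_ineq1. lra.
  - assert (H : (ln (/ (1 + x)) <= / (1 + x) - 1)%R).
    { rewrite <- (ln_exp (/ (1 + x) - 1)).
      assert (H0 : (0 < / (1 + x))%R) by (apply Rinv_0_lt_compat; lra).
      assert (H1 := exp_ineq1_le (/ (1 + x) - 1)).
      destruct (Rle_lt_or_eq_dec _ _ H1) as [H2|H2].
      - left. apply ln_increasing; lra.
      - right. rewrite <- H2. f_equal. ring. }
    rewrite ln_Rinv in H by lra.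
    assert (H1 : (/ (1 + x) = 1 - x + x ^ 2 / (1 + x))%R) by (field; lra).
    assert (H2 : (x ^ 2 / (1 + x) <= x ^ 2)%R).
    { apply Rmult_le_reg_r with (1 + x)%R; [lra|]. unfold Rdiv. rewrite Rmult_assoc, Rinv_l by lra. nra. }
    lra.
Qed.

(* Euler's product [1 / Gamma (z + 1) = prod_(j >= 1) (1 + z / j) (1 + 1 / j)^(-z)];
   [Cprod] multiplies factors [1 + a k], and [k = j - 1]. *)
Definition gauss_term (z : C) (j : nat) : C :=
  (1 + z / (INR j + 1)) * Cexp (- (z * ln (1 + / (INR j + 1)))) - 1.

(** Read with [x = 1 / j] and [l = ln (1 + 1 / j)]: the first-order terms [z x] and [- z l] almost
    cancel, which leaves the order [x^2] and makes Euler's product absolutely convergent. The two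
    summands of the constant come from the remainder of the exponential and from the cross term
    [z^2 x l]. *)
Lemma gauss_term_expand (z : C) (x l : R) : (0 < x <= 1)%R -> (0 < l <= x /\ x - x ^ 2 <= l)%R ->
  (Cmod ((1 + z * x) * Cexp (- (z * l)) - 1 - z * (x - l)) <=
   x ^ 2 * (Cmod z ^ 2 / 2 * exp (Cmod z) * (1 + Cmod z) + Cmod z ^ 2))%R.
Proof.
  intros Hx [Hl1 Hl2].
  assert (Hz := Cmod_ge_0 z).
  set (w := - (z * l)).
  assert (Hw : (Cmod w = Cmod z * l)%R) by (unfold w; rewrite Cmod_opp, Cmod_mult, Cmod_R, Rabs_pos_eq; lra).
  replace ((1 + z * x) * Cexp w - 1 - z * (x - l))
    with ((1 + z * x) * (Cexp w - 1 - w) - z * z * (x * l)) by (unfold w; ring).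
  eapply Rle_trans; [apply Cmod_triangle_minus|]. rewrite !Cmod_mult, !Cmod_R, !(Rabs_pos_eq x), (Rabs_pos_eq l) by lra.
  assert (K := Cexp_minus_2_le w). rewrite Hw in K.
  assert (K1 : (exp (Cmod z * l) <= exp (Cmod z))%R) by (apply exp_mono; nra).
  assert (K2 : ((Cmod z * l) ^ 2 <= Cmod z ^ 2 * x ^ 2)%R).
  { rewrite Rpow_mult_distr. apply Rmult_le_compat_l; [nra|]. nra. }
  assert (K3 : (Cmod (Cexp w - 1 - w) <= Cmod z ^ 2 * x ^ 2 / 2 * exp (Cmod z))%R).
  { eapply Rle_trans; [exact K|]. apply Rmult_le_compat; try lra; [nra|left; apply exp_pos]. }
  assert (K4 : (Cmod (1 + z * x) <= 1 + Cmod z)%R).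
  { eapply Rle_trans; [apply Cmod_triangle|]. rewrite Cmod_1, Cmod_mult, Cmod_R, Rabs_pos_eq by lra. nra. }
  assert (K5 : (Cmod (1 + z * x) * Cmod (Cexp w - 1 - w) <=
     (1 + Cmod z) * (Cmod z ^ 2 * x ^ 2 / 2 * exp (Cmod z)))%R).
  { apply Rmult_le_compat; auto using Cmod_ge_0. }
  assert (K6 : (Cmod z * Cmod z * (x * l) <= Cmod z ^ 2 * x ^ 2)%R).
  { replace (Cmod z ^ 2 * x ^ 2)%R with (Cmod z * Cmod z * (x * x))%R by ring.
    apply Rmult_le_compat_l; nra. }
  lra.
Qed.

Lemma inv_INR_1 (j : nat) : (0 < / (INR j + 1) <= 1)%R.
Proof.
  assert (H := pos_INR j). split; [apply Rinv_0_lt_compat; lra|].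
  rewrite <- Rinv_1. apply Rinv_le_contravar; lra.
Qed.

Lemma RtoC_inv_INR_1 (j : nat) : RtoC (/ (INR j + 1)) = / (INR j + 1).
Proof. rewrite RtoC_inv, RtoC_plus; [easy|]. assert (H := pos_INR j). lra. Qed.

Lemma gauss_term_jet (z : C) (j : nat) :
  (Cmod (gauss_term z j - z * (/ (INR j + 1) - ln (1 + / (INR j + 1)))%R) <=
   (/ (INR j + 1)) ^ 2 * (Cmod z ^ 2 / 2 * exp (Cmod z) * (1 + Cmod z) + Cmod z ^ 2))%R.
Proof.
  assert (Hx := inv_INR_1 j).
  assert (K := gauss_term_expand z _ _ Hx (ln_1_inv_bounds _ (proj1 Hx))).
  unfold gauss_term. rewrite RtoC_minus.
  replace (z / (INR j + 1)) with (z * RtoC (/ (INR j + 1))) by (rewrite RtoC_inv_INR_1; reflexivity).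
  exact K.
Qed.

Lemma gauss_term_le (z : C) : exists M, forall j, (Cmod (gauss_term z j) <= M * / (INR j + 1) ^ 2)%R.
Proof.
  exists (Cmod z ^ 2 / 2 * exp (Cmod z) * (1 + Cmod z) + Cmod z ^ 2 + Cmod z)%R. intros j.
  assert (Hx := inv_INR_1 j). assert (Hl := ln_1_inv_bounds _ (proj1 Hx)).
  assert (K := gauss_term_jet z j).
  set (x := (/ (INR j + 1))%R) in *. set (l := ln (1 + x)) in *.
  assert (K2 := Cmod_triangle_rev (gauss_term z j) (z * (x - l)%R)).
  assert (K3 : (Cmod (z * (x - l)%R) <= Cmod z * x ^ 2)%R).
  { rewrite Cmod_mult, Cmod_R, Rabs_pos_eq by lra. apply Rmult_le_compat_l; [apply Cmod_ge_0|lra]. }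
  replace (/ (INR j + 1) ^ 2)%R with (x ^ 2)%R; [lra|].
  unfold x. rewrite pow_inv. reflexivity.
Qed.

Lemma gauss_term_series (z : C) : ex_series (fun j => Cmod (gauss_term z j)).
Proof.
  destruct (gauss_term_le z) as [M HM].
  apply (@ex_series_le R_AbsRing R_CompleteNormedModule) with (b := fun j => (M * / (INR j + 1) ^ 2)%R).
  - intros n. change norm with Rabs. rewrite Rabs_pos_eq by apply Cmod_ge_0. apply HM.
  - apply (ex_series_scal_R M), ex_series_inv_sq.
Qed.

Lemma Crising_S (z : C) (n : nat) : Crising z (S n) = z * Crising (z + 1) n.
Proof.
  induction n.
  - simpl. ring.
  - change (Crising z (S (S n))) with (Crising z (S n) * (z + INR (S n))).
    rewrite IHn. change (Crising (z + 1) (S n)) with (Crising (z + 1) n * (z + 1 + INR n)).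
    rewrite INR_C_S. ring.
Qed.

Lemma Crising_1 (n : nat) : Crising 1 n = INR (fact n).
Proof.
  induction n; [reflexivity|]. cbn [Crising]. rewrite IHn, fact_C_S. ring.
Qed.

(** The logarithms [ln (1 + 1 / j)] telescope to [ln (n + 1)]. *)
Lemma Cprod_gauss_term (z : C) (n : nat) :
  Cprod (gauss_term z) n = Crising (z + 1) n / INR (fact n) * Cexp (- (z * ln (INR n + 1))).
Proof.
  induction n.
  - simpl. rewrite Rplus_0_l, ln_1, Cmult_0_r. replace (- RtoC 0) with (RtoC 0) by ring.
    rewrite Cexp_0. field.
  - cbn [Cprod Crising]. rewrite IHn. unfold gauss_term. rewrite fact_C_S.
    assert (H := pos_INR n).
    replace (ln (INR (S n) + 1)) with (ln (INR n + 1) + ln (1 + / (INR n + 1)))%R.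
    2:{ rewrite <- ln_mult; try lra.
        - f_equal. rewrite S_INR. field. lra.
        - assert (0 < / (INR n + 1))%R by (apply Rinv_0_lt_compat; lra). lra. }
    rewrite (RtoC_plus (ln (INR n + 1))).
    replace (- (z * (ln (INR n + 1) + ln (1 + / (INR n + 1)))))
      with (- (z * ln (INR n + 1)) + - (z * ln (1 + / (INR n + 1)))) by ring.
    rewrite Cexp_plus.
    field. split; [apply fact_C_neq_0|]. rewrite <- INR_C_S. apply INR_C_neq_0. lia.
Qed.

Lemma Carg_pos (x : R) : (0 < x)%R -> Carg x = 0%R.
Proof.
  intros H. unfold Carg. simpl. rewrite Cmod_R, Rabs_pos_eq by lra.
  replace (x / x)%R with 1%R by (field; lra).
  rewrite acos_1. destruct (Rle_dec 0 0); [easy|lra].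
Qed.

Lemma Cln_pos (x : R) : (0 < x)%R -> Cln x = ln x.
Proof.
  intros H. unfold Cln. rewrite Carg_pos, Cmod_R, Rabs_pos_eq by lra. reflexivity.
Qed.

Lemma Cpower_pos (x : R) (a : C) : (0 < x)%R -> Cpower x a = Cexp (a * ln x).
Proof. intros H. unfold Cpower. now rewrite Cln_pos. Qed.

Definition gauss (z : C) (n : nat) : C :=
  Crising z (S n) / (INR (fact n) * Cpower (INR n) z).

(** Gauss's formula normalises by [n^z] and the product by [(n + 1)^z]; the quotient [(1 + 1 / n)^z]
    tends to [1]. *)
Lemma gauss_Cprod (z : C) (n : nat) : (0 < n)%nat ->
  gauss z n = z * Cprod (gauss_term z) n * Cexp (z * (ln (1 + / INR n))%R).
Proof.
  intros Hn. unfold gauss. rewrite Crising_S, Cprod_gauss_term.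
  assert (H : (0 < INR n)%R) by now apply lt_0_INR.
  rewrite Cpower_pos by easy.
  replace (ln (1 + / INR n)) with (ln (INR n + 1) - ln (INR n))%R.
  2:{ replace (1 + / INR n)%R with ((INR n + 1) / INR n)%R by (field; lra).
      rewrite ln_div; lra. }
  rewrite RtoC_minus.
  replace (z * (ln (INR n + 1) - ln (INR n))) with (z * ln (INR n + 1) + - (z * ln (INR n))) by ring.
  rewrite Cexp_plus, !Cexp_opp. field. repeat split; auto using fact_C_neq_0, Cexp_neq_0.
Qed.

Lemma is_lim_seq_inv_INR : is_lim_seq (fun n => / INR n)%R 0.
Proof.
  replace (Finite 0) with (Rbar_inv p_infty) by reflexivity.
  apply is_lim_seq_inv; [apply is_lim_seq_INR|easy].
Qed.

Lemma tends_inv_INR (z : C) : tends eventually (fun n => z / INR n) 0.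
Proof.
  apply tends_ext with (f := fun n => z * RtoC (/ INR n)%R); [apply _| |].
  - exists 1%nat. intros n Hn. rewrite RtoC_inv; [reflexivity|]. apply not_0_INR. lia.
  - replace (RtoC 0) with (z * RtoC 0) by ring. apply tends_mult; [apply _|apply tends_const, _|].
    apply tends_RtoC; [apply _|]. apply is_lim_seq_inv_INR.
Qed.

Lemma tends_ratio_INR (a b : C) : tends eventually (fun n => (INR n + a) / (INR n + b)) 1.
Proof.
  apply tends_ext with (f := fun n => (1 + a / INR n) / (1 + b / INR n)); [apply _| |].
  - destruct (tends_inv_INR b (1/2)%R ltac:(lra)) as [N HN].
    exists (S N). intros n Hn.
    assert (H0 : RtoC (INR n) <> 0) by (apply INR_C_neq_0; lia).
    assert (H1 : 1 + b / INR n <> 0).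
    { intros E. specialize (HN n ltac:(lia)).
      replace (b / INR n - 0) with ((1 + b / INR n) - 1) in HN by ring. rewrite E in HN.
      replace (0 - 1) with (- (1)) in HN by ring. rewrite Cmod_m1 in HN. lra. }
    field. split; [|easy]. intros E. apply H1.
    replace (1 + b / INR n) with ((INR n + b) / INR n) by (field; easy).
    rewrite E. field. easy.
  - apply (tends_eq _ _ ((1 + 0) / (1 + 0))); [field|].
    apply tends_div; [apply _| | |];
      try (apply tends_plus; [apply _|apply tends_const, _|apply tends_inv_INR]).
    replace (1 + 0) with (RtoC 1) by ring. apply C1_nz.
Qed.

Lemma tends_ln_ratio : filterlim (fun n => ln (1 + / INR n)) eventually (locally 0%R).
Proof.
  change (is_lim_seq (fun n => ln (1 + / INR n)) 0).
  apply is_lim_seq_le_le_loc with (u := fun _ => 0%R) (w := fun n => (/ INR n)%R).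
  - exists 1%nat. intros n Hn. assert (0 < INR n)%R by (apply lt_0_INR; lia).
    assert (K := ln_1_inv_bounds (/ INR n) (Rinv_0_lt_compat _ H)). lra.
  - apply is_lim_seq_const.
  - apply is_lim_seq_inv_INR.
Qed.

Lemma gauss_cv (z : C) : exists l, tends eventually (Cprod (gauss_term z)) l /\ tends eventually (gauss z) (z * l).
Proof.
  destruct (Cprod_cv _ (gauss_term_series z)) as [l Hl]. exists l. split; [easy|].
  apply tends_ext with (f := fun n => z * Cprod (gauss_term z) n * Cexp (z * (ln (1 + / INR n))%R)); [apply _| |].
  - exists 1%nat. intros n Hn. symmetry. now apply gauss_Cprod.
  - replace (z * l) with (z * l * Cexp (z * RtoC 0)) by (rewrite Cmult_0_r, Cexp_0; ring).
    apply tends_mult; [apply _| |].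
    + apply tends_mult; [apply _|apply tends_const, _|easy].
    + apply tends_Cexp; [apply _|]. apply tends_mult; [apply _|apply tends_const, _|].
      apply tends_RtoC; [apply _|]. apply tends_ln_ratio.
Qed.

Lemma rGamma_tends (z : C) : tends eventually (gauss z) (rGamma z).
Proof.
  destruct (gauss_cv z) as [l [_ Hl]].
  replace (rGamma z) with (z * l); [easy|]. symmetry. now apply tends_CLim_seq.
Qed.

Lemma Cpower_plus_1 (n : nat) (z : C) : (0 < n)%nat ->
  Cpower (INR n) (z + 1) = Cpower (INR n) z * INR n.
Proof.
  intros Hn. assert (H : (0 < INR n)%R) by now apply lt_0_INR.
  rewrite !Cpower_pos by easy. rewrite Cmult_plus_distr_r, Cexp_plus, Cmult_1_l, Cexp_RtoC.
  now rewrite exp_ln.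
Qed.

Lemma Cpower_neq_0 (z a : C) : Cpower z a <> 0.
Proof. apply Cexp_neq_0. Qed.

(** The approximant [z * gauss (z + 1) n] is [gauss z n] times [(n + z + 1) / n], which tends to
    [1]. *)
Lemma rGamma_rec (z : C) : rGamma z = z * rGamma (z + 1).
Proof.
  apply (tends_unique (FF := eventually_filter) eventually (fun n => z * gauss (z + 1) n)).
  - apply tends_ext with (f := fun n => gauss z n * ((INR n + (z + 1)) / (INR n + 0))); [apply _| |].
    + exists 1%nat. intros n Hn. unfold gauss. rewrite Cpower_plus_1 by lia.
      change (Crising z (S n)) with (Crising z n * (z + INR n)).
      assert (E : z * Crising (z + 1) (S n) = Crising z (S n) * (z + INR n + 1)).
      { rewrite <- Crising_S. cbn [Crising]. rewrite INR_C_S. ring. }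
      cbn [Crising] in E |- *.
      assert (H0 : RtoC (INR n) <> 0) by (apply INR_C_neq_0; lia).
      replace (INR n + 0) with (RtoC (INR n)) by ring.
      transitivity ((Crising z n * (z + INR n) * (z + INR n + 1)) / (INR (fact n) * (Cpower (INR n) z * INR n))).
      * field. repeat split; auto using fact_C_neq_0, Cpower_neq_0.
      * rewrite <- E. field. repeat split; auto using fact_C_neq_0, Cpower_neq_0.
    + replace (rGamma z) with (rGamma z * 1) by ring.
      apply tends_mult; [apply _|apply rGamma_tends|apply tends_ratio_INR].
  - apply tends_mult; [apply _|apply tends_const, _|apply rGamma_tends].
Qed.

Lemma rGamma_1 : rGamma 1 = 1.
Proof.
  apply (tends_unique (FF := eventually_filter) eventually (gauss 1)); [apply rGamma_tends|].
  apply tends_ext with (f := fun n => (INR n + 1) / (INR n + 0)); [apply _| |apply tends_ratio_INR].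
  exists 1%nat. intros n Hn. unfold gauss. rewrite Crising_1, fact_C_S.
  assert (H : (0 < INR n)%R) by now apply lt_0_INR.
  rewrite Cpower_pos, Cmult_1_l, Cexp_RtoC, exp_ln by easy.
  assert (H0 : RtoC (INR n) <> 0) by (apply INR_C_neq_0; lia).
  replace (INR n + 0) with (RtoC (INR n)) by ring.
  field. auto using fact_C_neq_0.
Qed.

Lemma rGamma_0 : rGamma 0 = 0.
Proof. rewrite rGamma_rec. ring. Qed.

Lemma rGamma_Crising (z : C) (n : nat) : rGamma z = Crising z n * rGamma (z + INR n).
Proof.
  induction n.
  - simpl. replace (z + 0) with z by ring. ring.
  - rewrite IHn. cbn [Crising]. rewrite (rGamma_rec (z + INR n)), INR_C_S, Cplus_assoc. ring.
Qed.

Lemma rGamma_fact (n : nat) : rGamma (INR n + 1) = / INR (fact n).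
Proof.
  assert (H := rGamma_Crising 1 n). rewrite rGamma_1, Crising_1 in H.
  rewrite (Cplus_comm (INR n)).
  replace (rGamma (1 + INR n)) with (/ INR (fact n) * (INR (fact n) * rGamma (1 + INR n)))
    by (field; apply fact_C_neq_0).
  rewrite <- H. ring.
Qed.

Lemma rGamma_neg (n : nat) : rGamma (- INR n) = 0.
Proof.
  rewrite (rGamma_Crising _ n). replace (- INR n + INR n) with (RtoC 0) by ring.
  rewrite rGamma_0. ring.
Qed.

(** Nonvanishing passes to the limit because Euler's product converges absolutely and none of its
    factors is zero. *)
Lemma rGamma_neq_0 (z : C) : (forall n, z + INR n <> 0) -> rGamma z <> 0.
Proof.
  intros H. destruct (gauss_cv z) as [l [Hl Hl']].
  rewrite (tends_unique (FF := eventually_filter) _ _ _ _ (rGamma_tends z) Hl').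
  apply Cmult_neq_0.
  - specialize (H 0%nat). simpl in H. now replace (z + 0) with z in H by ring.
  - apply (Cprod_cv_neq_0 (gauss_term z)); [apply gauss_term_series| |easy].
    intros k. unfold gauss_term.
    assert (Hk : RtoC (INR k) + 1 <> 0) by (rewrite <- INR_C_S; apply INR_C_neq_0; lia).
    replace (1 + ((1 + z / (INR k + 1)) * Cexp (- (z * ln (1 + / (INR k + 1)))) - 1))
      with ((z + (INR k + 1)) * / (INR k + 1) * Cexp (- (z * ln (1 + / (INR k + 1))))) by (field; easy).
    apply Cmult_neq_0; [|apply Cexp_neq_0]. apply Cmult_neq_0.
    + rewrite <- INR_C_S. apply H.
    + intros E; apply C1_nz; rewrite <- (Cinv_r _ Hk), E; ring.
Qed.

Lemma rGamma_neq_0_Re (z : C) : (0 < Re z)%R -> rGamma z <> 0.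
Proof.
  intros H. apply rGamma_neq_0. intros n E. apply (f_equal Re) in E. simpl in E.
  assert (K := pos_INR n). unfold Re in H. lra.
Qed.

(** * The duplication formula *)

Lemma Crising_dup (z : C) (n : nat) :
  Crising (2 * z) (2 * n) = 4 ^ n * Crising z n * Crising (z + 1 / 2) n.
Proof.
  induction n; [simpl; ring|].
  replace (2 * S n)%nat with (S (S (2 * n))) by lia. cbn [Crising].
  rewrite IHn, Cpow_S, INR_C_S, mult_INR, RtoC_mult. simpl (INR 2).
  rewrite RtoC_plus. field.
Qed.

(** The index [2 n + 1] gives [gauss (2 z)] exactly [2 (n + 1)] linear factors, which split into the
    [n + 1] factors of each term on the left. *)
Lemma gauss_dup (z : C) (n : nat) : (0 < n)%nat ->
  gauss z n * gauss (z + 1 / 2) n =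
  Cexp (z * 2 * (ln 2 + ln (1 + / INR (2 * n)))%R) *
  (INR (fact (2 * n + 1)) / (4 ^ (S n) * INR (fact n) ^ 2 * Cpower (INR n) (1 / 2)))
  * gauss (2 * z) (2 * n + 1).
Proof.
  intros Hn. unfold gauss.
  replace (S (2 * n + 1)) with (2 * S n)%nat by lia. rewrite Crising_dup.
  assert (H : (0 < INR n)%R) by now apply lt_0_INR.
  assert (H2 : (0 < INR (2 * n))%R) by (apply lt_0_INR; lia).
  assert (H3 : (0 < INR (2 * n + 1))%R) by (apply lt_0_INR; lia).
  rewrite !Cpower_pos by easy.
  replace (ln 2 + ln (1 + / INR (2 * n)))%R with (ln (INR (2 * n + 1)) - ln (INR n))%R.
  2:{ assert (0 < / INR (2 * n))%R by now apply Rinv_0_lt_compat.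
      rewrite <- ln_mult by lra. rewrite <- ln_div by lra. f_equal.
      rewrite plus_INR, mult_INR. simpl. field. lra. }
  rewrite RtoC_minus.
  replace (z * 2 * (ln (INR (2 * n + 1)) - ln (INR n)))
    with (2 * z * ln (INR (2 * n + 1)) - (z * ln (INR n) + z * ln (INR n))) by ring.
  rewrite Cexp_minus, Cexp_plus, Cmult_plus_distr_r, Cexp_plus.
  assert (E4 : (4 : C) ^ S n <> 0) by (apply Cpow_nz, RtoC_neq_0; lra).
  field. repeat split; auto using fact_C_neq_0, Cexp_neq_0.
Qed.

(** The middle factor in [gauss_dup], here [c], is free of [z]; its limit is therefore read off at
    [z = 1 / 2], where [rGamma 1 = 1]. *)
Lemma rGamma_dup (z : C) :
  rGamma z * rGamma (z + 1 / 2) = Cexp (2 * z * ln 2) * (rGamma (1 / 2) / 2) * rGamma (2 * z).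
Proof.
  set (c := fun n => INR (fact (2 * n + 1)) / (4 ^ (S n) * INR (fact n) ^ 2 * Cpower (INR n) (1 / 2))).
  set (e := fun (w : C) n => Cexp (w * 2 * (ln 2 + ln (1 + / INR (2 * n)))%R)).
  assert (He : forall w, tends eventually (e w) (Cexp (2 * w * ln 2))).
  { intros w. apply tends_Cexp; [apply _|].
    replace (2 * w * ln 2) with (w * 2 * (ln 2 + RtoC 0)) by ring.
    apply tends_mult; [apply _|apply tends_const, _|].
    eapply tends_ext_all; [apply _|intros n; symmetry; apply RtoC_plus|].
    apply tends_plus; [apply _|apply tends_const, _|].
    apply tends_RtoC; [apply _|].
    apply (filterlim_comp _ _ _ (fun n => (2 * n)%nat) (fun n => ln (1 + / INR n))
      eventually eventually); [|apply tends_ln_ratio].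
    apply filterlim_eventually_ge. lia. }
  assert (Hg : forall w, tends eventually (fun n => gauss (2 * w) (2 * n + 1)) (rGamma (2 * w))).
  { intros w. eapply (tends_comp eventually eventually (fun n => (2 * n + 1)%nat) (gauss (2 * w)));
      [|apply rGamma_tends].
    apply filterlim_eventually_ge. lia. }
  assert (Hp : forall w, tends eventually (fun n => e w n * c n * gauss (2 * w) (2 * n + 1))
      (rGamma w * rGamma (w + 1 / 2))).
  { intros w. apply tends_ext with (f := fun n => gauss w n * gauss (w + 1 / 2) n); [apply _| |].
    - exists 1%nat. intros n Hn. now apply gauss_dup.
    - apply tends_mult; [apply _| |]; apply rGamma_tends. }
  assert (Hc : tends eventually c (rGamma (1 / 2) / 2)).
  { assert (Hnz : Cexp (2 * (1 / 2) * ln 2) * rGamma (2 * (1 / 2)) <> 0).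
    { apply Cmult_neq_0; [apply Cexp_neq_0|].
      replace (2 * (1 / 2)) with (RtoC 1) by field. rewrite rGamma_1. apply C1_nz. }
    assert (Q := tends_div _ _ _ _ _ Hnz (Hp (1 / 2)) (tends_mult _ _ _ _ _ (He (1 / 2)) (Hg (1 / 2)))).
    clear Hnz. replace (1 / 2 + 1 / 2) with (RtoC 1) in Q by field.
    replace (2 * (1 / 2)) with (RtoC 1) in Q by field.
    rewrite rGamma_1, !Cmult_1_l, Cexp_RtoC, exp_ln in Q by lra.
    replace (rGamma (1 / 2) / 2) with (rGamma (1 / 2) * 1 / (2 * 1)) by field.
    eapply tends_ext; [apply _| |exact Q].
    assert (B := Hg (1/2) (1/2)%R ltac:(lra)). revert B. apply filter_imp. intros n Hn.
    replace (2 * (1 / 2)) with (RtoC 1) in Hn by field. rewrite rGamma_1 in Hn.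
    assert (gauss 1 (2 * n + 1) <> 0).
    { intros E. rewrite E in Hn. replace (0 - 1) with (- (1)) in Hn by ring. rewrite Cmod_m1 in Hn. lra. }
    field. split; [easy|apply Cexp_neq_0]. }
  apply (tends_unique (FF := eventually_filter) _ _ _ _ (Hp z)).
  apply tends_mult; [apply _| |apply Hg]. apply tends_mult; [apply _|apply He|apply Hc].
Qed.

(** A ratio test in disguise: it is applied to coefficients divided by their expected growth, which
    do not increase from some index on. *)
Lemma eventually_decr_bounded (u : nat -> R) (N : nat) :
  (forall n, (N <= n)%nat -> (u (S n) <= u n)%R) -> exists M, (0 <= M)%R /\ forall n, (u n <= M)%R.
Proof.
  intros H.
  assert (A : forall m, exists M, (0 <= M)%R /\ forall n, (n <= m)%nat -> (u n <= M)%R).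
  { induction m.
    - exists (Rmax 0 (u 0%nat)). split; [apply Rmax_l|]. intros n Hn. replace n with 0%nat by lia. apply Rmax_r.
    - destruct IHm as [M [HM0 HM]]. exists (Rmax M (u (S m))). split.
      + eapply Rle_trans; [exact HM0|apply Rmax_l].
      + intros n Hn. destruct (Nat.eq_dec n (S m)) as [->|E]; [apply Rmax_r|].
        eapply Rle_trans; [apply HM; lia|apply Rmax_l]. }
  destruct (A N) as [M [HM0 HM]]. exists M. split; [easy|].
  intros n. destruct (le_lt_dec n N) as [h|h]; [now apply HM|].
  assert (B : forall k, (u (N + k)%nat <= M)%R).
  { induction k; [rewrite Nat.add_0_r; apply HM; lia|].
    rewrite Nat.add_succ_r. eapply Rle_trans; [apply H; lia|exact IHk]. }
  replace n with (N + (n - N))%nat by lia. apply B.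
Qed.

(** From some [k] on [|z + k + 1| >= (k + 1) / 2], so that each step of [rGamma_rec] contributes a
    factor of at most [2 / (k + 1)]. *)
Lemma rGamma_shift_bound (z : C) : exists M, (0 <= M)%R /\
  forall k, (Cmod (rGamma (z + INR k + 1)) <= M * (2 ^ k / INR (fact k)))%R.
Proof.
  destruct (INR_unbounded (2 * Cmod z + 1)) as [N HN].
  destruct (eventually_decr_bounded (fun k => INR (fact k) / 2 ^ k * Cmod (rGamma (z + INR k + 1)))%R N) as [M [HM0 HM]].
  - intros n Hn. assert (Hn' := le_INR _ _ Hn). assert (Hz := Cmod_ge_0 z).
    rewrite (rGamma_rec (z + INR n + 1)), Cmod_mult.
    replace (z + INR (S n) + 1) with (z + INR n + 1 + 1) by (rewrite INR_C_S; ring).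
    set (g := Cmod (rGamma (z + INR n + 1 + 1))). assert (Hg : (0 <= g)%R) by apply Cmod_ge_0.
    assert (K : ((INR n + 1) / 2 <= Cmod (z + INR n + 1))%R).
    { assert (Q := Cmod_triangle_rev (INR n + 1) (- z)).
      replace (INR n + 1 - - z) with (z + INR n + 1) in Q by ring.
      rewrite Cmod_opp, <- INR_C_S, Cmod_R, Rabs_pos_eq, S_INR in Q by apply pos_INR.
      unfold Cminus in *. lra. }
    change (fact (S n)) with (S n * fact n)%nat. rewrite mult_INR, S_INR.
    assert (P1 := INR_fact_lt_0 n). assert (P2 := pow_lt 2 n ltac:(lra)).
    assert (P3 : (0 < INR (fact n) / 2 ^ n)%R) by now apply Rdiv_lt_0_compat.
    replace ((INR n + 1) * INR (fact n) / 2 ^ S n * g)%R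
      with (INR (fact n) / 2 ^ n * ((INR n + 1) / 2 * g))%R by (simpl; field; lra).
    apply Rmult_le_compat_l; [lra|]. now apply Rmult_le_compat_r.
  - exists M. split; [easy|]. intros k. specialize (HM k). cbv beta in HM.
    assert (P1 := INR_fact_lt_0 k). assert (P2 := pow_lt 2 k ltac:(lra)).
    assert (P3 : (0 < 2 ^ k / INR (fact k))%R) by now apply Rdiv_lt_0_compat.
    replace (Cmod (rGamma (z + INR k + 1))) with
      ((INR (fact k) / 2 ^ k * Cmod (rGamma (z + INR k + 1))) * (2 ^ k / INR (fact k)))%R by (field; lra).
    apply Rmult_le_compat_r; lra.
Qed.

(** * First-order expansions with quadratic remainder *)

(* A first-order expansion at [0] of size at most [N], where the size of
   [a + b e + O(c |e|^2)] is [|a| + |b| + c]: this size is submultiplicative, so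
   that expansions pass to infinite products and series. *)
Record jet (f : C -> C) (N : R) : Type := mk_jet {
  jet_der : C;
  jet_rem : R;
  jet_rem_pos : (0 <= jet_rem)%R;
  jet_size : (Cmod (f 0) + Cmod jet_der + jet_rem <= N)%R;
  jet_approx : forall e, (Cmod e <= 1 / 2)%R ->
    (Cmod (f e - f 0 - e * jet_der) <= jet_rem * Cmod e ^ 2)%R
}.

Arguments jet_der {f N}. Arguments jet_rem {f N}. Arguments jet_rem_pos {f N}.
Arguments jet_size {f N}. Arguments jet_approx {f N}.

Lemma Cmod_0_le_half : (Cmod 0 <= 1 / 2)%R.
Proof. rewrite Cmod_0. lra. Qed.

Lemma jet_le (f : C -> C) (N M : R) : (N <= M)%R -> jet f N -> jet f M.
Proof.
  intros H [d c Hc Hs Ha]. apply (mk_jet f M d c); auto. lra.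
Qed.

Lemma jet_ext (f g : C -> C) (N : R) : (forall e, (Cmod e <= 1 / 2)%R -> f e = g e) -> jet f N -> jet g N.
Proof.
  intros H [d c Hc Hs Ha]. apply (mk_jet g N d c); auto.
  - rewrite <- H; [easy|apply Cmod_0_le_half].
  - intros e He. rewrite <- !H; auto using Cmod_0_le_half.
Qed.

Lemma jet_bound (f : C -> C) (N : R) : jet f N -> forall e, (Cmod e <= 1 / 2)%R -> (Cmod (f e) <= N)%R.
Proof.
  intros [d c Hc Hs Ha] e He. specialize (Ha e He).
  replace (f e) with ((f e - f 0 - e * d) + (f 0 + e * d)) by ring.
  eapply Rle_trans; [apply Cmod_triangle|].
  assert (K := Cmod_triangle (f 0) (e * d)). rewrite Cmod_mult in K.
  assert (H1 := Cmod_ge_0 e). assert (H2 := Cmod_ge_0 d).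
  assert (H3 : (Cmod e ^ 2 <= 1)%R) by nra.
  assert (Cmod e * Cmod d <= Cmod d)%R by nra.
  assert (c * Cmod e ^ 2 <= c)%R by nra. lra.
Qed.

Lemma jet_size_pos (f : C -> C) (N : R) : jet f N -> (0 <= N)%R.
Proof.
  intros [d c Hc Hs Ha]. assert (H1 := Cmod_ge_0 (f 0)). assert (H2 := Cmod_ge_0 d). lra.
Qed.

Lemma jet_const (a : C) : jet (fun _ => a) (Cmod a).
Proof.
  apply (mk_jet _ _ 0 0%R); [lra|rewrite Cmod_0; lra|].
  intros e _. replace (a - a - e * 0) with (RtoC 0) by ring. rewrite Cmod_0. lra.
Qed.

Lemma jet_affine (a b : C) : jet (fun e => a + b * e) (Cmod a + Cmod b).
Proof.
  apply (mk_jet _ _ b 0%R); [lra| |].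
  - replace (a + b * 0) with a by ring. lra.
  - intros e _. replace (a + b * e - (a + b * 0) - e * b) with (RtoC 0) by ring. rewrite Cmod_0. lra.
Qed.

Lemma jet_plus (f g : C -> C) (N M : R) : jet f N -> jet g M -> jet (fun e => f e + g e) (N + M).
Proof.
  intros [d c Hc Hs Ha] [d' c' Hc' Hs' Ha']. apply (mk_jet _ _ (d + d') (c + c')%R); [lra| |].
  - assert (K := Cmod_triangle (f 0) (g 0)). assert (K' := Cmod_triangle d d'). lra.
  - intros e He. specialize (Ha e He). specialize (Ha' e He).
    replace (f e + g e - (f 0 + g 0) - e * (d + d')) with ((f e - f 0 - e * d) + (g e - g 0 - e * d')) by ring.
    eapply Rle_trans; [apply Cmod_triangle|]. lra.
Qed.

(** All terms of order two or more go into the remainder; the cubic and quartic ones are absorbed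
    because [|e| <= 1]. *)
Lemma jet_mult (f g : C -> C) (N M : R) : jet f N -> jet g M -> jet (fun e => f e * g e) (N * M).
Proof.
  intros [d c Hc Hs Ha] [d' c' Hc' Hs' Ha'].
  set (a := Cmod (f 0)) in *. set (b := Cmod d) in *.
  set (a' := Cmod (g 0)) in *. set (b' := Cmod d') in *.
  assert (A : (0 <= a)%R) by apply Cmod_ge_0. assert (B : (0 <= b)%R) by apply Cmod_ge_0.
  assert (A' : (0 <= a')%R) by apply Cmod_ge_0. assert (B' : (0 <= b')%R) by apply Cmod_ge_0.
  apply (mk_jet _ _ (f 0 * d' + d * g 0) (a * c' + c * a' + b * b' + b * c' + c * b' + c * c')%R).
  - repeat apply Rplus_le_le_0_compat; now apply Rmult_le_pos.
  - apply Rle_trans with ((a + b + c) * (a' + b' + c'))%R.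
    + rewrite Cmod_mult.
      assert (K : (Cmod (f 0 * d' + d * g 0) <= a * b' + b * a')%R).
      { eapply Rle_trans; [apply Cmod_triangle|]. rewrite !Cmod_mult. apply Rle_refl. }
      fold a a'. lra.
    + apply Rmult_le_compat; lra.
  - intros e He. specialize (Ha e He). specialize (Ha' e He).
    set (r := f e - f 0 - e * d) in *. set (r' := g e - g 0 - e * d') in *.
    assert (H0 := Cmod_ge_0 e). set (h := Cmod e) in *.
    replace (f e * g e - f 0 * g 0 - e * (f 0 * d' + d * g 0))
      with (f 0 * r' + r * g 0 + (e * d) * (e * d') + (e * d) * r' + r * (e * d') + r * r')
      by (unfold r, r'; ring).
    assert (R1 := Cmod_ge_0 r). assert (R2 := Cmod_ge_0 r').
    eapply Rle_trans; [repeat (eapply Rle_trans; [apply Cmod_triangle|apply Rplus_le_compat_r])|].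
    { apply Rle_refl. }
    rewrite !Cmod_mult. fold a b a' b' h.
    assert (Hh2 : (0 <= h ^ 2)%R) by nra.
    assert (T1 : (a * Cmod r' <= a * c' * h ^ 2)%R) by (rewrite Rmult_assoc; now apply Rmult_le_compat_l).
    assert (T2 : (Cmod r * a' <= c * a' * h ^ 2)%R).
    { replace (c * a' * h ^ 2)%R with (c * h ^ 2 * a')%R by ring. now apply Rmult_le_compat_r. }
    assert (T3 : (h * b * (h * b') = b * b' * h ^ 2)%R) by ring.
    assert (T4 : (h * b * Cmod r' <= b * c' * h ^ 2)%R).
    { apply Rle_trans with (1 * b * (c' * h ^ 2))%R; [|right; ring].
      apply Rmult_le_compat; auto; nra. }
    assert (T5 : (Cmod r * (h * b') <= c * b' * h ^ 2)%R).
    { apply Rle_trans with (c * h ^ 2 * (1 * b'))%R; [|right; ring].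
      apply Rmult_le_compat; auto; nra. }
    assert (T6 : (Cmod r * Cmod r' <= c * c' * h ^ 2)%R).
    { apply Rle_trans with (c * 1 * (c' * h ^ 2))%R; [|right; ring].
      apply Rmult_le_compat; auto. eapply Rle_trans; [exact Ha|]. apply Rmult_le_compat_l; nra. }
    lra.
Qed.

Lemma jet_opp_arg (f : C -> C) (N : R) : jet f N -> jet (fun e => f (- e)) N.
Proof.
  assert (E : - RtoC 0 = 0) by ring.
  intros [d c Hc Hs Ha]. apply (mk_jet _ _ (- d) c); auto; rewrite E.
  - now rewrite Cmod_opp.
  - intros e He. specialize (Ha (- e)). rewrite Cmod_opp in Ha. specialize (Ha He).
    now replace (e * - d) with (- e * d) by ring.
Qed.

Lemma jet_Cexp (w : C) : jet (fun e => Cexp (w * e)) (1 + Cmod w + Cmod w ^ 2 * exp (Cmod w)).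
Proof.
  assert (E : w * 0 = 0) by ring. assert (Hw := Cmod_ge_0 w).
  apply (mk_jet _ _ w (Cmod w ^ 2 * exp (Cmod w))%R); rewrite ?E, ?Cexp_0, ?Cmod_1.
  - apply Rmult_le_pos; [nra|left; apply exp_pos].
  - lra.
  - intros e He. rewrite (Cmult_comm e). eapply Rle_trans; [apply Cexp_minus_2_le|].
    rewrite Cmod_mult. assert (H0 := Cmod_ge_0 e).
    assert (K : (exp (Cmod w * Cmod e) <= exp (Cmod w))%R) by (apply exp_mono; nra).
    replace (Cmod w ^ 2 * exp (Cmod w) * Cmod e ^ 2)%R with ((Cmod w * Cmod e) ^ 2 * exp (Cmod w))%R by ring.
    assert (P := exp_pos (Cmod w * Cmod e)).
    apply Rmult_le_compat; [|lra| |exact K]; nra.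
Qed.

(** The radius [1 / 2] keeps [|k + 1 + e| >= 1 / 2]; the size [4] is [1 + 1 + 2], for value,
    derivative and remainder. *)
Lemma jet_inv_shift (k : nat) : jet (fun e => / (INR k + 1 + e)) 4.
Proof.
  assert (Hk := pos_INR k).
  assert (H1 : RtoC (INR k) + 1 <> 0) by (rewrite <- INR_C_S; apply INR_C_neq_0; lia).
  assert (M1 : Cmod (INR k + 1) = (INR k + 1)%R).
  { rewrite <- RtoC_plus, Cmod_R, Rabs_pos_eq; lra. }
  assert (I : (Cmod (/ (INR k + 1)) <= 1)%R).
  { rewrite Cmod_inv, M1 by easy. rewrite <- Rinv_1. apply Rinv_le_contravar; lra. }
  assert (I0 := Cmod_ge_0 (/ (INR k + 1))).
  apply (mk_jet _ _ (- (/ (INR k + 1) * / (INR k + 1))) 2%R); replace (INR k + 1 + 0) with (RtoC (INR k) + 1) by ring.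
  - lra.
  - rewrite Cmod_opp, Cmod_mult. nra.
  - intros e He.
    assert (K : (1 / 2 <= Cmod (INR k + 1 + e))%R).
    { assert (Q := Cmod_triangle_rev (INR k + 1) (- e)). rewrite M1, Cmod_opp in Q.
      replace (INR k + 1 - - e) with (INR k + 1 + e) in Q by ring. lra. }
    assert (H2 : INR k + 1 + e <> 0) by (apply Cmod_gt_0; lra).
    replace (/ (INR k + 1 + e) - / (INR k + 1) - e * - (/ (INR k + 1) * / (INR k + 1)))
      with (/ (INR k + 1) * / (INR k + 1) * / (INR k + 1 + e) * (e * e)) by (field; easy).
    rewrite !Cmod_mult, (Cmod_inv (INR k + 1 + e)) by easy.
    replace (Cmod e ^ 2)%R with (Cmod e * Cmod e)%R by ring.
    assert (H0 := Cmod_ge_0 e).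
    apply Rmult_le_compat_r; [nra|].
    assert (J : (/ Cmod (INR k + 1 + e) <= 2)%R).
    { replace 2%R with (/ (1 / 2))%R by field. apply Rinv_le_contravar; lra. }
    assert (J0 : (0 < / Cmod (INR k + 1 + e))%R) by (apply Rinv_0_lt_compat; lra).
    assert (P : (Cmod (/ (INR k + 1)) * Cmod (/ (INR k + 1)) <= 1)%R) by nra. nra.
Qed.

(** The factor [3] arises because value, derivative and remainder of the sum are each bounded by the
    sum of the sizes. *)
Lemma jet_series (f : nat -> C -> C) (F : C -> C) (N : nat -> R) :
  (forall k, jet (f k) (N k)) -> ex_series N ->
  (forall e, (Cmod e <= 1 / 2)%R -> is_series (fun k => f k e) (F e)) ->
  jet F (3 * Series N).
Proof.
  intros J HN HF.
  assert (NP : forall k, (0 <= N k)%R) by (intros; apply (jet_size_pos _ _ (J k))).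
  assert (D : forall k, (Cmod (jet_der (J k)) <= N k)%R).
  { intros k. assert (Q := jet_size (J k)). assert (Q1 := jet_rem_pos (J k)).
    assert (Q2 := Cmod_ge_0 (f k 0)). lra. }
  set (d := CSeries (fun k => jet_der (J k))).
  assert (Hd : is_series (fun k => jet_der (J k)) d).
  { destruct (ex_series_C_le _ N D HN) as [l Hl]. unfold d. now rewrite (is_series_CSeries _ _ Hl). }
  assert (B : forall (a : nat -> C) (l : C), is_series a l -> forall c, (0 <= c)%R ->
     (forall k, (Cmod (a k) <= N k * c)%R) -> (Cmod l <= Series N * c)%R).
  { intros a l Hl c Hc Ha. rewrite <- (Cminus_0_r l).
    apply is_series_tends in Hl. apply (tends_le (FF := eventually_filter) _ _ _ _ _ Hl).
    apply filter_forall. intros n. rewrite Cminus_0_r.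
    eapply Rle_trans; [|apply Rmult_le_compat_r; [exact Hc|apply (sum_n_le_series N n NP HN)]].
    clear - Ha. induction n; [rewrite sum_n_0_C, sum_n_0_R; apply Ha|].
    rewrite sum_n_S_C, sum_n_S_R. eapply Rle_trans; [apply Cmod_triangle|].
    rewrite Rmult_plus_distr_r. now apply Rplus_le_compat. }
  apply (mk_jet _ _ d (Series N)).
  - replace 0%R with (Series (fun _ => 0)%R).
    + apply Series_le; [|exact HN]. intros n; split; [lra|apply NP].
    + rewrite (Series_ext _ (fun n => 0 * N n)%R) by (intros; ring).
      rewrite Series_scal_l. ring.
  - assert (B1 := B _ _ (HF 0 Cmod_0_le_half) 1%R Rle_0_1).
    assert (B2 := B _ _ Hd 1%R Rle_0_1).
    rewrite Rmult_1_r in B1, B2.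
    assert (Cmod (F 0) <= Series N)%R.
    { apply B1. intros k. rewrite Rmult_1_r. apply (jet_bound _ _ (J k)), Cmod_0_le_half. }
    assert (Cmod d <= Series N)%R.
    { apply B2. intros k. rewrite Rmult_1_r. apply D. }
    lra.
  - intros e He. apply (B (fun k => f k e - f k 0 - e * jet_der (J k))).
    + apply is_series_tends.
      assert (S1 := proj1 (is_series_tends _ _) (HF e He)).
      assert (S2 := proj1 (is_series_tends _ _) (HF 0 Cmod_0_le_half)).
      assert (S3 := proj1 (is_series_tends _ _) Hd).
      eapply tends_ext_all; [apply _| |apply tends_minus; [apply _|apply tends_minus; [apply _|exact S1|exact S2]|
        apply tends_mult; [apply _|apply (tends_const _ e)|exact S3]]].
      intros n. cbv beta. induction n; [now rewrite !sum_n_0_C|].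
      rewrite !sum_n_S_C, <- IHn. ring.
    + assert (Q := Cmod_ge_0 e). nra.
    + intros k. eapply Rle_trans; [apply (jet_approx (J k) e He)|].
      apply Rmult_le_compat_r; [assert (Q := Cmod_ge_0 e); nra|].
      assert (Q := jet_size (J k)). assert (Q1 := Cmod_ge_0 (f k 0)).
      assert (Q2 := Cmod_ge_0 (jet_der (J k))). lra.
Qed.

(** * The reciprocal Gamma function near the integers *)

(** The value at [e = 0] is zero and the derivative [x - ln (1 + x)] is at most [x^2]. For
    [|e| <= 1 / 2] the bound [exp |e| <= 3] keeps the remainder coefficient below [4 x^2], whence a
    size below [6 x^2]. *)
Lemma jet_gauss_term (j : nat) : jet (fun e => gauss_term e j) (6 * / (INR j + 1) ^ 2).
Proof.
  set (x := (/ (INR j + 1))%R). set (l := ln (1 + x)).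
  assert (Hx : (0 < x <= 1)%R) by apply inv_INR_1.
  assert (Hl := ln_1_inv_bounds x (proj1 Hx)). fold l in Hl.
  assert (E0 : gauss_term 0 j = 0).
  { unfold gauss_term. rewrite Cmult_0_l. replace (- RtoC 0) with (RtoC 0) by ring. rewrite Cexp_0.
    unfold Cdiv. ring. }
  replace (/ (INR j + 1) ^ 2)%R with (x ^ 2)%R by (unfold x; now rewrite pow_inv).
  apply (mk_jet _ _ (x - l)%R (4 * x ^ 2)%R).
  - nra.
  - rewrite E0, Cmod_0, Cmod_R, Rabs_pos_eq by lra. nra.
  - intros e He. rewrite E0. replace (gauss_term e j - 0) with (gauss_term e j) by ring.
    eapply Rle_trans; [apply gauss_term_jet|]. fold x.
    assert (H0 := Cmod_ge_0 e).
    assert (K : (exp (Cmod e) <= 3)%R).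
    { eapply Rle_trans; [|apply exp_le_3]. apply exp_mono. lra. }
    assert (K0 := exp_pos (Cmod e)).
    replace (4 * x ^ 2 * Cmod e ^ 2)%R with (x ^ 2 * (4 * Cmod e ^ 2))%R by ring.
    apply Rmult_le_compat_l; [nra|].
    replace (Cmod e ^ 2 / 2 * exp (Cmod e) * (1 + Cmod e) + Cmod e ^ 2)%R
      with (Cmod e ^ 2 * (exp (Cmod e) * (1 + Cmod e) / 2 + 1))%R by field.
    rewrite (Rmult_comm 4). apply Rmult_le_compat_l; nra.
Qed.

(** Since sizes are submultiplicative and [1 + N <= exp N], all partial products of Euler's product
    have jets of size at most [exp T]. Hence [rGamma (1 + e) - 1], the series of their differences,
    has terms with summable sizes. The existence is informative because the derivative stored in a
    [jet] is used later as a limit. *)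
Lemma jet_rGamma_1 : {N : R & jet (fun e => rGamma (1 + e)) N}.
Proof.
  set (T := Series (fun k => (6 * / (INR k + 1) ^ 2)%R)).
  assert (HT : ex_series (fun k => (6 * / (INR k + 1) ^ 2)%R)) by (apply ex_series_scal_R, ex_series_inv_sq).
  assert (P : forall n, jet (fun e => Cprod (gauss_term e) n) (exp T)).
  { assert (Pos : forall k, (0 <= 6 * / (INR k + 1) ^ 2)%R).
    { intros k. apply Rmult_le_pos; [lra|]. left. apply Rinv_0_lt_compat, pow_lt. assert (Q := pos_INR k). lra. }
    assert (P : forall n, jet (fun e => Cprod (gauss_term e) (S n)) (exp (sum_n (fun k => (6 * / (INR k + 1) ^ 2)%R) n))).
    { assert (Q : forall k, jet (fun e => 1 + gauss_term e k) (exp (6 * / (INR k + 1) ^ 2))).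
      { intros k. eapply jet_le; [|exact (jet_plus _ _ _ _ (jet_const 1) (jet_gauss_term k))].
        rewrite Cmod_1. apply exp_ineq1_le. }
      induction n.
      - rewrite sum_n_0_R. apply (jet_ext (fun e => 1 + gauss_term e 0)); [|apply Q].
        intros; simpl; ring.
      - rewrite sum_n_S_R, exp_plus. exact (jet_mult _ _ _ _ IHn (Q (S n))). }
    intros n. destruct n.
    - eapply jet_le; [|exact (jet_const 1)]. rewrite Cmod_1, <- exp_0. apply exp_mono.
      eapply Rle_trans; [|apply (sum_n_le_series _ 0 Pos HT)]. rewrite sum_n_0_R. apply Pos.
    - eapply jet_le; [|exact (P n)]. apply exp_mono. now apply sum_n_le_series. }
  assert (J := fun k => jet_mult _ _ _ _ (P k) (jet_gauss_term k)). cbv beta in J.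
  set (F := fun e => rGamma (1 + e) - 1).
  assert (JF : jet F (3 * Series (fun k => (exp T * (6 * / (INR k + 1) ^ 2))%R))).
  { apply (jet_series _ F _ J).
    - now apply ex_series_scal_R.
    - intros e He. apply is_series_tends. unfold F.
      destruct (gauss_cv e) as [l [Hl Hl']].
      assert (El : rGamma (1 + e) = l).
      (* From [gauss_cv] one has [rGamma e = e * l], which determines [l] only for [e <> 0]; at
         [e = 0] all factors of the product are [1]. *)
      { destruct (Ceq_dec e 0) as [->|Hne].
        - replace (1 + 0) with (RtoC 1) by ring. rewrite rGamma_1.
          apply (tends_unique (FF := eventually_filter) _ (fun _ => 1) _ _ (tends_const _ 1)).
          eapply tends_ext_all; [apply _| |exact Hl]. intros n. induction n; [easy|].
          cbn [Cprod]. rewrite IHn. unfold gauss_term, Cdiv. rewrite !Cmult_0_l.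
          replace (- RtoC 0) with (RtoC 0) by ring. rewrite Cexp_0. ring.
        - assert (Q := tends_unique (FF := eventually_filter) _ _ _ _ (rGamma_tends e) Hl').
          rewrite rGamma_rec in Q. rewrite (Cplus_comm 1).
          replace (rGamma (e + 1)) with (/ e * (e * rGamma (e + 1))) by (field; easy).
          rewrite Q. field. easy. }
      rewrite El.
      assert (Hs := tends_eventually_shift _ _ 1 Hl).
      eapply tends_ext_all; [apply _| |apply tends_minus; [apply _|exact Hs|apply (tends_const _ 1)]].
      intros n. cbv beta. rewrite Nat.add_1_r. induction n.
      + rewrite sum_n_0_C. simpl. ring.
      + rewrite sum_n_S_C, <- IHn. simpl. ring. }
  eexists. apply (jet_ext (fun e => F e + 1)); [|exact (jet_plus _ _ _ _ JF (jet_const 1))].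
  intros e _. unfold F. ring.
Qed.

(** Each upward step divides by [n + 1 + e] and is charged a factor [4]. This gives away the decay
    of [1 / Gamma], but the [1 / k!] in the Bessel series compensates for it. *)
Lemma jet_rGamma_pos : {N : R & forall n, jet (fun e => rGamma (1 + INR n + e)) (N * 4 ^ n)}.
Proof.
  destruct jet_rGamma_1 as [N J]. exists N. induction n.
  - rewrite Rmult_1_r. apply (jet_ext (fun e => rGamma (1 + e))); [|exact J].
    intros e _. f_equal. simpl. ring.
  - apply (jet_ext (fun e => / (INR n + 1 + e) * rGamma (1 + INR n + e))).
    + intros e He. rewrite (rGamma_rec (1 + INR n + e)).
      replace (1 + INR (S n) + e) with (1 + INR n + e + 1) by (rewrite INR_C_S; ring).
      assert (Hne : INR n + 1 + e <> 0).
      { intros E. assert (K := pos_INR n). assert (Q : Cmod e = (INR n + 1)%R); [|lra].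
        replace e with (- RtoC (INR n + 1)).
        - rewrite Cmod_opp, Cmod_R, Rabs_pos_eq; lra.
        - rewrite RtoC_plus. replace e with ((INR n + 1 + e) - (INR n + 1)) by ring. rewrite E. ring. }
      replace (1 + INR n + e) with (INR n + 1 + e) by ring. field. easy.
    + eapply jet_le; [|exact (jet_mult _ _ _ _ (jet_inv_shift n) IHn)]. simpl. lra.
Qed.

(** Every integer is [1 + n - p]; in the Bessel series near a negative integer [p] stays fixed while
    [n] grows. Each downward step multiplies by [e - p], of size at most [p + 1], which produces the
    factorial. *)
Lemma jet_rGamma_int : {N : R & forall p n, jet (fun e => rGamma (1 + INR n - INR p + e)) (N * INR (fact (S p)) * 4 ^ n)}.
Proof.
  destruct jet_rGamma_pos as [N J]. exists N.
  assert (HN : (0 <= N)%R) by (assert (Q := jet_size_pos _ _ (J 0%nat)); lra).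
  assert (Z : forall p, jet (fun e => rGamma (1 - INR p + e)) (N * INR (fact (S p)))).
  { induction p.
    - specialize (J 0%nat). apply (jet_ext (fun e => rGamma (1 + INR 0 + e))).
      + intros e _. f_equal. simpl. ring.
      + eapply jet_le; [|exact J]. simpl. lra.
    - apply (jet_ext (fun e => (- INR p + 1 * e) * rGamma (1 - INR p + e))).
      + intros e _. rewrite (rGamma_rec (1 - INR (S p) + e)), INR_C_S. f_equal; [ring|f_equal; ring].
      + eapply jet_le; [|exact (jet_mult _ _ _ _ (jet_affine (- INR p) 1) IHp)].
        rewrite Cmod_1, Cmod_opp, Cmod_R, Rabs_pos_eq by apply pos_INR.
        change (fact (S (S p))) with (S (S p) * fact (S p))%nat. rewrite mult_INR, !S_INR.
        assert (Q := pos_INR (fact (S p))). assert (Q2 := pos_INR p).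
        assert (0 <= N * INR (fact (S p)))%R by now apply Rmult_le_pos. nra. }
  intros p n.
  assert (F1 : forall q, (1 <= INR (fact q))%R).
  { intros q. apply (le_INR 1). apply lt_O_fact. }
  assert (P4 : forall q, (1 <= 4 ^ q)%R) by (intros; apply pow_R1_Rle; lra).
  destruct (le_lt_dec p n) as [h|h].
  - apply (jet_ext (fun e => rGamma (1 + INR (n - p) + e))).
    + intros e _. f_equal. rewrite minus_INR, RtoC_minus by easy. ring.
    + eapply jet_le; [|exact (J (n - p)%nat)].
      rewrite Rmult_assoc. apply Rmult_le_compat_l; [easy|].
      apply Rle_trans with (1 * 4 ^ n)%R.
      * rewrite Rmult_1_l. apply Rle_pow; [lra|lia].
      * apply Rmult_le_compat_r; [|apply F1]. specialize (P4 n). lra.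
  - apply (jet_ext (fun e => rGamma (1 - INR (p - n) + e))).
    + intros e _. f_equal. rewrite minus_INR, RtoC_minus by lia. ring.
    + eapply jet_le; [|exact (Z (p - n)%nat)].
      rewrite Rmult_assoc. apply Rmult_le_compat_l; [easy|].
      apply Rle_trans with (INR (fact (S p)) * 1)%R.
      * rewrite Rmult_1_r. apply le_INR, fact_le. lia.
      * apply Rmult_le_compat_l; [apply pos_INR|apply P4].
Qed.

Lemma jet_tends (f : C -> C) (N : R) : jet f N -> tends (locally (RtoC 0)) f (f 0).
Proof.
  intros J eps He. assert (HN := jet_size_pos _ _ J). apply locally_Cmod.
  exists (Rmin (1 / 2) (eps / (N + 1))). split.
  - apply Rmin_pos; [lra|]. apply Rdiv_lt_0_compat; lra.
  - intros e Hx. replace (e - 0) with e in Hx by ring.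
    assert (H1 := Rmin_l (1 / 2) (eps / (N + 1))). assert (H2 := Rmin_r (1 / 2) (eps / (N + 1))).
    destruct J as [d c Hc Hs Ha]. specialize (Ha e ltac:(lra)).
    replace (f e - f 0) with ((f e - f 0 - e * d) + e * d) by ring.
    eapply Rle_lt_trans; [apply Cmod_triangle|]. rewrite Cmod_mult.
    assert (H3 := Cmod_ge_0 e). assert (H4 := Cmod_ge_0 d). assert (H5 := Cmod_ge_0 (f 0)).
    apply Rle_lt_trans with (Cmod e * (N + 1))%R.
    + assert (0 <= c * (Cmod e * (1 - Cmod e)))%R by (repeat apply Rmult_le_pos; lra).
      assert (Cmod e * (c + Cmod d) <= Cmod e * (N + 1))%R by (apply Rmult_le_compat_l; lra). lra.
    + apply Rlt_le_trans with (eps / (N + 1) * (N + 1))%R; [apply Rmult_lt_compat_r; lra|].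
      right. field. lra.
Qed.

Lemma jet_slope (f : C -> C) (N : R) (J : jet f N) : f 0 = 0 ->
  tends (locally' (RtoC 0)) (fun e => f e / e) (jet_der J).
Proof.
  destruct J as [d c Hc Hs Ha]. intros H0 eps He. simpl. apply locally'_Cmod.
  exists (Rmin (1 / 2) (eps / (c + 1))). split.
  - apply Rmin_pos; [lra|]. apply Rdiv_lt_0_compat; lra.
  - intros e Hx Hne. replace (e - 0) with e in Hx by ring.
    assert (H1 := Rmin_l (1 / 2) (eps / (c + 1))). assert (H2 := Rmin_r (1 / 2) (eps / (c + 1))).
    specialize (Ha e ltac:(lra)). rewrite H0 in Ha.
    replace (f e / e - d) with ((f e - 0 - e * d) * / e) by (field; easy).
    rewrite Cmod_mult, Cmod_inv by easy. assert (H3 : (0 < Cmod e)%R) by now apply Cmod_gt_0.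
    apply Rle_lt_trans with (c * Cmod e)%R.
    + apply Rmult_le_reg_r with (Cmod e); [easy|]. rewrite Rmult_assoc, Rinv_l by lra. nra.
    + apply Rlt_le_trans with ((c + 1) * (eps / (c + 1)))%R; [|right; field; lra].
      nra.
Qed.

(** * Improper integrals over (0, PI) *)

Definition is_CInt (f : R -> C) (a b : R) (l : C) : Prop :=
  is_RInt (fun t => Re (f t)) a b (Re l) /\ is_RInt (fun t => Im (f t)) a b (Im l).

Lemma is_CInt_unique (f : R -> C) (a b : R) (l l' : C) : is_CInt f a b l -> is_CInt f a b l' -> l = l'.
Proof.
  intros [H1 H2] [H3 H4]. apply C_ext.
  - rewrite <- (is_RInt_unique _ _ _ _ H1). now apply is_RInt_unique.
  - rewrite <- (is_RInt_unique _ _ _ _ H2). now apply is_RInt_unique.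
Qed.

Lemma is_CInt_plus (f g : R -> C) (a b : R) (l m : C) :
  is_CInt f a b l -> is_CInt g a b m -> is_CInt (fun t => f t + g t) a b (l + m).
Proof. intros [H1 H2] [H3 H4]; split; simpl; now apply @is_RInt_plus. Qed.

Lemma is_RInt_Rlin (u v : R -> R) (a b x y lu lv : R) :
  is_RInt u a b lu -> is_RInt v a b lv ->
  is_RInt (fun t => (x * u t + y * v t)%R) a b (x * lu + y * lv)%R.
Proof.
  intros Hu Hv.
  exact (is_RInt_plus _ _ _ _ _ _ (is_RInt_scal _ _ _ x _ Hu) (is_RInt_scal _ _ _ y _ Hv)).
Qed.

Lemma is_CInt_scal (f : R -> C) (a b : R) (c l : C) :
  is_CInt f a b l -> is_CInt (fun t => c * f t) a b (c * l).
Proof.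
  intros [H1 H2]; split.
  - replace (Re (c * l)) with (Re c * Re l + - Im c * Im l)%R by (unfold Re, Im; simpl; ring).
    eapply is_RInt_ext; [|apply (is_RInt_Rlin _ _ _ _ (Re c) (- Im c) _ _ H1 H2)].
    intros t _. unfold Re, Im; simpl; ring.
  - replace (Im (c * l)) with (Im c * Re l + Re c * Im l)%R by (unfold Re, Im; simpl; ring).
    eapply is_RInt_ext; [|apply (is_RInt_Rlin _ _ _ _ (Im c) (Re c) _ _ H1 H2)].
    intros t _. unfold Re, Im; simpl; ring.
Qed.

Lemma is_CInt_ext (f g : R -> C) (a b : R) (l : C) : (a <= b)%R ->
  (forall t, (a < t < b)%R -> f t = g t) -> is_CInt f a b l -> is_CInt g a b l.
Proof.
  intros Hab E [H1 H2]; split; (eapply is_RInt_ext; [|eassumption]);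
    rewrite Rmin_left, Rmax_right by easy; intros t Ht; simpl; now rewrite E.
Qed.

Lemma is_CInt_Chasles (f : R -> C) (a b c : R) (l m : C) :
  is_CInt f a b l -> is_CInt f b c m -> is_CInt f a c (l + m).
Proof. intros [H1 H2] [H3 H4]; split; simpl; now apply @is_RInt_Chasles with b. Qed.

Lemma tends_continuous_Re (f : R -> C) (t : R) : tends (locally t) f (f t) -> continuous (fun x => Re (f x)) t.
Proof. intros H. now apply tends_Re; [apply _|]. Qed.

Lemma tends_continuous_Im (f : R -> C) (t : R) : tends (locally t) f (f t) -> continuous (fun x => Im (f x)) t.
Proof. intros H. now apply tends_Im; [apply _|]. Qed.

Lemma is_CInt_ex (f : R -> C) (a b : R) : (a <= b)%R ->
  (forall t, (a <= t <= b)%R -> tends (locally t) f (f t)) -> is_CInt f a b (RInt (fun t => Re (f t)) a b, RInt (fun t => Im (f t)) a b).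
Proof.
  intros Hab H. split; apply (@RInt_correct R_CompleteNormedModule); apply (@ex_RInt_continuous R_CompleteNormedModule);
    rewrite Rmin_left, Rmax_right by easy; intros t Ht.
  - now apply tends_continuous_Re, H.
  - now apply tends_continuous_Im, H.
Qed.

Lemma is_CInt_derive (f df : R -> C) (a b : R) : (a <= b)%R ->
  (forall t, (a <= t <= b)%R -> Cderiv f t (df t)) ->
  (forall t, (a <= t <= b)%R -> tends (locally t) df (df t)) ->
  is_CInt df a b (f b - f a).
Proof.
  intros Hab H1 H2. split.
  - apply (is_RInt_derive (fun t => Re (f t)) (fun t => Re (df t))); rewrite Rmin_left, Rmax_right by easy; intros t Ht.
    + now apply H1.
    + now apply tends_continuous_Re, H2.
  - apply (is_RInt_derive (fun t => Im (f t)) (fun t => Im (df t))); rewrite Rmin_left, Rmax_right by easy; intros t Ht.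
    + now apply H1.
    + now apply tends_continuous_Im, H2.
Qed.

Lemma is_RInt_const_R (a b c : R) : is_RInt (fun _ => c) a b (c * (b - a))%R.
Proof. rewrite Rmult_comm. exact (is_RInt_const a b c). Qed.

(* Project on the direction of the integral. *)
Lemma is_CInt_norm_le (f : R -> C) (g : R -> R) (a b : R) (l : C) (m : R) : (a <= b)%R ->
  (forall t, (a < t < b)%R -> (Cmod (f t) <= g t)%R) ->
  is_CInt f a b l -> is_RInt g a b m -> (Cmod l <= m)%R.
Proof.
  intros Hab H [H1 H2] Hg.
  destruct (Rle_lt_or_eq_dec 0 (Cmod l) (Cmod_ge_0 _)) as [Hl|Hl].
  - assert (K := is_RInt_Rlin _ _ _ _ (Re l) (Im l) _ _ H1 H2).
    assert (K2 := is_RInt_scal _ _ _ (Cmod l) _ Hg).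
    assert (K3 := is_RInt_le _ _ _ _ _ _ Hab K K2).
    assert (Q := Cmod2_alt l).
    assert (K4 : (Re l * Re l + Im l * Im l <= Cmod l * m)%R).
    { apply K3. intros t Ht. eapply Rle_trans; [apply Cmod_dot_le|].
      apply Rmult_le_compat_l; [lra|now apply H]. }
    nra.
  - rewrite <- Hl. apply (is_RInt_le (fun _ => 0%R) g a b _ _ Hab); [|exact Hg|].
    + assert (Z := is_RInt_const_R a b 0). now rewrite Rmult_0_l in Z.
    + intros t Ht. eapply Rle_trans; [|apply (H t Ht)]. apply Cmod_ge_0.
Qed.

(** [CInt_0_PI] has a value for every integrand; this predicate records that the improper integral
    converges, and [imp_int_CInt_0_PI] then identifies the value. *)
Definition imp_int (f : R -> C) (l : C) : Prop :=
  exists F : R -> C, (forall t, (0 <= t < PI)%R -> is_CInt f 0 t (F t)) /\ tends (at_left PI) F l.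

Lemma at_left_PI_interval (a : R) : (a < PI)%R -> at_left PI (fun t => (a < t < PI)%R).
Proof.
  intros Ha. unfold at_left, within.
  assert (H : locally PI (fun t => (a < t)%R)).
  { exists (mkposreal (PI - a) ltac:(lra)). intros t Ht. simpl in Ht.
    apply Rabs_lt_between in Ht. unfold minus, plus, opp in Ht. simpl in Ht. lra. }
  revert H. apply filter_imp. intros; lra.
Qed.

Lemma imp_int_unique (f : R -> C) (l l' : C) : imp_int f l -> imp_int f l' -> l = l'.
Proof.
  intros [F [H1 H2]] [F' [H1' H2']].
  apply (tends_unique (FF := at_left_proper_filter PI) (at_left PI) F); auto.
  eapply tends_ext; [apply _| |exact H2'].
  generalize (at_left_PI_interval 0 PI_RGT_0). apply filter_imp. intros t Ht.
  apply (is_CInt_unique f 0 t); [apply H1'|apply H1]; lra.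
Qed.

Lemma imp_int_plus (f g : R -> C) (l m : C) : imp_int f l -> imp_int g m -> imp_int (fun t => f t + g t) (l + m).
Proof.
  intros [F [H1 H2]] [G [H3 H4]]. exists (fun t => F t + G t). split.
  - intros t Ht. apply is_CInt_plus; auto.
  - apply tends_plus; auto; apply _.
Qed.

Lemma imp_int_scal (f : R -> C) (c l : C) : imp_int f l -> imp_int (fun t => c * f t) (c * l).
Proof.
  intros [F [H1 H2]]. exists (fun t => c * F t). split.
  - intros t Ht. apply is_CInt_scal; auto.
  - apply tends_mult; auto; try apply _. apply tends_const, _.
Qed.

Lemma imp_int_ext (f g : R -> C) (l : C) : (forall t, (0 < t < PI)%R -> f t = g t) -> imp_int f l -> imp_int g l.
Proof.
  intros E [F [H1 H2]]. exists F. split; auto. intros t Ht.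
  apply (is_CInt_ext f); [lra| |now apply H1]. intros x Hx. apply E. lra.
Qed.

Lemma imp_int_norm_le (f : R -> C) (g : R -> R) (l m : C) :
  (forall t, (0 < t < PI)%R -> (Cmod (f t) <= g t)%R) ->
  imp_int f l -> imp_int (fun t => RtoC (g t)) m -> (Cmod l <= Re m)%R.
Proof.
  intros H [F [H1 H2]] [G [H3 H4]].
  assert (K : forall t, (0 <= t < PI)%R -> (Cmod (F t) <= Re (G t))%R).
  { intros t Ht. apply (is_CInt_norm_le f g 0 t); [lra| |now apply H1|apply (H3 t Ht)].
    intros x Hx. apply H. lra. }
  apply Rnot_lt_le. intros HH.
  set (e := ((Cmod l - Re m) / 2)%R). assert (He : (0 < e)%R) by (unfold e; lra).
  destruct (filter_ex (F := at_left PI) _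
    (filter_and _ _ (at_left_PI_interval 0 PI_RGT_0) (filter_and _ _ (H2 e He) (H4 e He)))) as [t [Ht [T1 T2]]].
  specialize (K t ltac:(lra)).
  assert (Q1 := Cmod_triangle_rev l (F t)). rewrite Cmod_minus_sym in Q1.
  assert (Q2 := Rle_trans _ _ _ (Rle_abs _) (re_le_Cmod (G t - m))).
  replace (Re (G t - m)) with (Re (G t) - Re m)%R in Q2 by (unfold Re; simpl; ring).
  unfold e in *. lra.
Qed.

(** The integral up to [t] is Lipschitz in [t] with constant [M], hence Cauchy as [t] tends to
    [PI]. *)
Lemma imp_int_bounded (f : R -> C) (M : R) :
  (forall t, (0 <= t < PI)%R -> tends (locally t) f (f t)) ->
  (forall t, (0 <= t < PI)%R -> (Cmod (f t) <= M)%R) -> exists l, imp_int f l.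
Proof.
  intros Hc Hb.
  set (F := fun t => (RInt (fun t => Re (f t)) 0 t, RInt (fun t => Im (f t)) 0 t) : C).
  assert (HF : forall t, (0 <= t < PI)%R -> is_CInt f 0 t (F t)).
  { intros t Ht. apply is_CInt_ex; [lra|]. intros x Hx. apply Hc. lra. }
  assert (HM : (0 <= M)%R).
  { eapply Rle_trans; [apply Cmod_ge_0|apply (Hb 0%R)]. assert (K := PI_RGT_0). lra. }
  assert (D : forall s t, (0 <= s <= t)%R -> (t < PI)%R -> (Cmod (F t - F s) <= M * (t - s))%R).
  { intros s t Hs Ht.
    assert (K : is_CInt f s t (RInt (fun t => Re (f t)) s t, RInt (fun t => Im (f t)) s t)).
    { apply is_CInt_ex; [lra|]. intros x Hx. apply Hc. lra. }
    set (d := (RInt (fun t => Re (f t)) s t, RInt (fun t => Im (f t)) s t) : C) in *.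
    assert (E : F t = F s + d).
    { apply (is_CInt_unique f 0 t); [apply HF; lra|]. apply is_CInt_Chasles with s; [apply HF; lra|exact K]. }
    rewrite E. replace (F s + d - F s) with d by ring.
    apply (is_CInt_norm_le f (fun _ => M) s t); [lra| |exact K|].
    - intros x Hx. apply Hb. lra.
    - apply is_RInt_const_R. }
  assert (PF : ProperFilter (at_left PI)) by apply at_left_proper_filter.
  destruct (proj1 (filterlim_locally_cauchy (U := C_CompleteNormedModule) (F := at_left PI) F)) as [l Hl].
  - intros eps. set (h := (eps / (M + 1))%R).
    assert (Hh : (0 < h)%R) by (apply Rdiv_lt_0_compat; [apply cond_pos|lra]).
    exists (fun t => (Rmax 0 (PI - h) < t < PI)%R). split.
    + apply at_left_PI_interval. apply Rmax_lub_lt; [apply PI_RGT_0|lra].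
    + intros u v Hu Hv.
      assert (R1 := Rmax_l 0 (PI - h)). assert (R2 := Rmax_r 0 (PI - h)).
      assert (Heps : (M * h < eps)%R).
      { replace (pos eps) with ((M + 1) * h)%R by (unfold h; field; lra). nra. }
      apply C_NormedModule_mixin_compat1. change (Cmod (F v - F u) < eps)%R.
      destruct (Rle_lt_dec u v) as [Huv|Huv].
      * eapply Rle_lt_trans; [apply D; lra|]. eapply Rle_lt_trans; [|exact Heps].
        apply Rmult_le_compat_l; lra.
      * rewrite Cmod_minus_sym. eapply Rle_lt_trans; [apply D; lra|]. eapply Rle_lt_trans; [|exact Heps].
        apply Rmult_le_compat_l; lra.
  - exists l, F. split; [exact HF|]. apply tends_filterlim; [apply _|exact Hl].
Qed.

Lemma imp_int_CInt_0_PI (f : R -> C) (l : C) : imp_int f l -> CInt_0_PI f = l.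
Proof.
  intros [F [H1 H2]]. unfold CInt_0_PI.
  apply (is_RInt_gen_unique (V := C_R_CompleteNormedModule)).
  intros P HP.
  apply (proj1 (tends_filterlim _ _ _)) in H2. specialize (H2 P HP).
  apply Filter_prod with (Q := fun x => x = 0%R) (R := fun t => (0 < t < PI)%R /\ P (F t)).
  - reflexivity.
  - apply filter_and; [apply at_left_PI_interval, PI_RGT_0|exact H2].
  - intros x t -> [Ht HPt]. exists (F t). split; [|exact HPt]. simpl.
    destruct (H1 t ltac:(lra)) as [K1 K2]. destruct (F t) as [u v].
    now apply is_RInt_fct_extend_pair.
Qed.

(** * Cauchy's integral *)

Lemma one_plus_cos_pos (t : R) : (- PI < t < PI)%R -> (0 < 1 + cos t)%R.
Proof.
  intros Ht. assert (H : (0 < cos (t / 2))%R) by (apply cos_gt_0; lra).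
  replace t with (2 * (t / 2))%R by field. rewrite cos_2a_cos. nra.
Qed.

Lemma one_plus_cos_le (t : R) : (1 + cos t <= 2)%R.
Proof. assert (H := COS_bound t). lra. Qed.

Definition ucos (s : C) (t : R) : C := Cexp (s * ln (1 + cos t)).

Lemma ucos_plus (s s' : C) (t : R) : ucos (s + s') t = ucos s t * ucos s' t.
Proof. unfold ucos. now rewrite Cmult_plus_distr_r, Cexp_plus. Qed.

Lemma ucos_1 (t : R) : (- PI < t < PI)%R -> ucos 1 t = (1 + cos t)%R.
Proof.
  intros Ht. unfold ucos. rewrite Cmult_1_l, Cexp_RtoC, exp_ln; [easy|]. now apply one_plus_cos_pos.
Qed.

Lemma ucos_plus_1 (s : C) (t : R) : (- PI < t < PI)%R -> ucos (s + 1) t = ucos s t * (1 + cos t)%R.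
Proof. intros Ht. now rewrite ucos_plus, ucos_1. Qed.

Lemma ucos_INR (n : nat) (t : R) : (- PI < t < PI)%R -> ucos (INR n) t = ((1 + cos t) ^ n)%R.
Proof.
  intros Ht. induction n.
  - simpl. unfold ucos. rewrite Cmult_0_l. apply Cexp_0.
  - rewrite INR_C_S, ucos_plus_1, IHn by easy. rewrite <- RtoC_mult. f_equal. simpl. ring.
Qed.

Lemma Cmod_ucos (s : C) (t : R) : Cmod (ucos s t) = exp (Re s * ln (1 + cos t)).
Proof. unfold ucos. rewrite Cmod_Cexp. f_equal. unfold Re; simpl. ring. Qed.

Lemma Cmod_ucos_le (s : C) (t : R) : (0 <= Re s)%R -> (- PI < t < PI)%R ->
  (Cmod (ucos s t) <= exp (Re s * ln 2))%R.
Proof.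
  intros Hs Ht. rewrite Cmod_ucos. apply exp_mono. apply Rmult_le_compat_l; [easy|].
  assert (H := one_plus_cos_pos t Ht). destruct (Rle_lt_or_eq_dec _ _ (one_plus_cos_le t)) as [H2|H2].
  - left. now apply ln_increasing.
  - rewrite H2. apply Rle_refl.
Qed.

Lemma Cderiv_ucos (s : C) (t : R) : (- PI < t < PI)%R ->
  Cderiv (ucos s) t (- (s * sin t / (1 + cos t)%R) * ucos s t).
Proof.
  intros Ht. assert (H := one_plus_cos_pos t Ht). unfold ucos.
  eapply Cderiv_eq; [|apply Cderiv_Cexp, Cderiv_mult; [apply Cderiv_const|apply Cderiv_RtoC]].
  2:{ auto_derive; [exact H|reflexivity]. }
  cbv beta. f_equal. rewrite !RtoC_mult, RtoC_opp, RtoC_inv by lra. unfold Cdiv. ring.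
Qed.

Lemma Cderiv_tends (f : R -> C) (t : R) (d : C) : Cderiv f t d -> tends (locally t) f (f t).
Proof.
  intros [H1 H2].
  assert (K := tends_pair (locally t) _ _ _ _ (ex_derive_continuous _ _ (ex_intro _ _ H1)) (ex_derive_continuous _ _ (ex_intro _ _ H2))).
  eapply tends_ext_all; [apply _| |eapply tends_eq; [|exact K]].
  - intros x. simpl. now destruct (f x).
  - simpl. now destruct (f t).
Qed.

Definition ccos (mu : C) (t : R) : C := Ccos (mu * t).
Definition csin (mu : C) (t : R) : C := Csin (mu * t).

Lemma Cderiv_exp_lin (w : C) (t : R) : Cderiv (fun x => Cexp (w * x)) t (w * Cexp (w * t)).
Proof.
  eapply Cderiv_eq; [|apply Cderiv_Cexp, Cderiv_mult; [apply Cderiv_const|apply Cderiv_RtoC, @is_derive_id]].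
  change (one : R) with 1%R. cbv beta. ring.
Qed.

Lemma ccos_exp (mu : C) (t : R) : ccos mu t = (Cexp (Ci * mu * t) + Cexp (- Ci * mu * t)) / 2.
Proof.
  unfold ccos, Ccos. replace (Ci * (mu * t)) with (Ci * mu * t) by ring.
  replace (- (Ci * mu * t)) with (- Ci * mu * t) by ring. reflexivity.
Qed.

Lemma csin_exp (mu : C) (t : R) : csin mu t = (Cexp (Ci * mu * t) - Cexp (- Ci * mu * t)) / (2 * Ci).
Proof.
  unfold csin, Csin. replace (Ci * (mu * t)) with (Ci * mu * t) by ring.
  replace (- (Ci * mu * t)) with (- Ci * mu * t) by ring. reflexivity.
Qed.

Lemma Ci_2_neq_0 : 2 * Ci <> 0.
Proof. apply Cmult_neq_0; [apply RtoC_neq_0; lra|apply Ci_nz]. Qed.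

Lemma Ci_sq : Ci * Ci = - (1).
Proof. apply C_ext; simpl; ring. Qed.

Lemma inv_2Ci : / (2 * Ci) = - Ci / 2.
Proof.
  replace (- Ci / 2) with (/ (2 * Ci) * ((2 * Ci) * (- Ci / 2))).
  - replace (2 * Ci * (- Ci / 2)) with (- (Ci * Ci)) by field. rewrite Ci_sq. ring.
  - field. apply Ci_nz.
Qed.

Lemma Cderiv_ccos (mu : C) (t : R) : Cderiv (ccos mu) t (- mu * csin mu t).
Proof.
  eapply Cderiv_ext; [intros x; symmetry; apply ccos_exp|].
  eapply Cderiv_eq; [|apply Cderiv_mult; [apply Cderiv_plus; apply Cderiv_exp_lin|apply (Cderiv_const (/ 2))]].
  rewrite csin_exp. unfold Cdiv. rewrite inv_2Ci. field.
Qed.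

Lemma Cderiv_csin (mu : C) (t : R) : Cderiv (csin mu) t (mu * ccos mu t).
Proof.
  eapply Cderiv_ext; [intros x; symmetry; apply csin_exp|].
  eapply Cderiv_eq; [|apply Cderiv_mult; [apply Cderiv_minus; apply Cderiv_exp_lin|apply (Cderiv_const (/ (2 * Ci)))]].
  rewrite ccos_exp. cbv beta. field. apply Ci_nz.
Qed.

Lemma ccos_minus_1_le (mu : C) (t : R) : (Cmod (ccos mu t - 1) <= (Cmod mu * Rabs t) ^ 2 * exp (Cmod mu * Rabs t))%R.
Proof.
  assert (K1 := Cexp_minus_2_le (Ci * mu * t)). assert (K2 := Cexp_minus_2_le (- Ci * mu * t)).
  rewrite !Cmod_mult, ?Cmod_opp, Cmod_Ci, Cmod_R, Rmult_1_l in K1.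
  rewrite !Cmod_mult, Cmod_opp, Cmod_Ci, Cmod_R, Rmult_1_l in K2.
  rewrite ccos_exp.
  replace ((Cexp (Ci * mu * t) + Cexp (- Ci * mu * t)) / 2 - 1)
    with (((Cexp (Ci * mu * t) - 1 - Ci * mu * t) + (Cexp (- Ci * mu * t) - 1 - - Ci * mu * t)) * / 2) by field.
  rewrite Cmod_mult, Cmod_inv, Cmod_R, Rabs_pos_eq by (try apply RtoC_neq_0; lra).
  assert (T := Cmod_triangle (Cexp (Ci * mu * t) - 1 - Ci * mu * t) (Cexp (- Ci * mu * t) - 1 - - Ci * mu * t)).
  assert (P := exp_pos (Cmod mu * Rabs t)).
  assert (P2 : (0 <= (Cmod mu * Rabs t) ^ 2 * exp (Cmod mu * Rabs t))%R) by (apply Rmult_le_pos; nra).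
  lra.
Qed.

Lemma Cmod_ccos_le (mu : C) (t : R) : (Cmod (ccos mu t) <= exp (Cmod mu * Rabs t))%R.
Proof.
  rewrite ccos_exp. unfold Cdiv. rewrite Cmod_mult, Cmod_inv, Cmod_R, Rabs_pos_eq by (try apply RtoC_neq_0; lra).
  assert (T := Cmod_triangle (Cexp (Ci * mu * t)) (Cexp (- Ci * mu * t))).
  assert (K1 := Cmod_Cexp_le (Ci * mu * t)). assert (K2 := Cmod_Cexp_le (- Ci * mu * t)).
  rewrite !Cmod_mult, ?Cmod_opp, Cmod_Ci, Cmod_R, Rmult_1_l in K1.
  rewrite !Cmod_mult, Cmod_opp, Cmod_Ci, Cmod_R, Rmult_1_l in K2. lra.
Qed.

Lemma Cmod_csin_le (mu : C) (t : R) : (Cmod (csin mu t) <= exp (Cmod mu * Rabs t))%R.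
Proof.
  rewrite csin_exp. unfold Cdiv. rewrite Cmod_mult, Cmod_inv, Cmod_mult, Cmod_Ci, Cmod_R, Rabs_pos_eq, Rmult_1_r
    by (try apply Ci_2_neq_0; lra).
  assert (T := Cmod_triangle_minus (Cexp (Ci * mu * t)) (Cexp (- Ci * mu * t))).
  assert (K1 := Cmod_Cexp_le (Ci * mu * t)). assert (K2 := Cmod_Cexp_le (- Ci * mu * t)).
  rewrite !Cmod_mult, ?Cmod_opp, Cmod_Ci, Cmod_R, Rmult_1_l in K1.
  rewrite !Cmod_mult, Cmod_opp, Cmod_Ci, Cmod_R, Rmult_1_l in K2. lra.
Qed.

Lemma exp_mu_t_le (mu : C) (t : R) : (0 <= t <= PI)%R -> (exp (Cmod mu * Rabs t) <= exp (Cmod mu * PI))%R.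
Proof.
  intros Ht. apply exp_mono. rewrite Rabs_pos_eq by lra. apply Rmult_le_compat_l; [apply Cmod_ge_0|lra].
Qed.

Lemma cauchy_continuous (s mu : C) (t : R) : (0 <= t < PI)%R ->
  tends (locally t) (fun x => ucos s x * ccos mu x) (ucos s t * ccos mu t).
Proof.
  intros Ht. assert (P := PI_RGT_0). apply tends_mult; [apply _| |].
  - eapply Cderiv_tends, Cderiv_ucos. lra.
  - eapply Cderiv_tends, Cderiv_ccos.
Qed.

(** The boundary term of the integration by parts. The combination is chosen so that the terms with
    [sin (mu t)] cancel in the derivative; then [sin^2 t = u (2 - u)] with [u = 1 + cos t] leaves
    only the exponents [s] and [s + 1]. *)
Definition cauchy_bdry (s mu : C) (t : R) : C :=
  (s + 1) * (ucos s t * sin t * ccos mu t) - mu * (ucos (s + 1) t * csin mu t).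

Lemma Cderiv_cauchy_bdry (s mu : C) (t : R) : (- PI < t < PI)%R ->
  Cderiv (cauchy_bdry s mu) t
    ((s + 1 + mu) * (s + 1 - mu) * (ucos (s + 1) t * ccos mu t)
     + - ((s + 1) * (2 * s + 1)) * (ucos s t * ccos mu t)).
Proof.
  intros Ht. assert (H := one_plus_cos_pos t Ht).
  assert (H' : RtoC (1 + cos t) <> 0) by (apply RtoC_neq_0; lra).
  assert (K1 := Cderiv_mult _ _ _ _ _ (Cderiv_mult _ _ _ _ _ (Cderiv_ucos s t Ht)
    (Cderiv_RtoC _ _ _ (is_derive_sin t))) (Cderiv_ccos mu t)).
  assert (K2 := Cderiv_mult _ _ _ _ _ (Cderiv_ucos (s + 1) t Ht) (Cderiv_csin mu t)).
  assert (K := Cderiv_minus _ _ _ _ _ (Cderiv_mult _ _ _ _ _ (Cderiv_const (s + 1) t) K1)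
    (Cderiv_mult _ _ _ _ _ (Cderiv_const mu t) K2)).
  refine (Cderiv_eq _ _ _ _ _ K). clear K K1 K2.
  cbv beta. rewrite ucos_plus_1 by easy.
  assert (S2 : RtoC (sin t) * RtoC (sin t) = RtoC (1 + cos t) * (2 - RtoC (1 + cos t))).
  { rewrite <- RtoC_mult, <- RtoC_minus, <- RtoC_mult. f_equal. assert (Q := sin2_cos2 t). unfold Rsqr in Q. nra. }
  assert (C1 : RtoC (cos t) = RtoC (1 + cos t) - 1) by (rewrite RtoC_plus; ring).
  rewrite C1. set (u := RtoC (1 + cos t)) in *. set (U := ucos s t). set (c := ccos mu t). set (g := csin mu t).
  set (S := RtoC (sin t)) in *.
  transitivity ((s + 1) * (- (s * (S * S) / u) * U * c + U * (u - 1) * c - U * S * mu * g)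
     - mu * (- ((s + 1) * S) * U * g + U * u * mu * c)).
  - field. easy.
  - rewrite S2. field. easy.
Qed.

Lemma at_left_PI_cos (d : R) : (0 < d)%R -> at_left PI (fun t => (1 + cos t < d)%R).
Proof.
  intros Hd. unfold at_left, within.
  assert (K : filterlim cos (locally PI) (locally (cos PI))).
  { apply (ex_derive_continuous cos). exists (- sin PI)%R. apply is_derive_cos. }
  assert (K2 := proj1 (filterlim_locally cos (cos PI)) K (mkposreal d Hd)).
  revert K2. apply filter_imp. intros t Ht _. rewrite cos_PI in Ht.
  change (Rabs (cos t - - (1)) < d)%R in Ht. apply Rabs_lt_between in Ht. lra.
Qed.

Lemma ucos_at_PI (x : R) : (0 < x)%R ->
  filterlim (fun t => exp (x * ln (1 + cos t))) (at_left PI) (locally 0%R).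
Proof.
  intros Hx. apply filterlim_locally. intros eps.
  assert (K := at_left_PI_cos (exp (ln eps / x)) (exp_pos _)).
  generalize (filter_and _ _ K (at_left_PI_interval 0 PI_RGT_0)). apply filter_imp.
  intros t [H1 H2]. change (Rabs (exp (x * ln (1 + cos t)) - 0) < eps)%R.
  assert (H3 := one_plus_cos_pos t ltac:(lra)).
  rewrite Rminus_0_r, Rabs_pos_eq by (left; apply exp_pos).
  rewrite <- (exp_ln eps) by apply cond_pos. apply exp_increasing.
  apply ln_increasing in H1; [|easy]. rewrite ln_exp in H1.
  replace (ln eps) with (x * (ln eps / x))%R by (field; lra).
  now apply Rmult_lt_compat_l.
Qed.

(** From [sin^2 t = (1 - cos t) (1 + cos t)]. The half power gained makes the boundary term vanish
    at [PI] as soon as [Re s > - 1 / 2]. *)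
Lemma sin_le_ucos (t : R) : (- PI < t < PI)%R -> (Rabs (sin t) <= 2 * exp (1 / 2 * ln (1 + cos t)))%R.
Proof.
  intros Ht. assert (H := one_plus_cos_pos t Ht). assert (H2 := one_plus_cos_le t).
  set (e := exp (1 / 2 * ln (1 + cos t))). assert (He : (0 < e)%R) by apply exp_pos.
  assert (E : (e * e = 1 + cos t)%R).
  { unfold e. rewrite <- exp_plus. replace (1 / 2 * ln (1 + cos t) + 1 / 2 * ln (1 + cos t))%R with (ln (1 + cos t)) by field.
    now apply exp_ln. }
  assert (Q := sin2_cos2 t). unfold Rsqr in Q.
  apply Rsqr_incr_0_var; [|lra]. rewrite <- Rsqr_abs. unfold Rsqr. nra.
Qed.

Lemma filterlim_Rlin {T} (F : (T -> Prop) -> Prop) {FF : Filter F} (u v : T -> R) (a b x y : R) :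
  filterlim u F (locally x) -> filterlim v F (locally y) ->
  filterlim (fun t => (a * u t + b * v t)%R) F (locally (a * x + b * y)%R).
Proof.
  intros Hu Hv.
  assert (K := tends_plus F _ _ _ _ (tends_mult F _ _ _ _ (tends_const F a) (tends_RtoC F _ _ Hu))
    (tends_mult F _ _ _ _ (tends_const F b) (tends_RtoC F _ _ Hv))).
  apply tends_Re in K; [|exact FF].
  replace (a * x + b * y)%R with (Re (a * x + b * y)) by (unfold Re; simpl; ring).
  eapply filterlim_ext; [|exact K]. intros t. unfold Re; simpl; ring.
Qed.

Lemma cauchy_bdry_at_PI (s mu : C) : (- (1 / 2) < Re s)%R -> tends (at_left PI) (cauchy_bdry s mu) 0.
Proof.
  intros Hs. set (E := exp (Cmod mu * PI)).
  apply tends_squeeze with (g := fun t =>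
    (Cmod (s + 1) * 2 * E * exp ((Re s + 1 / 2) * ln (1 + cos t)) + Cmod mu * E * exp ((Re s + 1) * ln (1 + cos t)))%R); [apply _| |].
  - generalize (at_left_PI_interval 0 PI_RGT_0). apply filter_imp. intros t Ht.
    assert (Ht' : (- PI < t < PI)%R) by lra.
    assert (L := exp_mu_t_le mu t ltac:(lra)). fold E in L.
    rewrite Cminus_0_r. unfold cauchy_bdry. eapply Rle_trans; [apply Cmod_triangle_minus|].
    rewrite !Cmod_mult, !Cmod_ucos, Cmod_R.
    assert (K1 := sin_le_ucos t Ht'). assert (K2 := Cmod_ccos_le mu t). assert (K3 := Cmod_csin_le mu t).
    apply Rplus_le_compat.
    + rewrite !Rmult_assoc. apply Rmult_le_compat_l; [apply Cmod_ge_0|].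
      replace ((Re s + 1 / 2) * ln (1 + cos t))%R with (Re s * ln (1 + cos t) + 1 / 2 * ln (1 + cos t))%R by ring.
      rewrite exp_plus.
      set (a := exp (Re s * ln (1 + cos t))). assert (Ha : (0 < a)%R) by apply exp_pos.
      set (b := exp (1 / 2 * ln (1 + cos t))) in *. assert (Hb : (0 < b)%R) by apply exp_pos.
      replace (2 * (E * (a * b)))%R with (a * (2 * b * E))%R by ring.
      apply Rmult_le_compat_l; [lra|]. apply Rmult_le_compat; [apply Rabs_pos|apply Cmod_ge_0|easy|lra].
    + rewrite !Rmult_assoc. apply Rmult_le_compat_l; [apply Cmod_ge_0|].
      rewrite (Rmult_comm E). replace (Re (s + 1)) with (Re s + 1)%R by reflexivity.
      apply Rmult_le_compat_l; [left; apply exp_pos|lra].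
  - replace 0%R with (Cmod (s + 1) * 2 * E * 0 + Cmod mu * E * 0)%R by ring.
    apply filterlim_Rlin; [apply _| |]; apply ucos_at_PI; lra.
Qed.

Lemma cauchy_bdry_0 (s mu : C) : cauchy_bdry s mu 0 = 0.
Proof.
  unfold cauchy_bdry, csin, Csin. rewrite sin_0, !Cmult_0_r.
  replace (- RtoC 0) with (RtoC 0) by ring. unfold Cdiv. ring.
Qed.

Lemma cauchy_int_bounded (s mu : C) : (0 <= Re s)%R ->
  exists l, imp_int (fun t => ucos s t * ccos mu t) l.
Proof.
  intros Hs. assert (P := PI_RGT_0).
  apply imp_int_bounded with (exp (Re s * ln 2) * exp (Cmod mu * PI))%R.
  - intros t Ht. now apply cauchy_continuous.
  - intros t Ht. rewrite Cmod_mult. apply Rmult_le_compat; try apply Cmod_ge_0.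
    + apply Cmod_ucos_le; lra.
    + eapply Rle_trans; [apply Cmod_ccos_le|]. apply exp_mu_t_le. lra.
Qed.

(** For [Re s < 0] the integrand may be unbounded at [PI]. Its convergence is transferred from the
    exponent [s + 1], where the integrand is bounded; the divisor [(s + 1) (2 s + 1)] has no zero
    with [Re s > - 1 / 2]. *)
Lemma cauchy_int_step (s mu l1 : C) : (- (1 / 2) < Re s)%R ->
  imp_int (fun t => ucos (s + 1) t * ccos mu t) l1 ->
  imp_int (fun t => ucos s t * ccos mu t) ((s + 1 + mu) * (s + 1 - mu) / ((s + 1) * (2 * s + 1)) * l1).
Proof.
  intros Hs [F [H1 H2]]. assert (P := PI_RGT_0).
  assert (D1 : s + 1 <> 0).
  { intros E. apply (f_equal Re) in E. unfold Re in *. simpl in E. lra. }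
  assert (D2 : 2 * s + 1 <> 0).
  { intros E. apply (f_equal Re) in E. unfold Re in *. simpl in E. lra. }
  set (A := (s + 1 + mu) * (s + 1 - mu)). set (D := (s + 1) * (2 * s + 1)).
  assert (HD : D <> 0) by now apply Cmult_neq_0.
  exists (fun t => A / D * F t + - / D * (cauchy_bdry s mu t - cauchy_bdry s mu 0)). split.
  - intros t Ht.
    apply (is_CInt_ext (fun x => A / D * (ucos (s + 1) x * ccos mu x) + - / D *
      (A * (ucos (s + 1) x * ccos mu x) + - D * (ucos s x * ccos mu x)))); [lra| |].
    + intros x Hx. field. easy.
    + apply is_CInt_plus; apply is_CInt_scal; [now apply H1|].
      apply is_CInt_derive; [lra| |].
      * intros x Hx. apply Cderiv_cauchy_bdry. lra.
      * intros x Hx. apply tends_plus; [apply _| |]; (apply tends_mult; [apply _|apply tends_const, _|apply cauchy_continuous; lra]).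
  - apply (tends_eq _ _ (A / D * l1 + - / D * (0 - 0))); [ring|].
    apply tends_plus; [apply _| |]; (apply tends_mult; [apply _|apply tends_const, _|]); [easy|].
    apply tends_minus; [apply _|now apply cauchy_bdry_at_PI|]. rewrite cauchy_bdry_0. apply tends_const, _.
Qed.

Definition cauchyI (s mu : C) : C := CInt_0_PI (fun t => ucos s t * ccos mu t).

Lemma cauchyI_correct (s mu : C) : (- (1 / 2) < Re s)%R ->
  imp_int (fun t => ucos s t * ccos mu t) (cauchyI s mu).
Proof.
  intros Hs. destruct (cauchy_int_bounded (s + 1) mu) as [l1 H1].
  { unfold Re in *; simpl; lra. }
  assert (K := cauchy_int_step s mu l1 Hs H1). unfold cauchyI.
  now rewrite (imp_int_CInt_0_PI _ _ K).
Qed.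

Lemma cauchyI_rec (s mu : C) : (- (1 / 2) < Re s)%R ->
  (s + 1 + mu) * (s + 1 - mu) * cauchyI (s + 1) mu = (s + 1) * (2 * s + 1) * cauchyI s mu.
Proof.
  intros Hs.
  assert (Hs1 : (- (1 / 2) < Re (s + 1))%R) by (unfold Re in *; simpl; lra).
  assert (K := cauchy_int_step s mu _ Hs (cauchyI_correct (s + 1) mu Hs1)).
  rewrite (imp_int_unique _ _ _ (cauchyI_correct s mu Hs) K). field. split.
  - intros E. apply (f_equal Re) in E. unfold Re in *. simpl in E. lra.
  - intros E. apply (f_equal Re) in E. unfold Re in *. simpl in E. lra.
Qed.

Lemma cauchyI_rec_n (s mu : C) (n : nat) : (- (1 / 2) < Re s)%R ->
  Crising (s + 1 + mu) n * Crising (s + 1 - mu) n * cauchyI (s + INR n) mu =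
  2 ^ n * Crising (s + 1) n * Crising (s + 1 / 2) n * cauchyI s mu.
Proof.
  intros Hs. induction n.
  - simpl. replace (s + 0) with s by ring. ring.
  - assert (K := cauchyI_rec (s + INR n) mu). replace (s + INR (S n)) with (s + INR n + 1) by (rewrite INR_C_S; ring).
    cbn [Crising]. rewrite Cpow_S.
    transitivity (Crising (s + 1 + mu) n * Crising (s + 1 - mu) n *
      ((s + INR n + 1 + mu) * (s + INR n + 1 - mu) * cauchyI (s + INR n + 1) mu)); [ring|].
    rewrite K by (assert (Q := pos_INR n); unfold Re in *; simpl; lra).
    transitivity ((s + INR n + 1) * (2 * (s + INR n) + 1) *
       (Crising (s + 1 + mu) n * Crising (s + 1 - mu) n * cauchyI (s + INR n) mu)); [ring|].
    rewrite IHn. field.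
Qed.

Lemma INR_Re_half (n : nat) : (- (1 / 2) < Re (INR n))%R.
Proof. simpl. assert (Q := pos_INR n). lra. Qed.

Lemma ccos_0 (t : R) : ccos 0 t = 1.
Proof.
  unfold ccos, Ccos. rewrite Cmult_0_l, Cmult_0_r. replace (- RtoC 0) with (RtoC 0) by ring.
  rewrite Cexp_0. field.
Qed.

Lemma cauchyI_0_0 : cauchyI 0 0 = PI.
Proof.
  apply imp_int_CInt_0_PI. apply (imp_int_ext (fun _ => 1)).
  - intros t Ht. rewrite ccos_0. unfold ucos. rewrite Cmult_0_l, Cexp_0. ring.
  - exists (fun t => RtoC t). split.
    + intros t Ht. split; simpl.
      * assert (Z := is_RInt_const_R 0 t 1). now rewrite Rmult_1_l, Rminus_0_r in Z.
      * assert (Z := is_RInt_const_R 0 t 0). now rewrite Rmult_0_l in Z.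
    + apply tends_RtoC; [apply _|]. intros Q HQ. unfold filtermap, at_left, within.
      revert HQ. apply filter_imp. easy.
Qed.

Lemma Crising_half_neq_0 (n : nat) : Crising (1 / 2) n <> 0.
Proof.
  induction n; [apply C1_nz|]. cbn [Crising]. apply Cmult_neq_0; [easy|].
  replace (1 / 2 + INR n) with (RtoC (1 / 2 + INR n)) by (rewrite RtoC_plus, RtoC_div; [easy|lra]).
  apply RtoC_neq_0. assert (Q := pos_INR n). lra.
Qed.

(** These Wallis integrals have known values and serve as the yardstick for the growth of
    [cauchyI (s + INR n) mu]. *)
Lemma cauchyI_nat (n : nat) : INR (fact n) * cauchyI (INR n) 0 = PI * 2 ^ n * Crising (1 / 2) n.
Proof.
  assert (K := cauchyI_rec_n 0 0 n). rewrite cauchyI_0_0 in K.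
  replace (0 + 1 + 0) with (RtoC 1) in K by ring. replace (0 + 1 - 0) with (RtoC 1) in K by ring.
  replace (0 + 1) with (RtoC 1) in K by ring. replace (0 + 1 / 2) with (1 / 2) in K by field.
  replace (0 + INR n) with (RtoC (INR n)) in K by ring.
  rewrite Crising_1 in K. specialize (K (INR_Re_half 0)).
  replace (INR (fact n) * cauchyI (INR n) 0)
    with (/ INR (fact n) * (INR (fact n) * INR (fact n) * cauchyI (INR n) 0)) by (field; apply fact_C_neq_0).
  rewrite K. field. apply fact_C_neq_0.
Qed.

Lemma cauchyI_nat_neq_0 (n : nat) : cauchyI (INR n) 0 <> 0.
Proof.
  intros E. assert (K := cauchyI_nat n). rewrite E, Cmult_0_r in K. symmetry in K. revert K.
  apply Cmult_neq_0; [|apply Crising_half_neq_0]. apply Cmult_neq_0.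
  - apply RtoC_neq_0, Rgt_not_eq, PI_RGT_0.
  - apply Cpow_nz, RtoC_neq_0. lra.
Qed.

(** The left side is the integral of [(1 + cos t)^n (1 - cos t)], because
    [1 - cos t = 2 - (1 + cos t)]. *)
Lemma cauchyI_nat_rec (n : nat) :
  2 * cauchyI (INR n) 0 - cauchyI (INR (S n)) 0 = cauchyI (INR n) 0 / (INR n + 1).
Proof.
  assert (K := cauchyI_rec (INR n) 0 (INR_Re_half n)). rewrite <- INR_C_S in *.
  assert (H : RtoC (INR (S n)) <> 0) by (apply INR_C_neq_0; lia).
  replace (INR (S n) + 0) with (RtoC (INR (S n))) in K by ring.
  replace (INR (S n) - 0) with (RtoC (INR (S n))) in K by ring.
  replace (cauchyI (INR (S n)) 0) with (/ INR (S n) * / INR (S n) * (INR (S n) * INR (S n) * cauchyI (INR (S n)) 0))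
    at 1 by (field; easy).
  rewrite K. rewrite INR_C_S in *. field. easy.
Qed.

(** With [x = t / 2 <= 2] the cubic Taylor bound gives [sin x >= x / 3], and [t^2 = 4 x^2 <= 36
    sin^2 x = 18 (1 - cos t)]. *)
Lemma t_sq_le (t : R) : (0 <= t <= PI)%R -> (t ^ 2 <= 18 * (1 - cos t))%R.
Proof.
  intros Ht. assert (P4 := PI_4).
  assert (B := proj1 (sin_bound (t / 2) 0 ltac:(lra) ltac:(lra))).
  unfold sin_approx, sin_term in B. simpl in B.
  set (x := (t / 2)%R) in *. assert (Hx : (0 <= x <= 2)%R) by (unfold x; lra).
  replace t with (2 * x)%R by (unfold x; field). rewrite cos_2a_sin.
  assert (B2 : (x / 3 <= sin x)%R).
  { apply Rle_trans with (x - x ^ 3 / 6)%R; [|eapply Rle_trans; [|exact B]; right; field].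
    assert (x * x <= 4)%R by nra. assert (0 <= x * (4 - x * x))%R by (apply Rmult_le_pos; lra). lra. }
  nra.
Qed.

(** The mean value inequality for [u^s] on [[1 + cos t, 2]]; as [Re s >= 1], the modulus of the
    derivative is largest at [u = 2]. *)
Lemma ucos_lipschitz (s : C) (t : R) : (1 <= Re s)%R -> (- PI < t < PI)%R ->
  (Cmod (ucos s t - Cexp (s * ln 2)) <= Cmod s * exp ((Re s - 1) * ln 2) * (1 - cos t))%R.
Proof.
  intros Hs Ht. assert (H := one_plus_cos_pos t Ht). assert (H2 := one_plus_cos_le t).
  set (M := (Cmod s * exp ((Re s - 1) * ln 2))%R).
  rewrite Cmod_minus_sym. unfold ucos.
  replace (M * (1 - cos t))%R with (M * 2 - M * (1 + cos t))%R by ring.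
  apply (Cderiv_increment_le (fun u => Cexp (s * ln u)) (fun u => s / u * Cexp (s * ln u))
     (fun u => M * u)%R (fun u => M)); [easy| | |].
  - intros u Hu. eapply Cderiv_eq; [|apply Cderiv_Cexp, Cderiv_mult; [apply Cderiv_const|apply Cderiv_RtoC, is_derive_ln; lra]].
    cbv beta. rewrite RtoC_inv by lra. unfold Cdiv. ring.
  - intros u Hu. auto_derive; [easy|ring].
  - intros u Hu. unfold Cdiv. rewrite !Cmod_mult, Cmod_inv, Cmod_R, Rabs_pos_eq, Cmod_Cexp by (try apply RtoC_neq_0; lra).
    unfold M. rewrite Rmult_assoc. apply Rmult_le_compat_l; [apply Cmod_ge_0|].
    replace (/ u)%R with (exp (- ln u)) by (rewrite exp_Ropp, exp_ln; lra).
    rewrite <- exp_plus. apply exp_mono.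
    replace (Re (s * ln u)) with (Re s * ln u)%R by (unfold Re; simpl; ring).
    replace (- ln u + Re s * ln u)%R with ((Re s - 1) * ln u)%R by ring.
    apply Rmult_le_compat_l; [lra|]. destruct (Rle_lt_or_eq_dec u 2 (proj2 Hu)) as [Q|Q].
    + left. apply ln_increasing; lra.
    + rewrite Q. apply Rle_refl.
Qed.

(** At [t = 0] the integrand equals [2^s]. Its deviation is of order [1 - cos t] because
    [cos (mu t) - 1] is of order [t^2], to which [t_sq_le] applies. *)
Lemma cauchy_at_0_lipschitz (s mu : C) : (1 <= Re s)%R ->
  exists K, (0 <= K)%R /\ forall t, (0 < t < PI)%R ->
  (Cmod (ucos s t * ccos mu t - Cexp (s * ln 2)) <= K * (1 - cos t))%R.
Proof.
  intros Hs. set (E := exp (Cmod mu * PI)). assert (HE : (0 < E)%R) by apply exp_pos.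
  set (A := (Cmod s * exp ((Re s - 1) * ln 2))%R).
  assert (HA : (0 <= A)%R) by (apply Rmult_le_pos; [apply Cmod_ge_0|left; apply exp_pos]).
  set (B := Cmod (Cexp (s * ln 2))). assert (HB : (0 <= B)%R) by apply Cmod_ge_0.
  assert (HM := Cmod_ge_0 mu).
  exists (A * E + B * (Cmod mu ^ 2 * 18 * E))%R. split.
  { apply Rplus_le_le_0_compat; repeat first [lra | apply pow2_ge_0 | apply Rmult_le_pos]. }
  intros t Ht. assert (Hc : (0 <= 1 - cos t)%R) by (assert (Q := COS_bound t); lra).
  replace (ucos s t * ccos mu t - Cexp (s * ln 2))
    with ((ucos s t - Cexp (s * ln 2)) * ccos mu t + Cexp (s * ln 2) * (ccos mu t - 1)) by ring.
  eapply Rle_trans; [apply Cmod_triangle|]. rewrite !Cmod_mult. rewrite Rmult_plus_distr_r.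
  assert (L := exp_mu_t_le mu t ltac:(lra)). fold E in L.
  apply Rplus_le_compat.
  - replace (A * E * (1 - cos t))%R with (A * (1 - cos t) * E)%R by ring.
    apply Rmult_le_compat; try apply Cmod_ge_0.
    + apply ucos_lipschitz; [easy|lra].
    + eapply Rle_trans; [apply Cmod_ccos_le|easy].
  - fold B. rewrite Rmult_assoc. apply Rmult_le_compat_l; [easy|].
    eapply Rle_trans; [apply ccos_minus_1_le|].
    replace (Cmod mu ^ 2 * 18 * E * (1 - cos t))%R with (Cmod mu ^ 2 * (18 * (1 - cos t)) * E)%R by ring.
    apply Rmult_le_compat; [apply pow2_ge_0|left; apply exp_pos| |exact L].
    rewrite Rpow_mult_distr, Rabs_pos_eq by lra. apply Rmult_le_compat_l; [apply pow2_ge_0|].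
    apply t_sq_le. lra.
Qed.

(* The weights [(1 + cos t)^n] concentrate at [t = 0]: their integral against
   [1 - cos t] is smaller than their mass by the factor [n + 1]. *)
Lemma cauchyI_asymptotic_1 (s mu : C) : (1 <= Re s)%R ->
  tends eventually (fun n => cauchyI (s + INR n) mu / cauchyI (INR n) 0) (Cexp (s * ln 2)).
Proof.
  intros Hs. destruct (cauchy_at_0_lipschitz s mu Hs) as [K [HK0 HK]].
  apply tends_squeeze with (g := fun n => (K * / (INR n + 1))%R); [apply _| |].
  - apply filter_forall. intros n. assert (Hn := pos_INR n).
    assert (Hw := cauchyI_nat_neq_0 n). assert (Hw' := proj1 (Cmod_gt_0 _) Hw).
    replace (cauchyI (s + INR n) mu / cauchyI (INR n) 0 - Cexp (s * ln 2))
      with ((cauchyI (s + INR n) mu + - Cexp (s * ln 2) * cauchyI (INR n) 0) * / cauchyI (INR n) 0) by (field; easy).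
    rewrite Cmod_mult, Cmod_inv by easy.
    apply Rmult_le_reg_r with (Cmod (cauchyI (INR n) 0)); [easy|].
    rewrite Rmult_assoc, Rinv_l, Rmult_1_r by lra.
    assert (H1 : (- (1 / 2) < Re (s + INR n))%R) by (unfold Re in *; simpl; lra).
    assert (I1 := imp_int_plus _ _ _ _ (cauchyI_correct (s + INR n) mu H1)
       (imp_int_scal _ (- Cexp (s * ln 2)) _ (cauchyI_correct (INR n) 0 (INR_Re_half n)))).
    (* The dominating function [K (1 + cos t)^n (1 - cos t)] is written with the powers [n] and
       [n + 1], so that [cauchyI_nat_rec] evaluates its integral. *)
    assert (I2 := imp_int_scal _ K _ (imp_int_plus _ _ _ _
       (imp_int_scal _ 2 _ (cauchyI_correct (INR n) 0 (INR_Re_half n)))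
       (imp_int_scal _ (- (1)) _ (cauchyI_correct (INR (S n)) 0 (INR_Re_half (S n)))))).
    apply (imp_int_ext _ (fun t => RtoC (K * ((1 + cos t) ^ n * (1 - cos t)))%R)) in I2.
    2:{ intros t Ht. rewrite !ccos_0, !ucos_INR by lra. rewrite <- !RtoC_opp, <- !RtoC_mult, <- !RtoC_plus, <- !RtoC_mult.
        f_equal. simpl. ring. }
    eapply Rle_trans; [refine (imp_int_norm_le _ _ _ _ _ I1 I2)|].
    + intros t Ht. rewrite ccos_0, ucos_plus, ucos_INR by lra.
      replace (ucos s t * ((1 + cos t) ^ n)%R * ccos mu t + - Cexp (s * ln 2) * (((1 + cos t) ^ n)%R * 1))
        with (((1 + cos t) ^ n)%R * (ucos s t * ccos mu t - Cexp (s * ln 2))) by ring.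
      assert (P : (0 <= (1 + cos t) ^ n)%R) by (apply pow_le; assert (Q := COS_bound t); lra).
      rewrite Cmod_mult, Cmod_R, Rabs_pos_eq by easy.
      replace (K * ((1 + cos t) ^ n * (1 - cos t)))%R with ((1 + cos t) ^ n * (K * (1 - cos t)))%R by ring.
      apply Rmult_le_compat_l; [easy|now apply HK].
    + eapply Rle_trans; [apply Rle_abs|]. eapply Rle_trans; [apply re_le_Cmod|].
      replace (2 * cauchyI (INR n) 0 + - (1) * cauchyI (INR (S n)) 0)
        with (2 * cauchyI (INR n) 0 - cauchyI (INR (S n)) 0) by ring.
      rewrite cauchyI_nat_rec. unfold Cdiv. rewrite <- INR_C_S.
      rewrite !Cmod_mult, Cmod_inv by (apply INR_C_neq_0; lia).
      rewrite !Cmod_R, S_INR, !Rabs_pos_eq by lra. right. ring.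
  - replace 0%R with (K * 0)%R by ring.
    change (is_lim_seq (fun n => (K * / (INR n + 1))%R) (Rbar_mult K 0)).
    apply is_lim_seq_scal_l.
    apply (is_lim_seq_ext (fun n => / INR (S n))%R); [intros; now rewrite S_INR|].
    apply (is_lim_seq_incr_1 (fun n => / INR n)%R). apply is_lim_seq_inv_INR.
Qed.

(** Exponents with [Re s < 1] are reached by shifting the index by [2]: the limits for [s + 2] and
    for [2], both covered by the preceding lemma, are divided. *)
Lemma cauchyI_asymptotic (s mu : C) : (- (1 / 2) < Re s)%R ->
  tends eventually (fun n => cauchyI (s + INR n) mu / cauchyI (INR n) 0) (Cexp (s * ln 2)).
Proof.
  intros Hs. apply tends_eventually_S, tends_eventually_S.
  assert (A := cauchyI_asymptotic_1 (s + 2) mu ltac:(unfold Re in *; simpl; lra)).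
  assert (B := cauchyI_asymptotic_1 2 0 ltac:(simpl; lra)).
  assert (D := tends_div _ _ _ _ _ (Cexp_neq_0 _) A B).
  eapply tends_ext; [apply _| |eapply tends_eq; [|exact D]].
  - apply filter_forall. intros n. cbv beta.
    replace (s + INR (S (S n))) with (s + 2 + INR n) by (rewrite !INR_C_S; ring).
    replace (2 + INR n) with (RtoC (INR (S (S n)))) by (rewrite !INR_C_S; ring).
    field. split; apply cauchyI_nat_neq_0.
  - rewrite <- Cexp_minus. f_equal. ring.
Qed.

Lemma Crising_gauss (z : C) (n : nat) : Crising z (S n) = gauss z n * (INR (fact n) * Cpower (INR n) z).
Proof. unfold gauss. field. auto using fact_C_neq_0, Cpower_neq_0. Qed.

(** This is [n + 1] steps of the recurrence, divided by the same steps for [s = mu = 0] and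
    rewritten with [gauss], so that every factor has a limit. *)
Lemma cauchyI_gauss (s mu : C) (n : nat) : (- (1 / 2) < Re s)%R -> (0 < n)%nat ->
  gauss (s + 1) n * gauss (s + 1 / 2) n * gauss 1 n * cauchyI s mu =
  PI * gauss (s + 1 + mu) n * gauss (s + 1 - mu) n * gauss (1 / 2) n *
    (cauchyI (s + INR (S n)) mu / cauchyI (INR (S n)) 0).
Proof.
  intros Hs Hn. assert (K := cauchyI_rec_n s mu (S n) Hs). assert (W := cauchyI_nat (S n)).
  assert (Hw := cauchyI_nat_neq_0 (S n)).
  assert (P2 : (2 : C) ^ S n <> 0) by (apply Cpow_nz, RtoC_neq_0; lra).
  rewrite <- (Crising_1 (S n)) in W. rewrite (Crising_gauss (s + 1 + mu)), (Crising_gauss (s + 1 - mu)), (Crising_gauss (s + 1)),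
    (Crising_gauss (s + 1 / 2)) in K. rewrite (Crising_gauss 1), (Crising_gauss (1 / 2)) in W.
  set (I := cauchyI (s + INR (S n)) mu) in *. set (V := cauchyI (INR (S n)) 0) in *. set (J := cauchyI s mu) in *.
  assert (HI : (0 < INR n)%R) by now apply lt_0_INR.
  assert (CP : forall a, Cpower (INR n) a = Cexp (a * ln (INR n))) by (intros; now apply Cpower_pos).
  rewrite (CP (s + 1 + mu)), (CP (s + 1 - mu)), (CP (s + 1)), (CP (s + 1 / 2)) in K.
  rewrite (CP 1), (CP (1 / 2)) in W. clear CP.
  replace (s + 1 + mu) with (s + (1 + mu)) in * by ring.
  replace (s + 1 - mu) with (s + (1 - mu)) in * by ring.
  set (L := RtoC (ln (INR n))) in *.
  (* The exponents of [n] add up to [2 s + 5 / 2] on both sides, as [(s + 1) + (s + 1 / 2) + 1] and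
     as [(s + 1 + mu) + (s + 1 - mu) + 1 / 2]. Hence the powers in Gauss's formula cancel. *)
  set (E := Cexp ((2 * s + 5 / 2) * L)). set (f := RtoC (INR (fact n))) in *.
  assert (Hf : f <> 0) by apply fact_C_neq_0. assert (HE : E <> 0) by apply Cexp_neq_0.
  assert (E1 : Cexp ((s + 1) * L) * Cexp ((s + 1 / 2) * L) * Cexp (1 * L) = E).
  { unfold E. rewrite <- !Cexp_plus. f_equal. field. }
  assert (E2 : Cexp ((s + (1 + mu)) * L) * Cexp ((s + (1 - mu)) * L) * Cexp (1 / 2 * L) = E).
  { unfold E. rewrite <- !Cexp_plus. f_equal. field. }
  set (X := gauss (s + 1) n * gauss (s + 1 / 2) n * gauss 1 n * J).
  set (Y := PI * gauss (s + (1 + mu)) n * gauss (s + (1 - mu)) n * gauss (1 / 2) n).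
  assert (Z : (f * f * f * 2 ^ S n * V) * (E * X) = (f * f * f * 2 ^ S n * V) * (E * (Y * (I / V)))).
  { transitivity (f * V * Cexp (1 * L) * gauss 1 n *
      (2 ^ S n * (gauss (s + 1) n * (f * Cexp ((s + 1) * L))) * (gauss (s + 1 / 2) n * (f * Cexp ((s + 1 / 2) * L))) * J)).
    { unfold X. rewrite <- E1. ring. }
    rewrite <- K.
    transitivity (gauss (s + (1 + mu)) n * Cexp ((s + (1 + mu)) * L) * gauss (s + (1 - mu)) n * Cexp ((s + (1 - mu)) * L) * f * f * I
       * (gauss 1 n * (f * Cexp (1 * L)) * V)); [ring|].
    rewrite W. unfold Y. rewrite <- E2. field. easy. }
  replace X with (/ (f * f * f * 2 ^ S n * V) * / E * ((f * f * f * 2 ^ S n * V) * (E * X))) by (field; auto).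
  rewrite Z. field. auto.
Qed.

Lemma cauchyI_formula (s mu : C) : (- (1 / 2) < Re s)%R ->
  rGamma (s + 1) * rGamma (s + 1 / 2) * cauchyI s mu =
  PI * rGamma (s + 1 + mu) * rGamma (s + 1 - mu) * rGamma (1 / 2) * Cexp (s * ln 2).
Proof.
  intros Hs.
  transitivity (rGamma (s + 1) * rGamma (s + 1 / 2) * rGamma 1 * cauchyI s mu); [rewrite rGamma_1; ring|].
  apply (tends_unique (FF := eventually_filter) eventually
    (fun n => gauss (s + 1) n * gauss (s + 1 / 2) n * gauss 1 n * cauchyI s mu)).
  - repeat (apply tends_mult; [apply _| |]); try apply rGamma_tends. apply tends_const, _.
  - eapply tends_ext; [apply _|exists 1%nat; intros n Hn; symmetry; now apply cauchyI_gauss|].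
    apply tends_mult; [apply _| |].
    { repeat (apply tends_mult; [apply _| |]); try apply rGamma_tends. apply tends_const, _. }
    apply (tends_comp eventually eventually S (fun n => cauchyI (s + INR n) mu * / cauchyI (INR n) 0)).
    + apply filterlim_eventually_ge. lia.
    + now apply cauchyI_asymptotic.
Qed.

(** * The value of [1 / Gamma] at [1 / 2] *)

Lemma cauchyI_half : cauchyI (1 / 2) 0 = 2 * exp (1 / 2 * ln 2).
Proof.
  apply imp_int_CInt_0_PI. set (e := exp (1 / 2 * ln 2)).
  assert (P := PI_RGT_0).
  apply (imp_int_ext (fun t => RtoC (e * cos (t / 2)))).
  - intros t Ht. rewrite ccos_0. unfold ucos, e.
    assert (H : (0 < cos (t / 2))%R) by (apply cos_gt_0; lra).
    replace (1 + cos t)%R with (2 * (cos (t / 2) * cos (t / 2)))%R.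
    2:{ replace t with (2 * (t / 2))%R at 3 by field. rewrite cos_2a_cos. ring. }
    rewrite !ln_mult by nra.
    replace (1 / 2 * RtoC (ln 2 + (ln (cos (t / 2)) + ln (cos (t / 2))))%R)
      with (RtoC (1 / 2 * ln 2 + ln (cos (t / 2)))).
    + rewrite Cexp_RtoC, exp_plus, exp_ln by easy. ring.
    + rewrite !RtoC_plus, RtoC_mult, RtoC_div by lra. field.
  - exists (fun t => RtoC (e * (2 * sin (t / 2)))). split.
    + intros t Ht.
      replace (RtoC (e * (2 * sin (t / 2)))) with (RtoC (e * (2 * sin (t / 2))) - RtoC (e * (2 * sin (0 / 2)))).
      2:{ replace (0 / 2)%R with 0%R by field. rewrite sin_0, !Rmult_0_r. ring. }
      apply (is_CInt_derive (fun t => RtoC (e * (2 * sin (t / 2))))); [lra| |].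
      * intros x Hx. apply Cderiv_RtoC. auto_derive; [easy|]. unfold Rdiv. field.
      * intros x Hx. apply tends_RtoC; [apply _|]. apply (ex_derive_continuous (fun x => e * cos (x / 2))%R).
        auto_derive. easy.
    + replace (2 * e) with (RtoC (e * (2 * sin (PI / 2)))).
      2:{ rewrite sin_PI2, !RtoC_mult. ring. }
      apply tends_RtoC; [apply _|]. eapply filterlim_filter_le_1.
      2:{ apply (ex_derive_continuous (fun x => e * (2 * sin (x / 2)))%R). auto_derive. easy. }
      apply filter_le_within.
Qed.

(** Cauchy's formula at [s = 1 / 2] and [mu = 0], where the integral is elementary, leaves an
    equation in [rGamma (1 / 2)] alone. *)
Lemma rGamma_half_sq : PI * (rGamma (1 / 2) * rGamma (1 / 2)) = 1.
Proof.
  assert (Hh : RtoC (1 / 2) = 1 / 2) by (rewrite RtoC_div; [easy|lra]).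
  assert (K := cauchyI_formula (1 / 2) 0). rewrite cauchyI_half in K.
  replace (1 / 2 + 1 + 0) with (1 / 2 + 1) in K by ring.
  replace (1 / 2 + 1 - 0) with (1 / 2 + 1) in K by ring.
  replace (1 / 2 + 1 / 2) with (RtoC 1) in K by field.
  rewrite rGamma_1 in K. rewrite (rGamma_rec (1 / 2)) in K |- *.
  set (g := rGamma (1 / 2 + 1)) in *.
  assert (Hg : g <> 0).
  { apply rGamma_neq_0_Re. rewrite <- Hh. simpl. lra. }
  replace (Cexp (1 / 2 * ln 2)) with (RtoC (exp (1 / 2 * ln 2))) in K.
  2:{ rewrite <- Cexp_RtoC. f_equal. rewrite RtoC_mult, Hh. reflexivity. }
  set (e := RtoC (exp (1 / 2 * ln 2))) in *.
  assert (He : e <> 0) by (apply RtoC_neq_0, Rgt_not_eq, exp_pos).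
  assert (K2 : g * 1 * (2 * e) = PI * g * g * (1 / 2 * g) * e).
  { apply K. rewrite <- Hh. simpl. lra. }
  transitivity (/ (g * 2 * e) * (PI * g * g * (1 / 2 * g) * e)).
  - field. auto.
  - rewrite <- K2. field. auto.
Qed.

Lemma gauss_half_Cmod (n : nat) : gauss (1 / 2) (S n) = Cmod (gauss (1 / 2) (S n)).
Proof.
  assert (Hh : RtoC (1 / 2) = 1 / 2) by (rewrite RtoC_div; [easy|lra]).
  assert (A : forall m, Crising (1 / 2) m = Cmod (Crising (1 / 2) m)).
  { induction m; [cbn [Crising]; now rewrite Cmod_1|]. cbn [Crising].
    assert (Q := pos_INR m). rewrite Cmod_mult, RtoC_mult, <- IHm, <- Hh, <- RtoC_plus, Cmod_R, Rabs_pos_eq by lra.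
    reflexivity. }
  unfold gauss. rewrite (A (S (S n))). set (X := Cmod (Crising (1 / 2) (S (S n)))).
  assert (HX : (0 <= X)%R) by apply Cmod_ge_0.
  rewrite Cpower_pos by (apply lt_0_INR; lia). rewrite <- Hh, <- RtoC_mult, Cexp_RtoC, <- RtoC_mult.
  set (d := (INR (fact (S n)) * exp (1 / 2 * ln (INR (S n))))%R).
  assert (D : (0 < d)%R) by (apply Rmult_lt_0_compat; [apply INR_fact_lt_0|apply exp_pos]).
  assert (Q : (0 <= X / d)%R) by (apply Rmult_le_pos; [easy|left; now apply Rinv_0_lt_compat]).
  rewrite <- RtoC_div, Cmod_R, Rabs_pos_eq by lra.
  reflexivity.
Qed.

(** The square is known; the sign is settled by Gauss's approximants, which are nonnegative reals by
    [gauss_half_Cmod]. *)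
Lemma rGamma_half : rGamma (1 / 2) = / sqrt PI.
Proof.
  assert (P := PI_RGT_0). assert (SP := sqrt_lt_R0 _ P).
  assert (T := tends_eventually_shift _ _ 1 (rGamma_tends (1 / 2))).
  assert (E : rGamma (1 / 2) = Cmod (rGamma (1 / 2))).
  { apply (tends_unique (FF := eventually_filter) _ _ _ _ T).
    intros eps He. generalize (T eps He). apply filter_imp. intros n Hn.
    rewrite Nat.add_1_r in *. rewrite gauss_half_Cmod, <- RtoC_minus, Cmod_R.
    eapply Rle_lt_trans; [|exact Hn]. apply Rabs_le. split.
    - rewrite Cmod_minus_sym. assert (Q := Cmod_triangle_rev (rGamma (1 / 2)) (gauss (1 / 2) (S n))). lra.
    - apply Cmod_triangle_rev. }
  assert (K := rGamma_half_sq). assert (Hx := Cmod_ge_0 (rGamma (1 / 2))). rewrite E in K |- *.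
  set (x := Cmod (rGamma (1 / 2))) in *.
  rewrite <- !RtoC_mult in K. apply RtoC_inj in K.
  rewrite <- RtoC_inv by lra. f_equal.
  apply Rmult_eq_reg_r with (sqrt PI); [|lra]. rewrite Rinv_l by lra.
  assert (Q := sqrt_sqrt PI ltac:(lra)).
  assert (N : (0 <= x * sqrt PI)%R) by (apply Rmult_le_pos; lra).
  assert (N2 : ((x * sqrt PI) * (x * sqrt PI) = 1)%R).
  { replace ((x * sqrt PI) * (x * sqrt PI))%R with ((sqrt PI * sqrt PI) * (x * x))%R by ring. now rewrite Q. }
  nra.
Qed.

(** * Uniform limits and integration of series *)

Lemma tends_uniform {T} (F : (T -> Prop) -> Prop) {FF : Filter F} (f : T -> C) (g : nat -> T -> C)
    (l : C) (m : nat -> C) (e : nat -> R) :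
  (forall k, tends F (g k) (m k)) -> (forall k, F (fun x => (Cmod (f x - g k x) <= e k)%R)) ->
  (forall k, (Cmod (l - m k) <= e k)%R) -> is_lim_seq e 0 -> tends F f l.
Proof.
  intros Hg Hf Hl He eps Heps.
  apply is_lim_seq_spec in He. assert (H3 : (0 < eps / 3)%R) by lra.
  destruct (He (mkposreal _ H3)) as [N HN]. specialize (HN N (le_n _)). simpl in HN.
  rewrite Rminus_0_r in HN. apply Rabs_lt_between in HN.
  generalize (filter_and _ _ (Hg N _ H3) (Hf N)). apply filter_imp. intros x [H1 H2].
  specialize (Hl N).
  assert (T1 := Cmod_triangle3 (f x) (g N x) l). assert (T2 := Cmod_triangle3 (g N x) (m N) l).
  rewrite (Cmod_minus_sym (m N) l) in T2. lra.
Qed.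

Lemma series_tail_le (a : nat -> C) (l : C) (b : nat -> R) (n : nat) :
  is_series a l -> (forall k, (Cmod (a k) <= b k)%R) -> ex_series b ->
  (Cmod (l - sum_n a n) <= Series b - sum_n b n)%R.
Proof.
  intros Hl Hab Hb. apply is_series_tends in Hl.
  assert (Hb0 : forall k, (0 <= b k)%R) by (intros k; eapply Rle_trans; [apply Cmod_ge_0|apply Hab]).
  apply (tends_le (FF := eventually_filter) _ _ _ _ _ Hl).
  exists n. intros p Hp. apply Rle_trans with (sum_n b p - sum_n b n)%R.
  - induction Hp.
    + assert (Z : sum_n a n - sum_n a n = 0) by (set (x := sum_n a n : C); change (x - x = 0); ring).
      rewrite Z, Cmod_0. lra.
    + rewrite sum_n_S_C, sum_n_S_R.
      replace (sum_n a m + a (S m) - sum_n a n) with ((sum_n a m - sum_n a n) + a (S m))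
        by (generalize (sum_n a m : C) (sum_n a n : C); intros; ring).
      eapply Rle_trans; [apply Cmod_triangle|]. specialize (Hab (S m)). lra.
  - assert (Q := sum_n_le_series b p Hb0 Hb). lra.
Qed.

Lemma series_tail_lim (b : nat -> R) : ex_series b -> is_lim_seq (fun n => Series b - sum_n b n)%R 0.
Proof.
  intros H. replace 0%R with (Series b - Series b)%R by ring.
  apply is_lim_seq_minus'; [apply is_lim_seq_const|]. exact (Series_correct _ H).
Qed.

Lemma ex_series_exp (x : R) : ex_series (fun k => x ^ k / INR (fact k))%R.
Proof.
  exists (exp x). replace (exp x) with (Re (Cexp x)) by (rewrite Cexp_RtoC; reflexivity).
  eapply is_series_ext; [|apply is_series_Re, Cexp_series].
  intros n. cbv beta. rewrite <- RtoC_pow, <- RtoC_div by apply INR_fact_neq_0. reflexivity.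
Qed.

Lemma imp_int_sum_n (f : nat -> R -> C) (l : nat -> C) (n : nat) :
  (forall k, imp_int (f k) (l k)) -> imp_int (fun t => sum_n (fun k => f k t) n) (sum_n l n).
Proof.
  intros H. induction n.
  - rewrite sum_n_0_C. apply (imp_int_ext (f 0%nat)); [|apply H]. intros; now rewrite sum_n_0_C.
  - rewrite sum_n_S_C. apply (imp_int_ext (fun t => sum_n (fun k => f k t) n + f (S n) t)).
    + intros; now rewrite sum_n_S_C.
    + now apply imp_int_plus.
Qed.

(** A form of dominated convergence: the errors are small relative to an integrable [g], which
    controls the part near [PI], where [f] may be unbounded. *)
Lemma imp_int_uniform (f : R -> C) (fk : nat -> R -> C) (lk : nat -> C) (L G : C) (g : R -> R) (e : nat -> R) :
  (forall t, (0 <= t < PI)%R -> tends (locally t) f (f t)) ->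
  (forall k, imp_int (fk k) (lk k)) -> tends eventually lk L ->
  (forall t, (0 < t < PI)%R -> (0 <= g t)%R) -> imp_int (fun t => RtoC (g t)) G ->
  (forall k, (0 <= e k)%R) -> is_lim_seq e 0 ->
  (forall k t, (0 < t < PI)%R -> (Cmod (f t - fk k t) <= e k * g t)%R) -> imp_int f L.
Proof.
  intros Hf Hfk HL Hg [I [HI1 HI2]] He0 He Hle.
  set (F := fun t => (RInt (fun t => Re (f t)) 0 t, RInt (fun t => Im (f t)) 0 t) : C).
  assert (HF : forall t, (0 <= t < PI)%R -> is_CInt f 0 t (F t)).
  { intros t Ht. apply is_CInt_ex; [lra|]. intros x Hx. apply Hf. lra. }
  exists F. split; [exact HF|]. intros eps Heps. assert (H3 : (0 < eps / 3)%R) by lra.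
  assert (HG := Cmod_ge_0 G). set (M := (Cmod G + 1)%R) in *.
  apply is_lim_seq_spec in He. assert (H4 : (0 < eps / 3 / M)%R) by (apply Rdiv_lt_0_compat; unfold M; lra).
  destruct (He (mkposreal _ H4)) as [N1 HN1]. destruct (HL _ H3) as [N2 HN2].
  set (n := max N1 N2). specialize (HN1 n ltac:(lia)). specialize (HN2 n ltac:(lia)). simpl in HN1.
  rewrite Rminus_0_r, Rabs_pos_eq in HN1 by apply He0.
  destruct (Hfk n) as [Fn [HFn1 HFn2]].
  generalize (filter_and _ _ (at_left_PI_interval 0 PI_RGT_0) (filter_and _ _ (HFn2 _ H3) (tends_bounded _ _ _ HI2))).
  apply filter_imp. intros t [Ht [T1 T2]].
  assert (D : (Cmod (F t - Fn t) <= e n * Re (I t))%R).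
  { assert (K := is_CInt_plus _ _ _ _ _ _ (HF t ltac:(lra)) (is_CInt_scal _ _ _ (- (1)) _ (HFn1 t ltac:(lra)))).
    replace (F t - Fn t) with (F t + - (1) * Fn t) by ring.
    refine (is_CInt_norm_le _ (fun t => e n * g t)%R 0 t _ _ _ _ K _); [lra| |].
    - intros x Hx. replace (f x + - (1) * fk n x) with (f x - fk n x) by ring. apply Hle. lra.
    - exact (is_RInt_scal _ _ _ _ _ (proj1 (HI1 t ltac:(lra)))). }
  assert (D2 : (e n * Re (I t) <= e n * M)%R).
  { apply Rmult_le_compat_l; [apply He0|]. assert (Q := Rle_trans _ _ _ (Rle_abs _) (re_le_Cmod (I t))). unfold M. lra. }
  assert (D3 : (e n * M < eps / 3)%R).
  { replace (eps / 3)%R with (eps / 3 / M * M)%R by (field; unfold M; lra). apply Rmult_lt_compat_r; unfold M in *; lra. }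
  assert (Q1 := Cmod_triangle3 (F t) (Fn t) L). assert (Q2 := Cmod_triangle3 (Fn t) (lk n) L). lra.
Qed.

(** Sums leave equations at the carrier of a canonical structure; restating them at [C] lets [ring]
    recognise the field. *)
Ltac Cring := match goal with |- ?x = ?y => change (@eq C x y) end; ring.

Lemma sum_n_scal_C (c : C) (a : nat -> C) (n : nat) : c * sum_n a n = sum_n (fun k => c * a k) n.
Proof.
  induction n; [now rewrite !sum_n_0_C|]. rewrite !sum_n_S_C, <- IHn. ring.
Qed.

Lemma sum_n_ext_C (a b : nat -> C) (n : nat) :
  (forall k, (k <= n)%nat -> a k = b k) -> sum_n a n = sum_n b n.
Proof. intros H. apply sum_n_ext_loc. exact H. Qed.


(** * Termwise integration of the incomplete gamma function *)

Definition gs_term (a w : C) (k : nat) : C := w ^ k * rGamma (a + INR k + 1).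

Lemma gs_term_bound (a : C) (R0 : R) :
  exists b : nat -> R, ex_series b /\ forall x, (Cmod x <= R0)%R -> forall k, (Cmod (gs_term a x k) <= b k)%R.
Proof.
  destruct (rGamma_shift_bound a) as [M [HM0 HM]].
  exists (fun k => M * ((2 * R0) ^ k / INR (fact k)))%R. split.
  - apply ex_series_scal_R, ex_series_exp.
  - intros x Hx k. unfold gs_term. rewrite Cmod_mult, Cmod_pow.
    assert (F := INR_fact_lt_0 k).
    replace (M * ((2 * R0) ^ k / INR (fact k)))%R with (R0 ^ k * (M * (2 ^ k / INR (fact k))))%R
      by (rewrite Rpow_mult_distr; field; lra).
    apply Rmult_le_compat; [apply pow_le, Cmod_ge_0|apply Cmod_ge_0| |apply HM].
    apply pow_incr. split; [apply Cmod_ge_0|easy].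
Qed.

Lemma gs_series (a w : C) : is_series (gs_term a w) (CSeries (gs_term a w)).
Proof.
  destruct (gs_term_bound a (Cmod w)) as [b [Hb Hb']].
  destruct (ex_series_C_le (gs_term a w) b (Hb' w (Rle_refl _)) Hb) as [l Hl].
  now rewrite (is_series_CSeries _ _ Hl).
Qed.

Lemma one_plus_cos_Cmod (w : C) (t : R) : (Cmod (w * (1 + cos t)%R) <= 2 * Cmod w)%R.
Proof.
  rewrite Cmod_mult, Cmod_R, Rabs_pos_eq by (assert (Q := COS_bound t); lra).
  rewrite Rmult_comm. apply Rmult_le_compat_r; [apply Cmod_ge_0|apply one_plus_cos_le].
Qed.

Lemma gs_cos_continuous (a w : C) (t : R) :
  tends (locally t) (fun x => CSeries (gs_term a (w * (1 + cos x)%R))) (CSeries (gs_term a (w * (1 + cos t)%R))).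
Proof.
  destruct (gs_term_bound a (2 * Cmod w)) as [b [Hb Hb']].
  assert (B : forall n x, (Cmod (CSeries (gs_term a (w * (1 + cos x)%R)) - sum_n (gs_term a (w * (1 + cos x)%R)) n)
       <= Series b - sum_n b n)%R).
  { intros n x. apply series_tail_le; [apply gs_series| |easy]. apply Hb', one_plus_cos_Cmod. }
  apply (tends_uniform (locally t) _ (fun n x => sum_n (gs_term a (w * (1 + cos x)%R)) n) _
     (fun n => sum_n (gs_term a (w * (1 + cos t)%R)) n) (fun n => Series b - sum_n b n)%R).
  - assert (D : tends (locally t) (fun x => w * (1 + cos x)%R) (w * (1 + cos t)%R)).
    { apply tends_mult; [apply _|apply tends_const, _|]. apply tends_RtoC; [apply _|].
      apply (ex_derive_continuous (fun x => 1 + cos x)%R). auto_derive. easy. }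
    assert (DP : forall k, tends (locally t) (fun x => (w * (1 + cos x)%R) ^ k) ((w * (1 + cos t)%R) ^ k)).
    { induction k; [exact (tends_const _ 1)|]. exact (tends_mult _ _ _ _ _ D IHk). }
    intros n. induction n.
    + rewrite sum_n_0_C.
      apply (tends_ext_all _ (fun x => gs_term a (w * (1 + cos x)%R) 0)); [intros x; now rewrite sum_n_0_C|].
      apply tends_mult; [apply _|apply DP|apply tends_const, _].
    + rewrite sum_n_S_C.
      apply (tends_ext_all _ (fun x => sum_n (gs_term a (w * (1 + cos x)%R)) n + gs_term a (w * (1 + cos x)%R) (S n)));
        [intros x; now rewrite sum_n_S_C|].
      apply tends_plus; [apply _|exact IHn|]. apply tends_mult; [apply _|apply DP|apply tends_const, _].
  - intros n. apply filter_forall. intros x. apply B.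
  - intros n. apply B.
  - now apply series_tail_lim.
Qed.

Lemma gs_int_term (a mu w : C) (k : nat) : (- (1 / 2) < Re a)%R ->
  imp_int (fun t => ucos a t * gs_term a (w * (1 + cos t)%R) k * ccos mu t)
    (w ^ k * rGamma (a + INR k + 1) * cauchyI (a + INR k) mu).
Proof.
  intros Ha. assert (Ha' : (- (1 / 2) < Re (a + INR k))%R).
  { assert (Q := pos_INR k). unfold Re in *; simpl; lra. }
  eapply imp_int_ext; [|apply imp_int_scal, (cauchyI_correct (a + INR k) mu Ha')].
  intros t Ht. unfold gs_term. rewrite ucos_plus, ucos_INR by lra. rewrite RtoC_pow, Cpow_mult_l. ring.
Qed.

(* The remainders of the series are dominated by multiples of [(1 + cos t)^(Re a)],
   which is integrable although it may be unbounded at [PI]. *)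
Lemma gs_int (a mu w : C) : (- (1 / 2) < Re a)%R -> exists L,
  is_series (fun k => w ^ k * rGamma (a + INR k + 1) * cauchyI (a + INR k) mu) L /\
  imp_int (fun t => ucos a t * CSeries (gs_term a (w * (1 + cos t)%R)) * ccos mu t) L.
Proof.
  intros Ha. assert (P := PI_RGT_0).
  destruct (gs_term_bound a (2 * Cmod w)) as [b [Hb Hb']].
  assert (Hb0 : forall k, (0 <= b k)%R).
  { intros k. eapply Rle_trans; [apply Cmod_ge_0|]. apply (Hb' 0). rewrite Cmod_0. assert (Q := Cmod_ge_0 w). lra. }
  set (E := exp (Cmod mu * PI)). assert (HE : (0 < E)%R) by apply exp_pos.
  set (g := fun t => (E * Cmod (ucos a t))%R).
  set (G := E * cauchyI (Re a) 0).
  assert (IG : imp_int (fun t => RtoC (g t)) G).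
  { eapply imp_int_ext; [|apply imp_int_scal, (cauchyI_correct (Re a) 0 Ha)]. intros t _. unfold g.
    rewrite RtoC_mult, ccos_0, Cmult_1_r, Cmod_ucos. unfold ucos. now rewrite <- RtoC_mult, Cexp_RtoC. }
  assert (Hdom : forall t x B, (0 < t < PI)%R -> (Cmod x <= B)%R -> (Cmod (ucos a t * x * ccos mu t) <= B * g t)%R).
  { intros t x B Ht HB. unfold g. rewrite !Cmod_mult.
    replace (B * (E * Cmod (ucos a t)))%R with (Cmod (ucos a t) * B * E)%R by ring.
    apply Rmult_le_compat; [apply Rmult_le_pos; apply Cmod_ge_0|apply Cmod_ge_0| |].
    - apply Rmult_le_compat_l; [apply Cmod_ge_0|easy].
    - eapply Rle_trans; [apply Cmod_ccos_le|]. apply exp_mu_t_le. lra. }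
  set (c := fun k => w ^ k * rGamma (a + INR k + 1) * cauchyI (a + INR k) mu).
  destruct (ex_series_C_le c (fun k => Re G * b k)%R) as [L HL].
  { intros k. replace (Re G * b k)%R with (Re (b k * G)) by (unfold Re; simpl; ring).
    refine (imp_int_norm_le _ (fun t => b k * g t)%R _ _ _ (gs_int_term a mu w k Ha) _).
    - intros t Ht. apply Hdom; [easy|]. apply Hb', one_plus_cos_Cmod.
    - eapply imp_int_ext; [|apply imp_int_scal, IG]. intros t _. now rewrite RtoC_mult. }
  { now apply ex_series_scal_R. }
  exists L. split; [exact HL|].
  refine (imp_int_uniform _ (fun n t => sum_n (fun k => ucos a t * gs_term a (w * (1 + cos t)%R) k * ccos mu t) n)
    (sum_n c) L G g (fun n => Series b - sum_n b n)%R _ _ _ _ IG _ (series_tail_lim b Hb) _).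
  - intros t Ht. apply tends_mult; [apply _| |eapply Cderiv_tends, Cderiv_ccos].
    apply tends_mult; [apply _| |apply gs_cos_continuous]. eapply Cderiv_tends, Cderiv_ucos. lra.
  - intros n. apply (imp_int_sum_n (fun k t => ucos a t * gs_term a (w * (1 + cos t)%R) k * ccos mu t)).
    intros k. now apply gs_int_term.
  - now apply is_series_tends.
  - intros t _. apply Rmult_le_pos; [lra|apply Cmod_ge_0].
  - intros n. assert (Q := sum_n_le_series b n Hb0 Hb). lra.
  - intros n t Ht.
    replace (sum_n (fun k => ucos a t * gs_term a (w * (1 + cos t)%R) k * ccos mu t) n)
      with (ucos a t * ccos mu t * sum_n (gs_term a (w * (1 + cos t)%R)) n)
      by (rewrite sum_n_scal_C; apply sum_n_ext_C; intros k _; ring).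
    match goal with |- (Cmod (?u * ?s * ?v - ?u * ?v * ?s') <= _)%R =>
      replace (u * s * v - u * v * s') with (u * (s - s') * v) by Cring end.
    apply Hdom; [easy|]. apply series_tail_le; [apply gs_series| |easy]. apply Hb', one_plus_cos_Cmod.
Qed.

(** * Cauchy products and Kummer's second formula *)

Definition conv (a b : nat -> C) (n : nat) : C := sum_n (fun k => a k * b (n - k)%nat) n.

Lemma is_series_conv (a b : nat -> C) (la lb : C) :
  is_series a la -> is_series b lb ->
  ex_series (fun k => Cmod (a k)) -> ex_series (fun k => Cmod (b k)) -> is_series (conv a b) (la * lb).
Proof.
  intros Ha Hb HA HB.
  assert (AR : forall u, ex_series (fun k => Cmod (u k)) -> ex_series (fun k => Rabs (Re (u k)))).
  { intros u Hu. apply (@ex_series_le R_AbsRing R_CompleteNormedModule) with (b := fun k => Cmod (u k)); [|easy].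
    intros n. change norm with Rabs. rewrite Rabs_Rabsolu. apply re_le_Cmod. }
  assert (AI : forall u, ex_series (fun k => Cmod (u k)) -> ex_series (fun k => Rabs (Im (u k)))).
  { intros u Hu. apply (@ex_series_le R_AbsRing R_CompleteNormedModule) with (b := fun k => Cmod (u k)); [|easy].
    intros n. change norm with Rabs. rewrite Rabs_Rabsolu. apply im_le_Cmod. }
  assert (M : forall u v lu lv, is_series u lu -> is_series v lv -> ex_series (fun k => Rabs (u k)) ->
     ex_series (fun k => Rabs (v k)) -> is_series (fun n => sum_n (fun k => u k * v (n - k)%nat)%R n) (lu * lv)%R).
  { intros u v lu lv Hu Hv Hau Hav. eapply is_series_ext; [|apply (is_series_mult u v lu lv Hu Hv Hau Hav)].
    intros n. symmetry. apply sum_n_Reals. }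
  assert (R1 := M _ _ _ _ (is_series_Re _ _ Ha) (is_series_Re _ _ Hb) (AR _ HA) (AR _ HB)).
  assert (R2 := M _ _ _ _ (is_series_Im _ _ Ha) (is_series_Im _ _ Hb) (AI _ HA) (AI _ HB)).
  assert (R3 := M _ _ _ _ (is_series_Re _ _ Ha) (is_series_Im _ _ Hb) (AR _ HA) (AI _ HB)).
  assert (R4 := M _ _ _ _ (is_series_Im _ _ Ha) (is_series_Re _ _ Hb) (AI _ HA) (AR _ HB)).
  assert (QR : forall m n, (sum_n (fun k => Re (a k) * Re (b (m - k)%nat)) n - sum_n (fun k => Im (a k) * Im (b (m - k)%nat)) n
      = sum_n (fun k => Re (a k * b (m - k)%nat)%C) n)%R).
  { intros m n. induction n; [now rewrite !sum_n_0_R|].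
    rewrite !sum_n_S_R, <- IHn. unfold Re, Im; simpl. ring. }
  assert (QI : forall m n, (sum_n (fun k => Re (a k) * Im (b (m - k)%nat)) n + sum_n (fun k => Im (a k) * Re (b (m - k)%nat)) n
      = sum_n (fun k => Im (a k * b (m - k)%nat)%C) n)%R).
  { intros m n. induction n; [now rewrite !sum_n_0_R|].
    rewrite !sum_n_S_R, <- IHn. unfold Re, Im; simpl. ring. }
  apply is_series_pair.
  - eapply is_series_ext; [|exact (is_series_minus _ _ _ _ R1 R2)].
    intros n. unfold conv. rewrite Re_sum_n. apply QR.
  - eapply is_series_ext; [|exact (is_series_plus _ _ _ _ R3 R4)].
    intros n. unfold conv. rewrite Im_sum_n. apply QI.
Qed.

Lemma sum_n_first_C (a : nat -> C) (n : nat) : sum_n a (S n) = a 0%nat + sum_n (fun k => a (S k)) n.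
Proof.
  induction n; [now rewrite sum_n_S_C, !sum_n_0_C|].
  rewrite sum_n_S_C, IHn, sum_n_S_C. Cring.
Qed.

Lemma sum_n_plus_C (a b : nat -> C) (n : nat) : sum_n (fun k => a k + b k) n = sum_n a n + sum_n b n.
Proof.
  induction n; [now rewrite !sum_n_0_C|]. rewrite !sum_n_S_C, IHn. Cring.
Qed.

Definition formal_deriv (a : nat -> C) (n : nat) : C := (INR n + 1) * a (S n).

(** Leibniz's rule for power series, from splitting [n + 1] as [k + (n + 1 - k)]. *)
Lemma conv_deriv (a b : nat -> C) (n : nat) :
  formal_deriv (conv a b) n = conv (formal_deriv a) b n + conv a (formal_deriv b) n.
Proof.
  unfold formal_deriv at 1, conv at 1. rewrite <- INR_C_S, sum_n_scal_C.
  transitivity (sum_n (fun k => INR k * a k * b (S n - k)%nat) (S n) +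
     sum_n (fun k => (INR (S n) - INR k) * a k * b (S n - k)%nat) (S n)).
  - rewrite <- sum_n_plus_C. apply sum_n_ext_C. intros k _. ring.
  - f_equal.
    + rewrite sum_n_first_C. unfold conv, formal_deriv. simpl (INR 0). rewrite !Cmult_0_l, Cplus_0_l.
      apply sum_n_ext_C. intros k _. rewrite INR_C_S. reflexivity.
    + rewrite sum_n_S_C. replace (INR (S n) - INR (S n)) with (RtoC 0) by ring. rewrite !Cmult_0_l, Cplus_0_r.
      unfold conv, formal_deriv. apply sum_n_ext_C. intros k Hk.
      replace (S n - k)%nat with (S (n - k)) by lia.
      rewrite minus_INR, RtoC_minus by easy. rewrite INR_C_S. ring.
Qed.

Lemma conv_ext (a a' b b' : nat -> C) (n : nat) : (forall k, a k = a' k) -> (forall k, b k = b' k) ->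
  conv a b n = conv a' b' n.
Proof. intros Ha Hb. apply sum_n_ext_C. intros k _. now rewrite Ha, Hb. Qed.

Lemma conv_plus_r (a b c : nat -> C) (n : nat) : conv a b n + conv a c n = conv a (fun k => b k + c k) n.
Proof. unfold conv. rewrite <- sum_n_plus_C. apply sum_n_ext_C. intros k _. ring. Qed.

(* [kummer_coef l mu = 4^mu Gamma(mu+l+1/2) / (sqrt PI Gamma(2 mu+l+1))], written
   without poles. *)
Definition kummer_coef (l : nat) (mu : C) : C :=
  / 2 ^ l * Crising (mu + INR (Nat.div2 (S l)) + 1 / 2) (Nat.div2 l) * rGamma (mu + INR (Nat.div2 l) + 1).

Lemma div2_even (p : nat) : Nat.div2 (2 * p) = p.
Proof. apply Nat.div2_double. Qed.

Lemma div2_odd (p : nat) : Nat.div2 (S (2 * p)) = p.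
Proof. apply Nat.div2_succ_double. Qed.

Lemma kummer_coef_even (p : nat) (mu : C) : kummer_coef (2 * p) mu =
  / 4 ^ p * Crising (mu + INR p + 1 / 2) p * rGamma (mu + INR p + 1).
Proof.
  unfold kummer_coef. rewrite div2_even, div2_odd, Cpow_mult_r.
  replace (2 ^ 2) with (RtoC 4) by (simpl; rewrite <- !RtoC_mult; f_equal; ring). reflexivity.
Qed.

Lemma kummer_coef_odd (p : nat) (mu : C) : kummer_coef (S (2 * p)) mu =
  / (2 * 4 ^ p) * Crising (mu + INR p + 3 / 2) p * rGamma (mu + INR p + 1).
Proof.
  unfold kummer_coef. rewrite div2_odd, Cpow_S, Cpow_mult_r.
  replace (2 ^ 2) with (RtoC 4) by (simpl; rewrite <- !RtoC_mult; f_equal; ring).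
  replace (S (S (2 * p))) with (2 * S p)%nat by lia. rewrite div2_even, INR_C_S.
  replace (mu + (INR p + 1) + 1 / 2) with (mu + INR p + 3 / 2) by field. reflexivity.
Qed.

Lemma pow4_neq_0 (p : nat) : (4 : C) ^ p <> 0.
Proof. apply Cpow_nz, RtoC_neq_0. lra. Qed.

Lemma kummer_coef_ind (P : nat -> Prop) : (forall p, P (2 * p)%nat) -> (forall p, P (S (2 * p))) -> forall l, P l.
Proof.
  intros H0 H1 l. destruct (Nat.Even_or_Odd l) as [[p ->]|[p ->]]; [apply H0|].
  rewrite Nat.add_1_r. apply H1.
Qed.

Lemma kummer_coef_0 (mu : C) : kummer_coef 0 mu = rGamma (mu + 1).
Proof.
  change 0%nat with (2 * 0)%nat. rewrite kummer_coef_even. simpl.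
  replace (mu + 0 + 1) with (mu + 1) by ring. field.
Qed.

Lemma kummer_coef_1 (mu : C) : 2 * kummer_coef 1 mu = kummer_coef 0 mu.
Proof.
  rewrite kummer_coef_0. change 1%nat with (S (2 * 0)). rewrite kummer_coef_odd. simpl.
  replace (mu + 0 + 1) with (mu + 1) by ring. field.
Qed.

(** The parities of [l] are treated separately because the definition halves the index. The identity
    contains no division by a function of [mu], so that it holds at half-integers as well; it is the
    recurrence that carries Kummer's formula. *)
Lemma kummer_coef_shift (l : nat) (mu : C) :
  2 * kummer_coef (S (S l)) mu - kummer_coef (S l) mu = (INR l + 1) / 4 * kummer_coef l (mu + 1).
Proof.
  revert l. apply kummer_coef_ind; intros p.
  - replace (S (S (2 * p))) with (2 * S p)%nat by lia. rewrite kummer_coef_even, kummer_coef_odd, kummer_coef_even.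
    replace (mu + INR (S p) + 1 / 2) with (mu + INR p + 3 / 2) by (rewrite INR_C_S; field).
    replace (mu + 1 + INR p + 1 / 2) with (mu + INR p + 3 / 2) by field.
    rewrite (rGamma_rec (mu + INR p + 1)).
    replace (mu + INR (S p) + 1) with (mu + INR p + 1 + 1) by (rewrite INR_C_S; ring).
    replace (mu + 1 + INR p + 1) with (mu + INR p + 1 + 1) by ring.
    cbn [Crising]. rewrite Cpow_S, mult_INR, RtoC_mult. simpl (INR 2). rewrite ?RtoC_plus.
    field. apply pow4_neq_0.
  - replace (S (S (S (2 * p)))) with (S (2 * S p)) by lia. replace (S (S (2 * p))) with (2 * S p)%nat by lia.
    rewrite kummer_coef_even, !kummer_coef_odd.
    replace (mu + INR (S p) + 1) with (mu + INR p + 2) by (rewrite INR_C_S; ring).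
    replace (mu + 1 + INR p + 1) with (mu + INR p + 2) by ring.
    rewrite (Crising_S (mu + INR (S p) + 1 / 2)).
    replace (mu + INR (S p) + 1 / 2 + 1) with (mu + INR p + 5 / 2) by (rewrite INR_C_S; field).
    replace (mu + 1 + INR p + 3 / 2) with (mu + INR p + 5 / 2) by field.
    replace (mu + INR (S p) + 3 / 2) with (mu + INR p + 5 / 2) by (rewrite INR_C_S; field).
    cbn [Crising]. rewrite Cpow_S, !INR_C_S, mult_INR, RtoC_mult. simpl (INR 2). rewrite ?RtoC_plus.
    field. apply pow4_neq_0.
Qed.

(** The factor [2 mu + l + 1] may vanish, so that this recurrence in [l] does not determine the
    coefficients for every [mu]. It serves for their growth and for the terms of [chi] at
    half-integers. *)
Lemma kummer_coef_rec (l : nat) (mu : C) :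
  (2 * mu + INR l + 1) * kummer_coef (S l) mu = (mu + INR l + 1 / 2) * kummer_coef l mu.
Proof.
  revert l. apply kummer_coef_ind; intros p.
  - rewrite kummer_coef_even, kummer_coef_odd, mult_INR, RtoC_mult. simpl (INR 2). rewrite ?RtoC_plus.
    assert (E : (mu + INR p + 1 / 2) * Crising (mu + INR p + 3 / 2) p
      = Crising (mu + INR p + 1 / 2) p * (mu + INR p + 1 / 2 + INR p)).
    { replace (mu + INR p + 3 / 2) with (mu + INR p + 1 / 2 + 1) by field.
      rewrite <- Crising_S. reflexivity. }
    transitivity (/ 4 ^ p * ((mu + INR p + 1 / 2) * Crising (mu + INR p + 3 / 2) p) * rGamma (mu + INR p + 1)).
    + field. apply pow4_neq_0.
    + rewrite E. field. apply pow4_neq_0.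
  - replace (S (S (2 * p))) with (2 * S p)%nat by lia. rewrite kummer_coef_even, kummer_coef_odd.
    rewrite (rGamma_rec (mu + INR p + 1)).
    replace (mu + INR (S p) + 1) with (mu + INR p + 1 + 1) by (rewrite INR_C_S; ring).
    replace (mu + INR (S p) + 1 / 2) with (mu + INR p + 3 / 2) by (rewrite INR_C_S; field).
    cbn [Crising]. rewrite Cpow_S, INR_C_S, mult_INR, RtoC_mult. simpl (INR 2). rewrite ?RtoC_plus.
    field. apply pow4_neq_0.
Qed.

Lemma kummer_coef_bound (mu : C) : exists M, (0 <= M)%R /\ forall l, (Cmod (kummer_coef l mu) <= M * 2 ^ l)%R.
Proof.
  (* For [l > 5 |mu|] one has [|mu + l + 1/2| <= 2 |2 mu + l + 1|], so that a coefficient is at most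
     twice the preceding one. *)
  destruct (INR_unbounded (5 * Cmod mu)) as [N HN].
  destruct (eventually_decr_bounded (fun l => Cmod (kummer_coef l mu) / 2 ^ l)%R N) as [M [HM0 HM]].
  - intros l Hl. assert (Hl' := le_INR _ _ Hl). assert (Hm := Cmod_ge_0 mu).
    assert (E := f_equal Cmod (kummer_coef_rec l mu)). rewrite !Cmod_mult in E.
    assert (A : (2 * (INR l + 1) - 4 * Cmod mu <= 2 * Cmod (2 * mu + INR l + 1))%R).
    { assert (Q := Cmod_triangle_rev (INR l + 1) (- (2 * mu))).
      replace (INR l + 1 - - (2 * mu)) with (2 * mu + INR l + 1) in Q by ring.
      rewrite Cmod_opp, Cmod_mult, <- RtoC_plus, !Cmod_R, !Rabs_pos_eq in Q by lra. lra. }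
    assert (B : (Cmod (mu + INR l + 1 / 2) <= Cmod mu + (INR l + 1 / 2))%R).
    { replace (mu + INR l + 1 / 2) with (mu + RtoC (INR l + 1 / 2)) by (rewrite RtoC_plus, RtoC_div by lra; ring).
      eapply Rle_trans; [apply Cmod_triangle|]. rewrite Cmod_R, Rabs_pos_eq by lra. lra. }
    set (x := Cmod (kummer_coef (S l) mu)) in *. set (y := Cmod (kummer_coef l mu)) in *.
    assert (Hx : (0 <= x)%R) by apply Cmod_ge_0. assert (Hy : (0 <= y)%R) by apply Cmod_ge_0.
    set (u := Cmod (2 * mu + INR l + 1)) in *. set (v := Cmod (mu + INR l + 1 / 2)) in *.
    assert (Huv : (v <= 2 * u)%R) by lra. assert (Hu : (0 < u)%R) by lra.
    assert (X : (x <= 2 * y)%R).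
    { apply Rmult_le_reg_l with u; [easy|]. rewrite E. nra. }
    assert (P2 := pow_lt 2 l ltac:(lra)).
    replace (x / 2 ^ S l)%R with (x / 2 * / 2 ^ l)%R by (simpl; field; lra).
    apply Rmult_le_compat_r; [left; now apply Rinv_0_lt_compat|lra].
  - exists M. split; [easy|]. intros l. specialize (HM l). assert (P2 := pow_lt 2 l ltac:(lra)).
    replace (Cmod (kummer_coef l mu)) with (Cmod (kummer_coef l mu) / 2 ^ l * 2 ^ l)%R by (field; lra).
    apply Rmult_le_compat_r; lra.
Qed.

Definition kummer_term (mu x : C) (l : nat) : C := x ^ l / INR (fact l) * kummer_coef l mu.

Lemma kummer_abs (mu x : C) : ex_series (fun l => Cmod (kummer_term mu x l)).
Proof.
  destruct (kummer_coef_bound mu) as [M [HM0 HM]].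
  apply (@ex_series_le R_AbsRing R_CompleteNormedModule) with
    (b := fun l => (M * ((2 * Cmod x) ^ l / INR (fact l)))%R).
  - intros l. change norm with Rabs. rewrite Rabs_pos_eq by apply Cmod_ge_0.
    unfold kummer_term. unfold Cdiv. rewrite !Cmod_mult, Cmod_inv, Cmod_pow, Cmod_R, Rabs_pos_eq
      by (try apply fact_C_neq_0; apply pos_INR).
    assert (F := INR_fact_lt_0 l).
    replace (M * ((2 * Cmod x) ^ l / INR (fact l)))%R with (Cmod x ^ l * / INR (fact l) * (M * 2 ^ l))%R
      by (rewrite Rpow_mult_distr; field; lra).
    apply Rmult_le_compat_l; [|apply HM]. apply Rmult_le_pos; [apply pow_le, Cmod_ge_0|].
    left. now apply Rinv_0_lt_compat.
  - apply ex_series_scal_R, ex_series_exp.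
Qed.

Lemma kummer_series (mu x : C) : is_series (kummer_term mu x) (CSeries (kummer_term mu x)).
Proof.
  destruct (ex_series_C_le (kummer_term mu x) _ (fun n => Rle_refl _) (kummer_abs mu x)) as [l Hl].
  now rewrite (is_series_CSeries _ _ Hl).
Qed.

Definition kummer_conv (mu : C) : nat -> C :=
  conv (fun k => / INR (fact k)) (kummer_term mu (- (2))).

(* With [Phi_mu(x) = sum_l kummer_coef l mu x^l / l!], the relation [kummer_coef_shift]
   says that [exp(x) Phi_mu(-2x)] has derivative [(x/2) exp(x) Phi_(mu+1)(-2x)]. *)
Lemma kummer_conv_deriv (mu : C) (n : nat) :
  formal_deriv (kummer_conv mu) (S n) = / 2 * kummer_conv (mu + 1) n /\ kummer_conv mu 1 = 0.
Proof.
  assert (DE : forall k, formal_deriv (fun k => / INR (fact k)) k = / INR (fact k)).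
  { intros k. unfold formal_deriv. rewrite fact_C_S. field. split; [apply fact_C_neq_0|].
    rewrite <- INR_C_S. apply INR_C_neq_0; lia. }
  set (h := fun k => match k with O => RtoC 0 | S p => / 2 * kummer_term (mu + 1) (- (2)) p end).
  assert (DK : forall k, kummer_term mu (- (2)) k + formal_deriv (kummer_term mu (- (2))) k = h k).
  { intros k. unfold formal_deriv, kummer_term.
    assert (E : (- (2)) ^ k / INR (fact k) * kummer_coef k mu +
        (INR k + 1) * ((- (2)) ^ S k / INR (fact (S k)) * kummer_coef (S k) mu)
        = - ((- (2)) ^ k / INR (fact k) * (2 * kummer_coef (S k) mu - kummer_coef k mu))).
    { rewrite Cpow_S, fact_C_S. field. split; [apply fact_C_neq_0|].
      rewrite <- INR_C_S. apply INR_C_neq_0; lia. }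
    rewrite E. destruct k.
    - rewrite kummer_coef_1. simpl. field.
    - rewrite kummer_coef_shift. unfold h, kummer_term. rewrite Cpow_S, fact_C_S. field. split; [apply fact_C_neq_0|].
      rewrite <- INR_C_S. apply INR_C_neq_0; lia. }
  assert (DC : forall m, formal_deriv (kummer_conv mu) m = conv (fun k => / INR (fact k)) h m).
  { intros m. unfold kummer_conv. rewrite conv_deriv.
    rewrite (conv_ext _ (fun k => / INR (fact k)) _ (kummer_term mu (- (2))) m DE (fun _ => eq_refl)).
    rewrite conv_plus_r. apply conv_ext; [easy|exact DK]. }
  split.
  - rewrite DC. unfold conv. rewrite sum_n_S_C, Nat.sub_diag. change (h 0%nat) with (RtoC 0).
    rewrite Cmult_0_r, Cplus_0_r. unfold kummer_conv, conv. rewrite sum_n_scal_C.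
    apply sum_n_ext_C. intros k Hk. replace (S n - k)%nat with (S (n - k)) by lia. unfold h. ring.
  - specialize (DC 0%nat). unfold formal_deriv, conv in DC. rewrite sum_n_0_C in DC. simpl in DC.
    replace ((0 + 1) * kummer_conv mu 1) with (kummer_conv mu 1) in DC by ring.
    rewrite DC. ring.
Qed.

(** Induction over all [mu] at once: [kummer_conv_deriv] lowers the degree by two and raises [mu] by
    one. *)
Lemma kummer_conv_even (k : nat) (mu : C) :
  kummer_conv mu (2 * k) = / (4 ^ k * INR (fact k)) * rGamma (mu + INR k + 1).
Proof.
  revert mu. induction k; intros mu.
  - change (2 * 0)%nat with 0%nat. unfold kummer_conv, conv. rewrite sum_n_0_C. unfold kummer_term. simpl (0 - 0)%nat.
    rewrite kummer_coef_0. simpl. replace (mu + 0 + 1) with (mu + 1) by ring. field.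
  - replace (2 * S k)%nat with (S (S (2 * k))) by lia.
    destruct (kummer_conv_deriv mu (2 * k)) as [E _]. rewrite IHk in E. unfold formal_deriv in E.
    rewrite <- INR_C_S in E. replace (INR (S (S (2 * k)))) with (2 * INR (S k))%R in E
      by (rewrite !S_INR, mult_INR; simpl; ring).
    rewrite RtoC_mult in E.
    assert (N : RtoC (INR (S k)) <> 0) by (apply INR_C_neq_0; lia).
    replace (kummer_conv mu (S (S (2 * k)))) with (/ (2 * INR (S k)) * (2 * INR (S k) * kummer_conv mu (S (S (2 * k))))) by (field; easy).
    rewrite E. replace (mu + 1 + INR k + 1) with (mu + INR (S k) + 1) by (rewrite INR_C_S; ring).
    rewrite fact_C_S, Cpow_S, <- INR_C_S. field. repeat split; auto using pow4_neq_0, fact_C_neq_0.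
Qed.

Lemma kummer_conv_odd (k : nat) (mu : C) : kummer_conv mu (S (2 * k)) = 0.
Proof.
  revert mu. induction k; intros mu.
  - apply (proj2 (kummer_conv_deriv mu 0)).
  - replace (S (2 * S k))%nat with (S (S (S (2 * k)))) by lia.
    destruct (kummer_conv_deriv mu (S (2 * k))) as [E _]. rewrite IHk in E. unfold formal_deriv in E.
    rewrite <- INR_C_S, Cmult_0_r in E.
    assert (N : RtoC (INR (S (S (S (2 * k))))) <> 0) by (apply INR_C_neq_0; lia).
    replace (kummer_conv mu (S (S (S (2 * k))))) with
      (/ INR (S (S (S (2 * k)))) * (INR (S (S (S (2 * k)))) * kummer_conv mu (S (S (S (2 * k)))))) by (field; easy).
    rewrite E. ring.
Qed.

(** For [x = iz], the Cauchy product of [exp x] and the Kummer series at [-2 x] has only even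
    coefficients, and these are the terms of the Bessel series. Its partial sums of even order [2 n]
    are thus the partial sums of order [n] wanted here. *)
Lemma kummer_formula (mu z : C) :
  is_series (fun k => (- (1)) ^ k * (z / 2) ^ (2 * k) / INR (fact k) * rGamma (mu + INR k + 1))
    (Cexp (Ci * z) * CSeries (kummer_term mu (- (2) * (Ci * z)))).
Proof.
  set (x := Ci * z).
  assert (AE : ex_series (fun k => Cmod (x ^ k / INR (fact k)))).
  { eapply ex_series_ext; [|apply (ex_series_exp (Cmod x))]. intros k. unfold Cdiv.
    rewrite Cmod_mult, Cmod_inv, Cmod_pow, Cmod_R, Rabs_pos_eq by (try apply fact_C_neq_0; apply pos_INR). reflexivity. }
  assert (K := is_series_conv _ _ _ _ (Cexp_series x) (kummer_series mu (- (2) * x)) AE (kummer_abs mu _)).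
  assert (E : forall n, conv (fun k => x ^ k / INR (fact k)) (kummer_term mu (- (2) * x)) n = x ^ n * kummer_conv mu n).
  { intros n. unfold kummer_conv, conv. rewrite sum_n_scal_C. apply sum_n_ext_C. intros k Hk.
    unfold kummer_term. rewrite Cpow_mult_l.
    replace (x ^ n) with (x ^ k * x ^ (n - k)) by (rewrite <- Cpow_add_r; f_equal; lia).
    field. split; apply fact_C_neq_0. }
  apply is_series_tends. apply is_series_tends in K.
  assert (H2 : forall n, (n <= 2 * n)%nat) by (intros; lia).
  assert (K2 := tends_comp eventually eventually (fun n => (2 * n)%nat) _ _ (filterlim_eventually_ge _ H2) K).
  eapply tends_ext_all; [apply _| |exact K2]. intros n. cbv beta.
  assert (X2 : x ^ 2 = - (1) * 4 * (z / 2) ^ 2).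
  { unfold x. simpl. replace (Ci * z * (Ci * z * 1)) with ((Ci * Ci) * z * z) by ring. rewrite Ci_sq. field. }
  assert (TE : forall k, conv (fun k => x ^ k / INR (fact k)) (kummer_term mu (- (2) * x)) (2 * k) =
     (- (1)) ^ k * (z / 2) ^ (2 * k) / INR (fact k) * rGamma (mu + INR k + 1)).
  { intros k. rewrite E, kummer_conv_even, !Cpow_mult_r, X2, !Cpow_mult_l. field.
    split; [apply fact_C_neq_0|apply pow4_neq_0]. }
  assert (TO : forall k, conv (fun k => x ^ k / INR (fact k)) (kummer_term mu (- (2) * x)) (S (2 * k)) = 0).
  { intros k. rewrite E, kummer_conv_odd. ring. }
  induction n.
  - change (2 * 0)%nat with 0%nat. rewrite !sum_n_0_C. exact (TE 0%nat).
  - replace (2 * S n)%nat with (S (S (2 * n))) by lia. rewrite !sum_n_S_C, IHn, TO.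
    replace (S (S (2 * n))) with (2 * S n)%nat by lia. rewrite TE. ring.
Qed.

(** * The representation of the Bessel function *)

Lemma nearest_bounds (x : R) : (- (1 / 2) < x - IZR (nearest x) <= 1 / 2)%R.
Proof.
  unfold nearest. rewrite opp_IZR. assert (B := base_Int_part (1 / 2 - x)). lra.
Qed.

Lemma nearest_unique (x : R) (n : Z) : (- (1 / 2) < x - IZR n <= 1 / 2)%R -> nearest x = n.
Proof.
  intros H. assert (B := nearest_bounds x).
  assert (H1 : (IZR (nearest x) < IZR n + 1)%R) by lra. assert (H2 : (IZR n < IZR (nearest x) + 1)%R) by lra.
  rewrite <- plus_IZR in H1, H2. apply lt_IZR in H1, H2. lia.
Qed.

Lemma fpart_bounds (mu : C) : (- (1 / 2) < Re (fpart mu) <= 1 / 2)%R.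
Proof.
  assert (B := nearest_bounds (Re mu)). unfold fpart. unfold Re in *. simpl. lra.
Qed.

Lemma fpart_unique (mu a : C) (n : Z) : mu = a + IZR n -> (- (1 / 2) < Re a <= 1 / 2)%R ->
  nearest (Re mu) = n /\ fpart mu = a.
Proof.
  intros E H. assert (N : nearest (Re mu) = n).
  { apply nearest_unique. rewrite E. unfold Re in *. simpl. lra. }
  split; [easy|]. unfold fpart. rewrite N, E. ring.
Qed.

Lemma Cln_exp (z : C) : z <> 0 -> Cexp (Cln z) = z.
Proof.
  intros Hz. assert (Hm := proj1 (Cmod_gt_0 _) Hz).
  unfold Cln, Cexp. cbn [Re Im fst snd]. rewrite exp_ln by easy.
  assert (B : (-1 <= Re z / Cmod z <= 1)%R).
  { assert (Q := re_le_Cmod z). apply Rabs_le_between in Q.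
    split; [apply Rmult_le_reg_r with (Cmod z)|apply Rmult_le_reg_r with (Cmod z)]; try easy;
    unfold Rdiv; rewrite Rmult_assoc, Rinv_l by lra; lra. }
  assert (S : (Cmod z * sqrt (1 - (Re z / Cmod z)²) = Rabs (Im z))%R).
  { rewrite <- (sqrt_Rsqr (Cmod z)) at 1 by lra. rewrite <- sqrt_mult_alt by apply Rle_0_sqr.
    rewrite <- sqrt_Rsqr_abs. f_equal. assert (Q := Cmod2_alt z). unfold Rsqr. 
    replace (Im z * Im z)%R with (Cmod z ^ 2 - Re z * Re z)%R by (rewrite Q; ring). field. lra. }
  unfold Carg. destruct (Rle_dec 0 (Im z)) as [h|h].
  - rewrite cos_acos, sin_acos by easy. rewrite S, Rabs_pos_eq by easy. apply C_ext; simpl; [|easy].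
    field. lra.
  - rewrite cos_neg, sin_neg, cos_acos, sin_acos by easy.
    apply C_ext; simpl; [field; lra|]. rewrite <- Ropp_mult_distr_r, S, Rabs_left by lra. ring.
Qed.

Lemma Cln_half (z : C) : z <> 0 -> Cln (z / 2) = Cln z - ln 2.
Proof.
  intros Hz. assert (Hm := proj1 (Cmod_gt_0 _) Hz).
  assert (E : z / 2 = RtoC (/ 2) * z) by (rewrite RtoC_inv by lra; unfold Cdiv; ring).
  assert (M : Cmod (z / 2) = (Cmod z / 2)%R).
  { rewrite E, Cmod_mult, Cmod_R, Rabs_pos_eq by lra. field. }
  unfold Cln. rewrite M, ln_div by lra.
  assert (A : Carg (z / 2) = Carg z).
  { unfold Carg. rewrite M. rewrite E. rewrite re_scal_l, im_scal_l.
    replace (/ 2 * Re z / (Cmod z / 2))%R with (Re z / Cmod z)%R by (field; lra).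
    destruct (Rle_dec 0 (/ 2 * Im z)), (Rle_dec 0 (Im z)); try easy; exfalso; lra. }
  rewrite A. apply C_ext; simpl; ring.
Qed.

Lemma Cexp_Ci_half_PI : Cexp (- (Ci * PI / 2)) = - Ci.
Proof.
  replace (- (Ci * PI / 2)) with ((0, (- (PI / 2))%R) : C).
  - unfold Cexp. simpl. rewrite exp_0, cos_neg, sin_neg, cos_PI2, sin_PI2. apply C_ext; simpl; ring.
  - apply C_ext; simpl; field.
Qed.

(* The logarithm of [-i z] that is implicit in [mipow]. *)
Definition log_mi (z : C) : C := Cln z - Ci * PI / 2.

Lemma log_mi_exp (z : C) : z <> 0 -> Cexp (log_mi z) = - Ci * z.
Proof.
  intros Hz. unfold log_mi, Cminus. rewrite Cexp_plus, Cexp_Ci_half_PI, Cln_exp by easy. ring.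
Qed.

Lemma mipow_exp (c : R) (z a : C) : (0 < c)%R -> mipow c z a = Cexp (a * (log_mi z + ln c)).
Proof.
  intros Hc. unfold mipow, ipow, log_mi. rewrite Cpower_pos by easy. unfold Cpower.
  rewrite <- !Cexp_plus. f_equal. field.
Qed.

Lemma CSeries_ext (a b : nat -> C) : (forall k, a k = b k) -> CSeries a = CSeries b.
Proof.
  intros H. unfold CSeries. f_equal; apply Series_ext; intros; now rewrite H.
Qed.

(** The factor [exp (iz (1 + cos t))] of the incomplete gamma function turns [exp (- iz cos t)] into
    the constant [exp (iz)], and [mipow] contributes [(1 + cos t)^a]. Apart from [cos (mu t)], what
    depends on [t] is a power series in [1 + cos t] times this power. *)
Lemma Pgamma_integrand (a mu z : C) (t : R) : (0 < t < PI)%R ->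
  Cexp (- Ci * z * cos t) * Pgamma_mi a (1 + cos t) z * Ccos (mu * t) =
  Cexp (a * log_mi z) * Cexp (Ci * z) *
    (ucos a t * CSeries (gs_term a (- Ci * z * (1 + cos t)%R)) * ccos mu t).
Proof.
  intros Ht. assert (H := one_plus_cos_pos t ltac:(lra)).
  unfold Pgamma_mi, gammastar. rewrite mipow_exp by easy.
  rewrite Cmult_plus_distr_l, Cexp_plus. fold (ucos a t) (ccos mu t).
  replace (Cexp (Ci * z)) with (Cexp (- Ci * z * cos t) * Cexp (- (- Ci * (1 + cos t)%R * z))).
  2:{ rewrite <- Cexp_plus. f_equal. rewrite RtoC_plus. ring. }
  rewrite (CSeries_ext (fun k => (- Ci * (1 + cos t)%R * z) ^ k * rGamma (a + INR k + 1))
    (gs_term a (- Ci * z * (1 + cos t)%R))).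
  2:{ intros k. unfold gs_term. do 2 f_equal. ring. }
  ring.
Qed.

Lemma Pgamma_imp_int (a mu z : C) : (- (1 / 2) < Re a)%R -> exists L,
  is_series (fun k => (- Ci * z) ^ k * rGamma (a + INR k + 1) * cauchyI (a + INR k) mu) L /\
  imp_int (fun t => Cexp (- Ci * z * cos t) * Pgamma_mi a (1 + cos t) z * Ccos (mu * t))
    (Cexp (a * log_mi z) * Cexp (Ci * z) * L).
Proof.
  intros Ha. destruct (gs_int a mu (- Ci * z) Ha) as [L [H1 H2]]. exists L. split; [easy|].
  eapply imp_int_ext; [|apply imp_int_scal, H2]. intros t Ht. symmetry. now apply Pgamma_integrand.
Qed.

Lemma sqrt_PI_neq_0 : RtoC (sqrt PI) <> 0.
Proof. apply RtoC_neq_0, Rgt_not_eq, sqrt_lt_R0, PI_RGT_0. Qed.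

Lemma Cexp_2_ln2 (n : nat) : Cexp (INR n * (2 * ln 2)) = 4 ^ n.
Proof.
  rewrite <- Cexp_pow. f_equal. rewrite <- RtoC_mult, Cexp_RtoC. f_equal.
  replace (2 * ln 2)%R with (ln 2 + ln 2)%R by ring. rewrite exp_plus, exp_ln by lra. ring.
Qed.

Lemma Cexp_ln2 : Cexp (ln 2) = 2.
Proof. rewrite Cexp_RtoC, exp_ln; [easy|lra]. Qed.

(** The closed form of the coefficient with its denominator cleared, since both sides may vanish.
    The duplication formula is applied at [mu + p + 1 / 2] for [l = 2 p] and at [mu + p + 1] for
    [l = 2 p + 1]. *)
Lemma kummer_coef_gamma (l : nat) (mu : C) :
  rGamma (mu + INR l + 1 / 2) * kummer_coef l mu =
  Cexp (2 * mu * ln 2) * rGamma (1 / 2) * rGamma (2 * mu + INR l + 1).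
Proof.
  revert l. apply kummer_coef_ind; intros p.
  - rewrite kummer_coef_even.
    replace (INR (2 * p)) with (INR p + INR p)%R by (rewrite mult_INR; simpl; ring). rewrite RtoC_plus.
    transitivity (/ 4 ^ p * ((Crising (mu + INR p + 1 / 2) p * rGamma (mu + INR p + 1 / 2 + INR p)) * rGamma (mu + INR p + 1 / 2 + 1 / 2))).
    { replace (mu + INR p + 1 / 2 + 1 / 2) with (mu + INR p + 1) by field.
      replace (mu + (INR p + INR p) + 1 / 2) with (mu + INR p + 1 / 2 + INR p) by ring. ring. }
    rewrite <- rGamma_Crising, rGamma_dup.
    replace (2 * (mu + INR p + 1 / 2)) with (2 * mu + (INR p + INR p) + 1) by field.
    replace ((2 * mu + (INR p + INR p) + 1) * ln 2) with (2 * mu * ln 2 + INR p * (2 * ln 2) + ln 2) by ring.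
    rewrite !Cexp_plus, Cexp_2_ln2, Cexp_ln2. field. apply pow4_neq_0.
  - rewrite kummer_coef_odd. rewrite INR_C_S.
    replace (INR (2 * p)) with (INR p + INR p)%R by (rewrite mult_INR; simpl; ring). rewrite RtoC_plus.
    transitivity (/ (2 * 4 ^ p) * (rGamma (mu + INR p + 1) * (Crising (mu + INR p + 1 + 1 / 2) p * rGamma (mu + INR p + 1 + 1 / 2 + INR p)))).
    { replace (mu + INR p + 1 + 1 / 2) with (mu + INR p + 3 / 2) by field.
      replace (mu + (INR p + INR p + 1) + 1 / 2) with (mu + INR p + 3 / 2 + INR p) by field. ring. }
    rewrite <- rGamma_Crising, rGamma_dup.
    replace (2 * (mu + INR p + 1)) with (2 * mu + (INR p + INR p + 1) + 1) by ring.
    replace ((2 * mu + (INR p + INR p + 1) + 1) * ln 2) with (2 * mu * ln 2 + INR p * (2 * ln 2) + ln 2 + ln 2) by ring.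
    rewrite !Cexp_plus, Cexp_2_ln2, Cexp_ln2. field. apply pow4_neq_0.
Qed.

(* For [k = n + l] the factor [rGamma (k + 1 - n)] is [1 / l!], and it vanishes for [k < n]. *)
Lemma B_series_term (a mu z : C) (n : Z) (k l : nat) : z <> 0 -> (- (1 / 2) < Re a)%R ->
  mu = a + IZR n -> Z.of_nat k = (n + Z.of_nat l)%Z ->
  (- Ci * z) ^ k * rGamma (a + INR k + 1) * cauchyI (a + INR k) mu =
  PI * Cexp (- mu * ln 2) * Cexp (IZR n * log_mi z) * kummer_term mu (- (2) * (Ci * z)) l.
Proof.
  intros Hz Ha Hmu Hk.
  assert (Hk' : RtoC (INR k) = IZR n + INR l).
  { rewrite !INR_IZR_INZ, Hk, plus_IZR. apply RtoC_plus. }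
  assert (Hs : a + INR k = mu + INR l) by (rewrite Hmu, Hk'; ring).
  assert (Hs2 : (- (1 / 2) < Re (a + INR k))%R) by (assert (Q := pos_INR k); unfold Re in *; simpl; lra).
  assert (F := cauchyI_formula (a + INR k) mu Hs2).
  assert (N : rGamma (a + INR k + 1 / 2) <> 0).
  { apply rGamma_neq_0_Re. unfold Re in *. simpl in *. lra. }
  assert (KG := kummer_coef_gamma l mu).
  rewrite Hs in *.
  replace (mu + INR l + 1 - mu) with (INR l + 1) in F by ring. rewrite rGamma_fact in F.
  replace (mu + INR l + 1 + mu) with (2 * mu + INR l + 1) in F by ring.
  set (g := rGamma (mu + INR l + 1 / 2)) in *.
  (* Since [n] may be negative, the power of [-iz] with exponent [k = n + l] is split through the
     logarithm. *)
  rewrite <- log_mi_exp, Cexp_pow, Hk' by easy.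
  replace ((IZR n + INR l) * log_mi z) with (IZR n * log_mi z + INR l * log_mi z) by ring.
  rewrite Cexp_plus, <- (Cexp_pow _ l), log_mi_exp by easy.
  unfold kummer_term. replace (- (2) * (Ci * z)) with (2 * (- Ci * z)) by ring. rewrite (Cpow_mult_l 2).
  assert (E2 : Cexp ((mu + INR l) * ln 2) = Cexp (- mu * ln 2) * Cexp (2 * mu * ln 2) * 2 ^ l).
  { replace (2 ^ l) with (Cexp (ln 2) ^ l) by (rewrite Cexp_ln2; reflexivity). rewrite Cexp_pow, <- !Cexp_plus. f_equal. ring. }
  rewrite E2 in F.
  transitivity (Cexp (IZR n * log_mi z) * (- Ci * z) ^ l * / g * (rGamma (mu + INR l + 1) * g * cauchyI (mu + INR l) mu)).
  { field. easy. }
  rewrite F.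
  transitivity (Cexp (IZR n * log_mi z) * (- Ci * z) ^ l * / g * (PI * / INR (fact l) * Cexp (- mu * ln 2) * 2 ^ l *
     (Cexp (2 * mu * ln 2) * rGamma (1 / 2) * rGamma (2 * mu + INR l + 1)))).
  { field. auto using fact_C_neq_0. }
  rewrite <- KG. field. auto using fact_C_neq_0.
Qed.

Lemma rGamma_neg_Z (m : Z) : (m <= 0)%Z -> rGamma (IZR m) = 0.
Proof.
  intros H. replace (RtoC (IZR m)) with (- INR (Z.to_nat (- m))); [apply rGamma_neg|].
  rewrite INR_IZR_INZ, Z2Nat.id, opp_IZR, RtoC_opp by lia. ring.
Qed.

Lemma B_series_term_0 (a mu : C) (n : Z) (k : nat) : (- (1 / 2) < Re a)%R ->
  mu = a + IZR n -> (Z.of_nat k < n)%Z -> rGamma (a + INR k + 1) * cauchyI (a + INR k) mu = 0.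
Proof.
  intros Ha Hmu Hk.
  assert (Hs2 : (- (1 / 2) < Re (a + INR k))%R) by (assert (Q := pos_INR k); unfold Re in *; simpl; lra).
  assert (F := cauchyI_formula (a + INR k) mu Hs2).
  assert (N : rGamma (a + INR k + 1 / 2) <> 0).
  { apply rGamma_neq_0_Re. unfold Re in *. simpl in *. lra. }
  replace (a + INR k + 1 - mu) with (RtoC (IZR (Z.of_nat k + 1 - n))) in F.
  2:{ rewrite Hmu, INR_IZR_INZ, minus_IZR, plus_IZR, RtoC_minus, RtoC_plus. ring. }
  rewrite (rGamma_neg_Z (Z.of_nat k + 1 - n)) in F by lia.
  set (g := rGamma (a + INR k + 1 / 2)) in *.
  transitivity (/ g * (rGamma (a + INR k + 1) * g * cauchyI (a + INR k) mu)); [field; easy|].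
  rewrite F. ring.
Qed.

Lemma is_series_scal_C (c : C) (a : nat -> C) (l : C) : is_series a l -> is_series (fun k => c * a k) (c * l).
Proof.
  intros H. apply is_series_tends. apply is_series_tends in H.
  eapply tends_ext_all; [apply _|intros n; apply sum_n_scal_C|].
  apply tends_mult; [apply _|apply tends_const, _|exact H].
Qed.

(** This sum has [n] terms where [sum_n a n] has [n + 1]; it can be empty, as [chi] and the shifts
    of a series require. *)
Fixpoint psum (a : nat -> C) (n : nat) : C :=
  match n with O => 0 | S p => psum a p + a p end.

Lemma psum_sum_n (a : nat -> C) (n : nat) : psum a (S n) = sum_n a n.
Proof.
  induction n; [rewrite sum_n_0_C; simpl; ring|].
  rewrite sum_n_S_C, <- IHn. reflexivity.
Qed.

Lemma psum_plus (a : nat -> C) (m n : nat) : psum a (m + n) = psum a m + psum (fun k => a (m + k)%nat) n.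
Proof.
  induction n; [rewrite Nat.add_0_r; simpl; ring|].
  rewrite Nat.add_succ_r. cbn [psum]. rewrite IHn. ring.
Qed.

Lemma is_series_psum (a : nat -> C) (l : C) : is_series a l <-> tends eventually (psum a) l.
Proof.
  rewrite is_series_tends. split; intros H.
  - apply tends_eventually_S. eapply tends_ext_all; [apply _| |exact H]. intros n. symmetry. apply psum_sum_n.
  - apply (tends_eventually_shift _ _ 1) in H. eapply tends_ext_all; [apply _| |exact H].
    intros n. cbv beta. rewrite Nat.add_1_r. apply psum_sum_n.
Qed.

Lemma is_series_shift_tail (a : nat -> C) (l : C) (m : nat) :
  is_series a l -> is_series (fun k => a (m + k)%nat) (l - psum a m).
Proof.
  rewrite !is_series_psum. intros H.
  assert (H2 := tends_eventually_shift _ _ m H).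
  eapply tends_ext_all; [apply _| |apply tends_minus; [apply _|exact H2|apply (tends_const _ (psum a m))]].
  intros n. cbv beta. rewrite Nat.add_comm, psum_plus. ring.
Qed.

Lemma is_series_shift_head (a : nat -> C) (l : C) (m : nat) : (forall k, (k < m)%nat -> a k = 0) ->
  is_series (fun k => a (m + k)%nat) l -> is_series a l.
Proof.
  intros H0. rewrite !is_series_psum. intros H.
  assert (Z : psum a m = 0).
  { clear H. induction m; [easy|]. cbn [psum]. rewrite H0, IHm by (intros; try apply H0; lia). ring. }
  intros eps He. destruct (H eps He) as [N HN]. exists (m + N)%nat. intros n Hn.
  replace n with (m + (n - m))%nat by lia. rewrite psum_plus, Z, Cplus_0_l. apply HN. lia.
Qed.

Definition kummer_sum (mu z : C) : C := CSeries (kummer_term mu (- (2) * (Ci * z))).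

Lemma Cpower_half (z mu : C) : z <> 0 -> Cpower (z / 2) mu = Cpower z mu * Cexp (- mu * ln 2).
Proof.
  intros Hz. unfold Cpower. rewrite Cln_half, <- Cexp_plus by easy. f_equal. ring.
Qed.

Lemma BesselJ_kummer (mu z : C) :
  BesselJ mu z = Cpower (z / 2) mu * Cexp (Ci * z) * kummer_sum mu z.
Proof.
  unfold BesselJ, kummer_sum. rewrite (is_series_CSeries _ _ (kummer_formula mu z)). ring.
Qed.

Lemma B_kummer (mu z : C) : z <> 0 ->
  B mu z = Cpower (z / 2) mu * Cexp (Ci * z) *
    (kummer_sum mu z - psum (kummer_term mu (- (2) * (Ci * z))) (Z.to_nat (- nearest (Re mu)))).
Proof.
  intros Hz. set (a := fpart mu). set (n := nearest (Re mu)).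
  assert (Ha := fpart_bounds mu). fold a in Ha.
  assert (Hmu : mu = a + IZR n) by (unfold a, fpart; fold n; ring).
  destruct (Pgamma_imp_int a mu z ltac:(lra)) as [L [HL HI]].
  unfold B. fold a. rewrite (imp_int_CInt_0_PI _ _ HI).
  set (c := PI * Cexp (- mu * ln 2) * Cexp (IZR n * log_mi z)).
  assert (K := kummer_series mu (- (2) * (Ci * z))). fold (kummer_sum mu z) in K.
  assert (E : L = c * (kummer_sum mu z - psum (kummer_term mu (- (2) * (Ci * z))) (Z.to_nat (- n)))).
  (* With [k = n + l]: for [n >= 0] the first [n] terms vanish and the whole Kummer series remains,
     while for [n < 0] the series starts at [l = - n]. *)
  { apply (is_series_C_unique _ _ _ HL). destruct (Z.le_gt_cases 0 n) as [h|h].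
    - replace (Z.to_nat (- n)) with 0%nat by lia. simpl psum. rewrite Cminus_0_r.
      apply (is_series_shift_head _ _ (Z.to_nat n)).
      + intros k Hk. rewrite <- Cmult_assoc, (B_series_term_0 a mu n) by (try easy; try lra; lia). ring.
      + eapply is_series_ext; [|apply is_series_scal_C, K].
        intros l. symmetry. apply (B_series_term a mu z n); [easy|lra|easy|lia].
    - eapply is_series_ext; [|apply is_series_scal_C, (is_series_shift_tail _ _ (Z.to_nat (- n)) K)].
      intros k. symmetry. apply (B_series_term a mu z n); [easy|lra|easy|lia]. }
  rewrite E, Cpower_half by easy. unfold c.
  (* The factor [i^mu] of [B] undoes the rotation contained in [log_mi]. *)
  assert (X : ipow mu * Cexp (a * log_mi z) * Cexp (IZR n * log_mi z) = Cpower z mu).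
  { unfold ipow, Cpower, log_mi. rewrite <- !Cexp_plus. f_equal. rewrite Hmu. field. }
  rewrite <- X. field. apply RtoC_neq_0, Rgt_not_eq, PI_RGT_0.
Qed.

(** * The finite sum [chi] *)

Lemma Cexp_half_int (p : nat) : Cexp (- (2 * (- INR p - 1 / 2)) * ln 2) = 2 * 4 ^ p.
Proof.
  replace (- (2 * (- INR p - 1 / 2)) * ln 2) with (INR p * (2 * ln 2) + ln 2) by field.
  rewrite Cexp_plus, Cexp_2_ln2, Cexp_ln2. ring.
Qed.

(** The case [l = 0]: when [p] grows by one, both sides are multiplied by [- (4 p + 2)]. *)
Lemma kummer_coef_half_int_0 (p : nat) :
  2 * (- (1)) ^ p * INR (fact (2 * p)) / INR (fact p) = 2 * 4 ^ p * sqrt PI * rGamma (1 / 2 - INR p).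
Proof.
  induction p.
  - simpl. rewrite Cminus_0_r, rGamma_half. field. apply sqrt_PI_neq_0.
  - replace (2 * S p)%nat with (S (S (2 * p))) by lia. rewrite !fact_C_S, !Cpow_S.
    rewrite (rGamma_rec (1 / 2 - INR (S p))).
    replace (1 / 2 - INR (S p) + 1) with (1 / 2 - INR p) by (rewrite INR_C_S; ring).
    transitivity (- (4 * INR p + 2) * (2 * (- (1)) ^ p * INR (fact (2 * p)) / INR (fact p))).
    + rewrite (INR_C_S (2 * p)), mult_INR, RtoC_mult. simpl (INR 2). rewrite RtoC_plus.
      field. split; [apply fact_C_neq_0|]. rewrite <- INR_C_S. apply INR_C_neq_0; lia.
    + rewrite IHp, INR_C_S. field.
Qed.

(** The left side is the limit prescribed in [chi_ratio] at [mu = - p - 1 / 2], with [j = l + 1].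
    Both sides obey [kummer_coef_rec] in [l], whose factor [2 mu + l + 1 = l - 2 p] is nonzero for
    [l < p]. *)
Lemma kummer_coef_half_int (p l : nat) : (l <= p)%nat ->
  2 * (- (1)) ^ p * INR (fact (2 * p - l)) / INR (fact (p - l)) =
  2 * 4 ^ p * sqrt PI * kummer_coef l (- INR p - 1 / 2).
Proof.
  induction l; intros Hl.
  - rewrite !Nat.sub_0_r, kummer_coef_0. replace (- INR p - 1 / 2 + 1) with (1 / 2 - INR p) by field.
    apply kummer_coef_half_int_0.
  - specialize (IHl ltac:(lia)).
    replace (2 * p - l)%nat with (S (2 * p - S l)) in IHl by lia.
    replace (p - l)%nat with (S (p - S l)) in IHl by lia.
    rewrite !fact_C_S, <- !INR_C_S in IHl.
    assert (R := kummer_coef_rec l (- INR p - 1 / 2)).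
    assert (N1 : RtoC (INR (S (2 * p - S l))) = 2 * INR p - INR l).
    { replace (S (2 * p - S l)) with (2 * p - l)%nat by lia.
      rewrite minus_INR, mult_INR, RtoC_minus, RtoC_mult by lia. simpl (INR 2). rewrite RtoC_plus. ring. }
    assert (N2 : RtoC (INR (S (p - S l))) = INR p - INR l).
    { replace (S (p - S l)) with (p - l)%nat by lia. rewrite minus_INR, RtoC_minus by lia. ring. }
    assert (D1 : RtoC (INR (S (2 * p - S l))) <> 0) by (apply INR_C_neq_0; lia).
    assert (D2 : RtoC (INR (S (p - S l))) <> 0) by (apply INR_C_neq_0; lia).
    assert (F := fact_C_neq_0 (p - S l)).
    set (u := RtoC (INR (S (2 * p - S l)))) in *. set (v := RtoC (INR (S (p - S l)))) in *.
    replace (2 * (- INR p - 1 / 2) + INR l + 1) with (- u) in R by (rewrite N1; field).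
    replace (- INR p - 1 / 2 + INR l + 1 / 2) with (- v) in R by (rewrite N2; ring).
    transitivity (v * / u * (2 * (- (1)) ^ p * (u * INR (fact (2 * p - S l))) / (v * INR (fact (p - S l))))).
    { field. auto. }
    rewrite IHl.
    transitivity (2 * 4 ^ p * sqrt PI * (- / u) * (- v * kummer_coef l (- INR p - 1 / 2))); [ring|].
    rewrite <- R. field. easy.
Qed.

Lemma powerRZ_m1_neg (p : nat) : powerRZ (-1) (- Z.of_nat p) = ((-1) ^ p)%R.
Proof.
  destruct p; [reflexivity|].
  change (- Z.of_nat (S p))%Z with (Z.neg (Pos.of_succ_nat p)). cbn [powerRZ].
  rewrite SuccNat2Pos.id_succ, <- pow_inv. f_equal. lra.
Qed.

Lemma Gamma_INR_S (n : nat) : Gamma (INR n + 1) = INR (fact n).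
Proof. unfold Gamma. rewrite rGamma_fact. field. apply fact_C_neq_0. Qed.

Lemma chi_ratio_kummer (mu : C) (l : nat) : (l < Z.to_nat (- nearest (Re mu)))%nat ->
  chi_ratio mu (S l) = Cexp (- (2 * mu) * ln 2) * sqrt PI * kummer_coef l mu.
Proof.
  intros Hl. unfold chi_ratio. destruct (Ceq_dec (fpart mu) (1 / 2)) as [E|E].
  - set (m := nearest (Re mu)) in *. cbv zeta. set (p := Z.to_nat (- m - 1)).
    assert (Hm : m = (- Z.of_nat p - 1)%Z) by lia.
    assert (Hm' : RtoC (IZR m) = - INR p - 1).
    { rewrite Hm, minus_IZR, opp_IZR, <- INR_IZR_INZ, RtoC_minus, RtoC_opp. ring. }
    assert (Hmu : mu = - INR p - 1 / 2).
    { replace mu with (fpart mu + IZR m) by (unfold fpart; fold m; ring). rewrite E, Hm'. field. }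
    assert (Hlp : (l <= p)%nat) by lia.
    replace (m + 1)%Z with (- Z.of_nat p)%Z by lia. rewrite powerRZ_m1_neg, RtoC_pow.
    replace (RtoC (-1)) with (- (1)) by (rewrite <- RtoC_opp; f_equal; ring).
    replace (- INR (S l) - 2 * IZR m) with (INR (2 * p - l) + 1).
    2:{ rewrite Hm', INR_C_S, minus_INR, mult_INR, RtoC_minus, RtoC_mult by lia. simpl (INR 2). rewrite RtoC_plus. ring. }
    replace (- INR (S l) - IZR m + 1) with (INR (p - l) + 1).
    2:{ rewrite Hm', INR_C_S, minus_INR, RtoC_minus by lia. ring. }
    rewrite !Gamma_INR_S, (kummer_coef_half_int p l Hlp), Hmu, Cexp_half_int. reflexivity.
  (* A zero would give [mu = 1 / 2 - (l + q + 1)] for some natural [q], hence the fractional part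
     [1 / 2], which is excluded in this case. *)
  - assert (N : rGamma (mu + INR l + 1 / 2) <> 0).
    { apply rGamma_neq_0. intros q Hq. apply E.
      apply (fpart_unique mu (1 / 2) (- Z.of_nat (S (l + q)))).
      - rewrite opp_IZR, <- INR_IZR_INZ, RtoC_opp, INR_C_S, plus_INR, RtoC_plus.
        replace mu with ((mu + INR l + 1 / 2 + INR q) - (INR l + 1 / 2 + INR q)) by ring. rewrite Hq. field.
      - replace (1 / 2) with (RtoC (1 / 2)) by (rewrite RtoC_div; [easy|lra]). simpl. lra. }
    assert (K := kummer_coef_gamma l mu). rewrite rGamma_half in K.
    unfold Gamma.
    replace (INR (S l) + mu - 1 / 2) with (mu + INR l + 1 / 2) by (rewrite INR_C_S; field).
    replace (INR (S l) + 2 * mu) with (2 * mu + INR l + 1) by (rewrite INR_C_S; ring).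
    set (g := rGamma (mu + INR l + 1 / 2)) in *.
    assert (X : Cexp (- (2 * mu) * ln 2) * Cexp (2 * mu * ln 2) = 1).
    { rewrite <- Cexp_plus. replace (- (2 * mu) * ln 2 + 2 * mu * ln 2) with (RtoC 0) by ring. apply Cexp_0. }
    transitivity (/ g * (Cexp (- (2 * mu) * ln 2) * Cexp (2 * mu * ln 2)) * rGamma (2 * mu + INR l + 1)).
    { rewrite X. ring. }
    transitivity (/ g * Cexp (- (2 * mu) * ln 2) * sqrt PI * (Cexp (2 * mu * ln 2) * / sqrt PI * rGamma (2 * mu + INR l + 1))).
    { field. split; [apply sqrt_PI_neq_0|easy]. }
    rewrite <- K. field. easy.
Qed.

Lemma chi_kummer (mu z : C) : z <> 0 ->
  chi mu z = Cpower (z / 2) mu * Cexp (Ci * z) *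
    psum (kummer_term mu (- (2) * (Ci * z))) (Z.to_nat (- nearest (Re mu))).
Proof.
  intros Hz. assert (B := nearest_bounds (Re mu)). unfold chi. destruct (Rle_dec (Re mu) (- (1 / 2))) as [h|h].
  - set (N := Z.to_nat (- nearest (Re mu))).
    (* On the line [Re mu = - 1 / 2] the tie goes down to [-1], so that the sum has a term there
       too. *)
    assert (HN : (0 < N)%nat).
    { assert (nearest (Re mu) < 0)%Z by (apply lt_IZR; lra). unfold N. lia. }
    assert (T : forall l, (l < N)%nat ->
      chi_ratio mu (S l) / Gamma (INR (S l)) * mipow 2 z (INR (S l) + mu - 1) =
      Cexp (- (2 * mu) * ln 2) * sqrt PI * Cexp (mu * (log_mi z + ln 2)) * kummer_term mu (- (2) * (Ci * z)) l).
    { intros l Hl. rewrite (chi_ratio_kummer mu l Hl), mipow_exp by lra.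
      replace ((INR (S l) + mu - 1) * (log_mi z + ln 2)) with (mu * (log_mi z + ln 2) + INR l * (log_mi z + ln 2))
        by (rewrite INR_C_S; ring).
      rewrite Cexp_plus, <- (Cexp_pow _ l), (Cexp_plus (log_mi z)), log_mi_exp, Cexp_ln2, INR_C_S, Gamma_INR_S by easy.
      unfold kummer_term. replace (- Ci * z * 2) with (- (2) * (Ci * z)) by ring. unfold Cdiv. ring. }
    assert (S1 : forall M, (M <= N)%nat -> (0 < M)%nat ->
      sum_n_m (fun j => chi_ratio mu j / Gamma (INR j) * mipow 2 z (INR j + mu - 1)) 1 M =
      Cexp (- (2 * mu) * ln 2) * sqrt PI * Cexp (mu * (log_mi z + ln 2)) * psum (kummer_term mu (- (2) * (Ci * z))) M).
    { induction M; intros H1 H2; [lia|]. destruct M.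
      - rewrite sum_n_n, T by lia. cbn [psum]. Cring.
      - rewrite sum_n_Sm, IHM, T by lia. cbn [psum]. change plus with Cplus. Cring. }
    rewrite (S1 N (le_n _) HN), Cpower_half by easy.
    assert (X : ipow mu * Cexp (- (2 * mu) * ln 2) * Cexp (mu * (log_mi z + ln 2)) = Cpower z mu * Cexp (- mu * ln 2)).
    { unfold ipow, Cpower, log_mi. rewrite <- !Cexp_plus. f_equal. field. }
    rewrite <- X. field. apply sqrt_PI_neq_0.
  - replace (Z.to_nat (- nearest (Re mu))) with 0%nat; [simpl; ring|].
    assert (-1 < nearest (Re mu))%Z by (apply lt_IZR; lra). lia.
Qed.

Lemma BesselJ_B_chi (mu z : C) : z <> 0 -> BesselJ mu z = B mu z + chi mu z.
Proof.
  intros Hz. rewrite BesselJ_kummer, B_kummer, chi_kummer by easy. ring.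
Qed.

(** * Behaviour at the integers *)

(** At a zero [exp (i nu PI)] and [exp (- i nu PI)] agree; equality of their moduli gives
    [Im nu = 0], and the zeros of the real sine are known. *)
Lemma Csin_PI_neq_0 (nu : C) : fpart nu <> 0 -> Csin (nu * PI) <> 0.
Proof.
  intros H E. apply H. assert (P := PI_RGT_0).
  set (w := nu * PI) in *.
  assert (E1 : Cexp (Ci * w) = Cexp (- (Ci * w))).
  { unfold Csin in E. replace (Cexp (Ci * w)) with
      ((Cexp (Ci * w) - Cexp (- (Ci * w))) / (2 * Ci) * (2 * Ci) + Cexp (- (Ci * w))) by (field; apply Ci_nz).
    rewrite E. ring. }
  assert (E2 := f_equal Cmod E1). rewrite !Cmod_Cexp in E2. apply exp_inv in E2.
  assert (I : Im nu = 0%R).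
  { unfold w, Re, Im in *. simpl in E2. nra. }
  assert (Enu : nu = RtoC (Re nu)) by (apply C_ext; [easy|exact I]).
  assert (S0 : sin (Re nu * PI) = 0%R).
  { assert (Q : Cexp (Ci * w) = (cos (Re nu * PI), sin (Re nu * PI))).
    { unfold w, Cexp. rewrite Enu. unfold Re, Im. simpl.
      replace (0 * (fst nu * PI - 0 * 0) - 1 * (fst nu * 0 + 0 * PI))%R with 0%R by ring.
      replace (0 * (fst nu * 0 + 0 * PI) + 1 * (fst nu * PI - 0 * 0))%R with (fst nu * PI)%R by ring.
      rewrite exp_0. apply C_ext; simpl; ring. }
    assert (Q' : Cexp (- (Ci * w)) = (cos (Re nu * PI), (- sin (Re nu * PI))%R)).
    { unfold w, Cexp. rewrite Enu. unfold Re, Im. simpl.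
      replace (- (0 * (fst nu * PI - 0 * 0) - 1 * (fst nu * 0 + 0 * PI)))%R with 0%R by ring.
      replace (- (0 * (fst nu * 0 + 0 * PI) + 1 * (fst nu * PI - 0 * 0)))%R with (- (fst nu * PI))%R by ring.
      rewrite exp_0, cos_neg, sin_neg. apply C_ext; simpl; ring. }
    rewrite Q, Q' in E1. injection E1. lra. }
  destruct (sin_eq_0_0 _ S0) as [k Hk].
  assert (Hk' : Re nu = IZR k) by (apply Rmult_eq_reg_r with PI; lra).
  apply (fpart_unique nu 0 k); [|simpl; lra].
  rewrite Enu, Hk'. ring.
Qed.

Lemma Cexp_Ci_PI : Cexp (Ci * PI) = - (1).
Proof.
  replace (Ci * PI) with ((0%R, PI) : C) by (apply C_ext; simpl; ring).
  unfold Cexp. simpl. rewrite exp_0, cos_PI, sin_PI. apply C_ext; simpl; ring.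
Qed.

Lemma Cexp_Ci_int_PI (n : Z) : Cexp (Ci * IZR n * PI) * Cexp (Ci * IZR n * PI) = 1.
Proof.
  assert (A : forall p : nat, Cexp (Ci * INR p * PI) * Cexp (Ci * INR p * PI) = 1).
  { intros p. replace (Ci * INR p * PI) with (INR p * (Ci * PI)) by ring.
    rewrite <- Cexp_pow, Cexp_Ci_PI, <- Cpow_mult_l.
    replace (- (1) * - (1)) with (RtoC 1) by ring. apply Cpow_1_l. }
  destruct (Z.le_gt_cases 0 n) as [h|h].
  - specialize (A (Z.to_nat n)). now rewrite INR_IZR_INZ, Z2Nat.id in A.
  - specialize (A (Z.to_nat (- n))). rewrite INR_IZR_INZ, Z2Nat.id, opp_IZR, RtoC_opp in A by lia.
    replace (Ci * - IZR n * PI) with (- (Ci * IZR n * PI)) in A by ring. rewrite Cexp_opp in A.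
    set (x := Cexp (Ci * IZR n * PI)) in *. assert (Hx : x <> 0) by apply Cexp_neq_0.
    transitivity (x * x * (/ x * / x)); [rewrite A; ring|field; easy].
Qed.

Lemma Csin_shift (n : Z) (e : C) : Csin ((IZR n + e) * PI) = Cexp (Ci * IZR n * PI) * Csin (e * PI).
Proof.
  unfold Csin. replace (Ci * ((IZR n + e) * PI)) with (Ci * IZR n * PI + Ci * (e * PI)) by ring.
  replace (- (Ci * IZR n * PI + Ci * (e * PI))) with (- (Ci * IZR n * PI) + - (Ci * (e * PI))) by ring.
  rewrite !Cexp_plus, (Cexp_opp (Ci * IZR n * PI)).
  assert (A := Cexp_Ci_int_PI n). set (x := Cexp (Ci * IZR n * PI)) in *.
  assert (Hx : x <> 0) by apply Cexp_neq_0.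
  replace (/ x) with x; [field; apply Ci_nz|].
  transitivity (x * x * / x); [field; easy|rewrite A; ring].
Qed.

(** The limit is the derivative [PI cos (n PI)], in the exponential form that [Csin_shift]
    provides. *)
Lemma Csin_slope (n : Z) :
  tends (locally' (RtoC 0)) (fun e => Csin ((IZR n + e) * PI) / e) (Cexp (Ci * IZR n * PI) * PI).
Proof.
  assert (K : forall w, (Cmod (Csin w - w) <= Cmod w ^ 2 * exp (Cmod w))%R).
  { intros w. assert (K1 := Cexp_minus_2_le (Ci * w)). assert (K2 := Cexp_minus_2_le (- (Ci * w))).
    rewrite ?Cmod_opp, Cmod_mult, Cmod_Ci, Rmult_1_l in K1. rewrite Cmod_opp, Cmod_mult, Cmod_Ci, Rmult_1_l in K2.
    unfold Csin.
    replace ((Cexp (Ci * w) - Cexp (- (Ci * w))) / (2 * Ci) - w) with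
      (((Cexp (Ci * w) - 1 - Ci * w) - (Cexp (- (Ci * w)) - 1 - - (Ci * w))) * / (2 * Ci)) by (field; apply Ci_nz).
    rewrite Cmod_mult, Cmod_inv, Cmod_mult, Cmod_Ci, Cmod_R, Rabs_pos_eq by (try apply Ci_2_neq_0; lra).
    assert (T := Cmod_triangle_minus (Cexp (Ci * w) - 1 - Ci * w) (Cexp (- (Ci * w)) - 1 - - (Ci * w))).
    assert (E := exp_pos (Cmod w)). assert (Q := Cmod_ge_0 w).
    assert (0 <= Cmod w ^ 2 * exp (Cmod w))%R by (apply Rmult_le_pos; nra). lra. }
  assert (P := PI_RGT_0).
  apply tends_ext with (f := fun e => Cexp (Ci * IZR n * PI) * (Csin (e * PI) / e)); [apply _| |].
  { apply filter_forall. intros e. rewrite Csin_shift. unfold Cdiv. ring. }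
  apply tends_mult; [apply _|apply tends_const, _|].
  intros eps He. apply locally'_Cmod. set (M := (PI ^ 2 * exp PI)%R).
  assert (HM : (0 < M)%R) by (apply Rmult_lt_0_compat; [apply pow_lt; easy|apply exp_pos]).
  exists (Rmin 1 (eps / M)). split; [apply Rmin_pos; [lra|now apply Rdiv_lt_0_compat]|].
  intros e Hx Hne. rewrite Cminus_0_r in Hx.
  assert (H1 := Rmin_l 1 (eps / M)). assert (H2 := Rmin_r 1 (eps / M)).
  assert (H3 : (0 < Cmod e)%R) by now apply Cmod_gt_0.
  replace (Csin (e * PI) / e - PI) with ((Csin (e * PI) - e * PI) * / e) by (field; easy).
  specialize (K (e * PI)). rewrite !Cmod_mult, Cmod_R, Rabs_pos_eq in K by lra.
  rewrite Cmod_mult, Cmod_inv by easy.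
  apply Rle_lt_trans with (M * Cmod e)%R.
  - apply Rmult_le_reg_r with (Cmod e); [easy|]. rewrite Rmult_assoc, Rinv_l by lra. rewrite Rmult_1_r.
    eapply Rle_trans; [exact K|]. unfold M.
    replace (PI ^ 2 * exp PI * Cmod e * Cmod e)%R with ((Cmod e * PI) ^ 2 * exp PI)%R by ring.
    apply Rmult_le_compat_l; [apply pow2_ge_0|]. apply exp_mono. nra.
  - apply Rlt_le_trans with (M * (eps / M))%R; [apply Rmult_lt_compat_l; lra|]. right. field. lra.
Qed.

Lemma tends_translate (f : C -> C) (a l : C) :
  tends (locally' (RtoC 0)) (fun e => f (a + e)) l -> tends (locally' a) f l.
Proof.
  intros H eps He. specialize (H eps He).
  destruct (locally_of_Cmod _ _ H) as [d [Hd K]]. apply locally'_Cmod. exists d. split; [easy|].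
  intros x Hx Hne. specialize (K (x - a)). rewrite Cminus_0_r in K. specialize (K Hx).
  replace (a + (x - a)) with x in K by ring. apply K. now apply Cminus_eq_contra.
Qed.

Lemma Cplus_minus_cancel (a x : C) : a + (x - a) = x.
Proof. ring. Qed.

Lemma opp_IZR_plus_minus (n : Z) (x : C) : IZR (- n) + - (x - IZR n) = - x.
Proof. rewrite opp_IZR, RtoC_opp. ring. Qed.

Lemma jet_over_sin (f : C -> C) (N : R) (n : Z) : jet f N -> f 0 = 0 ->
  exists l, tends (locally' (RtoC (IZR n))) (fun nu => f (nu - IZR n) / Csin (nu * PI)) l.
Proof.
  intros J H0.
  assert (NZ : Cexp (Ci * IZR n * PI) * PI <> 0).
  { apply Cmult_neq_0; [apply Cexp_neq_0|]. apply RtoC_neq_0, Rgt_not_eq, PI_RGT_0. }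
  exists (jet_der J / (Cexp (Ci * IZR n * PI) * PI)).
  apply tends_translate.
  eapply tends_ext; [apply _| |exact (tends_div _ _ _ _ _ NZ (jet_slope f N J H0) (Csin_slope n))].
  apply locally'_Cmod. exists 1%R. split; [lra|]. intros e _ He.
  replace (IZR n + e - IZR n) with e by ring.
  destruct (Ceq_dec (Csin ((IZR n + e) * PI)) 0) as [E|E].
  (* A zero of the sine makes both sides [0], by [/ 0 = 0]. *)
  - unfold Cdiv. rewrite E. replace (0 * / e) with (RtoC 0) by ring.
    assert (Z : / RtoC 0 = 0) by (apply C_ext; simpl; unfold Rdiv; ring). rewrite Z. ring.
  - field. split; easy.
Qed.

(** The common shape of the Hankel quotient and of the [chi] quotient near [n]: [f] is the expansion
    at [n] and [g] the one at [- n], whence the reflected argument. The equation at [0] makes the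
    numerator vanish at [n]. *)
Lemma reflected_quot_lim (f g : C -> C) (n : Z) (N M : R) : jet f N -> jet g M ->
  Cexp (Ci * IZR n * PI) * f 0 = g 0 ->
  exists l, tends (locally' (RtoC (IZR n)))
    (fun nu => (Cexp (Ci * nu * PI) * f (nu - IZR n) - g (- (nu - IZR n))) / Csin (nu * PI)) l.
Proof.
  intros J1 J2 H0.
  assert (J3 : jet (fun e => Cexp (Ci * IZR n * PI) * Cexp (Ci * PI * e)) _)
    by exact (jet_mult _ _ _ _ (jet_const _) (jet_Cexp _)).
  assert (J := jet_plus _ _ _ _ (jet_mult _ _ _ _ J3 J1) (jet_mult _ _ _ _ (jet_const (- (1))) (jet_opp_arg _ _ J2))).
  cbv beta in J. destruct (jet_over_sin _ _ n J) as [l Hl].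
  { replace (- RtoC 0) with (RtoC 0) by ring. rewrite Cmult_0_r, Cexp_0, <- H0. ring. }
  exists l. eapply tends_ext_all; [apply _| |exact Hl]. intros nu. cbv beta.
  rewrite <- Cexp_plus. replace (Ci * IZR n * PI + Ci * PI * (nu - IZR n)) with (Ci * nu * PI) by Cring.
  unfold Cdiv. Cring.
Qed.

Lemma jet_Cpower (w : C) (a : C) : {N : R & jet (fun e => Cpower w (a + e)) N}.
Proof.
  eexists. apply (jet_ext (fun e => Cexp (a * Cln w) * Cexp (Cln w * e))).
  - intros e _. unfold Cpower. rewrite <- Cexp_plus. f_equal. ring.
  - apply jet_mult; [apply jet_const|apply jet_Cexp].
Qed.

Lemma IZR_C_parts (n : Z) : RtoC (IZR n) = INR (Z.to_nat n) - INR (Z.to_nat (- n)).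
Proof.
  rewrite <- RtoC_minus. f_equal. rewrite !INR_IZR_INZ, <- minus_IZR. f_equal. lia.
Qed.

(** With [m] and [p] the positive and negative parts of [n], the argument of [rGamma] near [n] is
    [1 + (m + k) - p + e]. The sizes of these expansions grow like [4^k], against the factor
    [1 / k!]. *)
Lemma jet_BesselJ (n : Z) (z : C) : {N : R & jet (fun e => BesselJ (IZR n + e) z) N}.
Proof.
  destruct jet_rGamma_int as [N0 J0]. destruct (jet_Cpower (z / 2) (IZR n)) as [N1 J1].
  set (m := Z.to_nat n). set (p := Z.to_nat (- n)).
  set (t := fun (e : C) (k : nat) => (- (1)) ^ k * (z / 2) ^ (2 * k) / INR (fact k) * rGamma (IZR n + e + INR k + 1)).
  assert (J : forall k, jet (fun e => t e k)
     (Cmod ((- (1)) ^ k * (z / 2) ^ (2 * k) / INR (fact k)) * (N0 * INR (fact (S p)) * 4 ^ (m + k)))).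
  { intros k. apply jet_mult; [apply jet_const|].
    apply (jet_ext (fun e => rGamma (1 + INR (m + k) - INR p + e))); [|apply J0].
    intros e _. f_equal. rewrite plus_INR, RtoC_plus, (IZR_C_parts n). fold m p. ring. }
  eexists. unfold BesselJ. apply jet_mult; [exact J1|].
  apply (jet_series (fun k e => t e k) _ _ J).
  - apply (ex_series_ext (fun k => (N0 * INR (fact (S p)) * 4 ^ m) * ((Cmod (z / 2) ^ 2 * 4) ^ k / INR (fact k)))%R);
      [|apply ex_series_scal_R, ex_series_exp].
    intros k. unfold Cdiv at 2. rewrite !Cmod_mult, Cmod_inv, !Cmod_pow, Cmod_R, Rabs_pos_eq
      by (try apply fact_C_neq_0; apply pos_INR).
    rewrite Cmod_m1, pow1, Rpow_mult_distr, pow_mult, pow_add.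
    match goal with |- ?x = ?y => change (@eq R x y) end. field. apply INR_fact_neq_0.
  - intros e _. assert (K := kummer_formula (IZR n + e) z). now rewrite (is_series_CSeries _ _ K).
Qed.

(** For the order [- p] the first [p] terms vanish, and the others are those of the order [p],
    shifted; the factor [exp (i p PI)] is the sign [(-1)^p]. *)
Lemma BesselJ_neg_nat (p : nat) (z : C) : z <> 0 ->
  BesselJ (- INR p) z = Cexp (Ci * INR p * PI) * BesselJ (INR p) z.
Proof.
  intros Hz. unfold BesselJ.
  assert (Hz2 : z / 2 <> 0).
  { intros E. apply Hz. replace z with (z / 2 * 2) by field. rewrite E. ring. }
  set (t := fun (mu : C) (k : nat) => (- (1)) ^ k * (z / 2) ^ (2 * k) / INR (fact k) * rGamma (mu + INR k + 1)).
  assert (K := kummer_formula (INR p) z). rewrite (is_series_CSeries _ _ K).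
  set (S := Cexp (Ci * z) * CSeries (kummer_term (INR p) (- (2) * (Ci * z)))) in *.
  assert (K2 : is_series (t (- INR p)) ((- (1)) ^ p * (z / 2) ^ (2 * p) * S)).
  { apply (is_series_shift_head _ _ p).
    - intros k Hk. unfold t. replace (- INR p + INR k + 1) with (RtoC (IZR (Z.of_nat k + 1 - Z.of_nat p))).
      + rewrite rGamma_neg_Z by lia. ring.
      + rewrite minus_IZR, plus_IZR, <- !INR_IZR_INZ, RtoC_minus, RtoC_plus. ring.
    - eapply is_series_ext; [|apply (is_series_scal_C ((- (1)) ^ p * (z / 2) ^ (2 * p)) _ _ K)].
      intros l. unfold t. replace (- INR p + INR (p + l) + 1) with (INR l + 1) by (rewrite plus_INR, RtoC_plus; ring).
      replace (INR p + INR l + 1) with (INR (p + l) + 1) by (rewrite plus_INR, RtoC_plus; ring).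
      rewrite !rGamma_fact. replace (2 * (p + l))%nat with (2 * p + 2 * l)%nat by lia.
      rewrite !Cpow_add_r. match goal with |- ?x = ?y => change (@eq C x y) end.
      field. split; apply fact_C_neq_0. }
  apply is_series_CSeries in K2. unfold t in K2. rewrite K2.
  replace (Ci * INR p * PI) with (INR p * (Ci * PI)) by ring. rewrite <- Cexp_pow, Cexp_Ci_PI.
  assert (X : Cpower (z / 2) (- INR p) * (z / 2) ^ (2 * p) = Cpower (z / 2) (INR p)).
  { unfold Cpower. rewrite <- (Cln_exp (z / 2)) at 2 by easy. rewrite Cexp_pow, <- Cexp_plus. f_equal.
    rewrite mult_INR, RtoC_mult. simpl (INR 2). rewrite RtoC_plus. ring. }
  rewrite <- X. ring.
Qed.

Lemma BesselJ_neg_int (n : Z) (z : C) : z <> 0 ->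
  Cexp (Ci * IZR n * PI) * BesselJ (IZR n) z - BesselJ (- IZR n) z = 0.
Proof.
  intros Hz. destruct (Z.le_gt_cases 0 n) as [h|h].
  - assert (K := BesselJ_neg_nat (Z.to_nat n) z Hz). rewrite INR_IZR_INZ, Z2Nat.id in K by easy.
    rewrite K. ring.
  - assert (K := BesselJ_neg_nat (Z.to_nat (- n)) z Hz).
    rewrite INR_IZR_INZ, Z2Nat.id, opp_IZR, RtoC_opp in K by lia.
    replace (- - IZR n) with (RtoC (IZR n)) in K by ring. rewrite K.
    replace (Ci * - IZR n * PI) with (- (Ci * IZR n * PI)) by ring. rewrite Cexp_opp.
    field. apply Cexp_neq_0.
Qed.

Definition hankel_quot (z nu : C) : C :=
  (Cexp (Ci * nu * PI) * BesselJ nu z - BesselJ (- nu) z) / Csin (nu * PI).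

Lemma hankel_quot_lim (n : Z) (z : C) : z <> 0 -> exists l, tends (locally' (RtoC (IZR n))) (hankel_quot z) l.
Proof.
  intros Hz. destruct (jet_BesselJ n z) as [N1 J1]. destruct (jet_BesselJ (- n) z) as [N2 J2].
  destruct (reflected_quot_lim _ _ n _ _ J1 J2) as [l Hl].
  { rewrite !Cplus_0_r, opp_IZR, RtoC_opp. apply Ceq_minus. now apply BesselJ_neg_int. }
  exists l. eapply tends_ext_all; [apply _| |exact Hl]. intros nu. cbv beta.
  now rewrite Cplus_minus_cancel, opp_IZR_plus_minus.
Qed.

(** At [mu = - p] the coefficient contains [rGamma] at [div2 l + 1 - p <= 0]. This is why every term
    of [chi] vanishes at a negative integer. *)
Lemma jet_kummer_coef (p l : nat) : (l < p)%nat ->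
  {N : R & jet (fun e => kummer_coef l (- INR p + e)) N} * (kummer_coef l (- INR p + 0) = 0).
Proof.
  intros Hl. assert (Hq : (Nat.div2 l < p)%nat).
  { destruct l; [simpl; lia|]. apply Nat.lt_trans with (S l); [apply Nat.lt_div2; lia|easy]. }
  split.
  - destruct jet_rGamma_int as [N0 J0].
    assert (JC : forall (a : C) q, {N : R & jet (fun e => Crising (a + e) q) N}).
    { intros a. induction q as [|q [N IH]]; [eexists; exact (jet_const 1)|].
      eexists. cbn [Crising]. apply jet_mult; [exact IH|].
      apply (jet_ext (fun e => (a + INR q) + 1 * e)); [intros; ring|apply jet_affine]. }
    destruct (JC (- INR p + INR (Nat.div2 (S l)) + 1 / 2) (Nat.div2 l)) as [N1 J1].
    eexists. unfold kummer_coef. apply jet_mult; [apply jet_mult; [apply jet_const|]|].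
    + eapply jet_ext; [|exact J1]. intros e _. cbv beta. f_equal. ring.
    + eapply jet_ext; [|exact (J0 p (Nat.div2 l))]. intros e _. cbv beta. f_equal. ring.
  - unfold kummer_coef. replace (- INR p + 0 + INR (Nat.div2 l) + 1) with (RtoC (IZR (Z.of_nat (Nat.div2 l) + 1 - Z.of_nat p))).
    + rewrite (rGamma_neg_Z (Z.of_nat (Nat.div2 l) + 1 - Z.of_nat p)) by lia. ring.
    + rewrite minus_IZR, plus_IZR, <- !INR_IZR_INZ, RtoC_minus, RtoC_plus. ring.
Qed.

(* [chi] near the integer [n], with the number of terms frozen. *)
Definition chi_local (n : Z) (z e : C) : C :=
  Cpower (z / 2) (IZR n + e) * Cexp (Ci * z) *
    psum (kummer_term (IZR n + e) (- (2) * (Ci * z))) (Z.to_nat (- n)).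

Lemma chi_near_int (n : Z) (z e : C) : z <> 0 -> (Cmod e < 1 / 2)%R ->
  chi (IZR n + e) z = chi_local n z e.
Proof.
  intros Hz He. rewrite chi_kummer by easy. unfold chi_local.
  replace (nearest (Re (IZR n + e))) with n; [easy|]. symmetry. apply nearest_unique.
  assert (Q := re_le_Cmod e). apply Rabs_le_between in Q. unfold Re in *. simpl. lra.
Qed.

Lemma jet_chi_local (n : Z) (z : C) :
  {N : R & jet (chi_local n z) N} * (chi_local n z 0 = 0).
Proof.
  set (x := - (2) * (Ci * z)). set (p := Z.to_nat (- n)).
  assert (P : forall M, (M <= p)%nat -> {N : R & jet (fun e => psum (kummer_term (IZR n + e) x) M) N}
     * (psum (kummer_term (IZR n + 0) x) M = 0)).
  { induction M; intros HM; [split; [eexists; exact (jet_const 0)|easy]|].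
    destruct (IHM ltac:(lia)) as [[N1 J1] Z1]. destruct (jet_kummer_coef p M ltac:(lia)) as [[N2 J2] Z2].
    assert (En : RtoC (IZR n) = - INR p).
    { rewrite (IZR_C_parts n). fold p. replace (Z.to_nat n) with 0%nat by lia. simpl. ring. }
    split.
    - eexists. cbn [psum]. apply jet_plus; [exact J1|]. unfold kummer_term at 1.
      apply jet_mult; [apply jet_const|]. rewrite En. exact J2.
    - cbn [psum]. rewrite Z1. unfold kummer_term at 1. rewrite En, Z2. ring. }
  destruct (P p (le_n _)) as [[N J] Z0]. split.
  - destruct (jet_Cpower (z / 2) (IZR n)) as [N1 J1]. eexists. unfold chi_local.
    apply jet_mult; [apply jet_mult; [exact J1|apply jet_const]|exact J].
  - unfold chi_local. fold x p. rewrite Z0. ring.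
Qed.

Lemma chi_Re_0 (mu z : C) : (- (1 / 2) < Re mu)%R -> chi mu z = 0.
Proof.
  intros H. unfold chi. destruct (Rle_dec (Re mu) (- (1 / 2))); [lra|easy].
Qed.

(** On the imaginary axis [sign] yields the index [0], and all three values of [chi] vanish. *)
Lemma T_plus_chi (nu z : C) :
  T_plus nu * chi (- nu * sign (Re nu)) z = Cexp (Ci * nu * PI) * chi nu z - chi (- nu) z.
Proof.
  assert (HR : Re (- nu) = (- Re nu)%R) by reflexivity.
  unfold T_plus. destruct (Rlt_dec (Re nu) 0) as [h|h].
  - rewrite sign_eq_m1 by easy. replace (- nu * -1) with nu by (apply C_ext; unfold Re, Im; simpl; ring).
    rewrite (chi_Re_0 (- nu)) by lra. ring.
  - destruct (Rle_lt_or_eq_dec 0 (Re nu)) as [h'|h']; [lra| |].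
    + rewrite sign_eq_1 by easy. rewrite Cmult_1_r, (chi_Re_0 nu) by lra. ring.
    + rewrite <- h', sign_0, Cmult_0_r, !chi_Re_0 by (try (simpl; lra); lra). ring.
Qed.

(** [T_plus] and [sign] jump across the imaginary axis; in the form given by [T_plus_chi] one
    expansion covers both sides of it. *)
Lemma chi_quot_lim (n : Z) (z : C) : z <> 0 -> exists l, tends (locally' (RtoC (IZR n))) (chi_quot z) l.
Proof.
  intros Hz. destruct (jet_chi_local n z) as [[N1 J1] Z1]. destruct (jet_chi_local (- n) z) as [[N2 J2] Z2].
  destruct (reflected_quot_lim _ _ n _ _ J1 J2) as [l Hl]; [rewrite Z1, Z2; ring|].
  exists l. eapply tends_ext; [apply _| |exact Hl].
  apply locally'_Cmod. exists (1 / 2)%R. split; [lra|]. intros nu Hnu _. unfold chi_quot, Cdiv.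
  assert (E1 := chi_near_int n z (nu - IZR n) Hz Hnu).
  assert (E2 := chi_near_int (- n) z (- (nu - IZR n)) Hz ltac:(now rewrite Cmod_opp)).
  rewrite Cplus_minus_cancel in E1. rewrite opp_IZR_plus_minus in E2.
  now rewrite Cmult_assoc, T_plus_chi, <- E1, <- E2.
Qed.

(** * The Hankel function and its decomposition *)

Lemma Cexp_cos_sin (w : C) : Cexp (Ci * w) = Ccos w + Ci * Csin w.
Proof. unfold Ccos, Csin. field. apply Ci_nz. Qed.

Lemma hankel_quot_split (z nu : C) : z <> 0 -> hankel_quot z nu = calH2_quot z nu + chi_quot z nu.
Proof.
  intros Hz. unfold chi_quot, calH2_quot, hankel_quot, Cdiv. rewrite Cmult_assoc, T_plus_chi.
  rewrite !BesselJ_B_chi by easy. ring.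
Qed.

Lemma hankel_quot_BesselY (z nu : C) : fpart nu <> 0 ->
  hankel_quot z nu = Ci * BesselJ nu z +
    (BesselJ nu z * Ccos (nu * PI) - BesselJ (- nu) z) / Csin (nu * PI).
Proof.
  intros H. assert (S := Csin_PI_neq_0 nu H). unfold hankel_quot.
  replace (Ci * nu * PI) with (Ci * (nu * PI)) by ring. rewrite Cexp_cos_sin. field. easy.
Qed.

Lemma fpart_near_int (n : Z) (nu : C) : (Cmod (nu - IZR n) < 1 / 2)%R ->
  fpart nu = nu - IZR n.
Proof.
  intros H. apply (fpart_unique nu (nu - IZR n) n); [ring|].
  assert (Q := re_le_Cmod (nu - IZR n)). apply Rabs_le_between in Q. lra.
Qed.

Lemma BesselJ_continuous_int (n : Z) (z : C) :
  tends (locally' (RtoC (IZR n))) (fun nu => BesselJ nu z) (BesselJ (IZR n) z).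
Proof.
  destruct (jet_BesselJ n z) as [N J]. apply tends_translate.
  intros eps He. assert (K := jet_tends _ _ J eps He). cbv beta in K. rewrite Cplus_0_r in K.
  exact (filter_le_within _ _ K).
Qed.

(** At an integer the limit that defines [Y] differs from that of [hankel_quot] by [i J], which is
    continuous in the order; then [i H = i J + Y] restores the limit of [hankel_quot]. *)
Lemma HankelH2_eq (mu z : C) : z <> 0 ->
  (fpart mu <> 0 -> Ci * HankelH2 mu z = hankel_quot z mu) /\
  (forall n l, mu = IZR n -> tends (locally' mu) (hankel_quot z) l -> Ci * HankelH2 mu z = l).
Proof.
  intros Hz. unfold HankelH2, BesselY, int_ext. split.
  - intros H. destruct (Ceq_dec (fpart mu) 0) as [E|E]; [easy|].
    rewrite hankel_quot_BesselY by easy.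
    set (Y := (BesselJ mu z * Ccos (mu * PI) - BesselJ (- mu) z) / Csin (mu * PI)).
    transitivity (Ci * BesselJ mu z - Ci * Ci * Y); [ring|]. rewrite Ci_sq. ring.
  - intros n l -> Hl.
    assert (F : fpart (IZR n) = 0).
    { rewrite (fpart_near_int n); [ring|]. replace (IZR n - IZR n) with (RtoC 0) by ring. rewrite Cmod_0. lra. }
    destruct (Ceq_dec (fpart (IZR n)) 0) as [E|E]; [|easy].
    assert (Y : tends (locally' (RtoC (IZR n)))
       (fun nu => (BesselJ nu z * Ccos (nu * PI) - BesselJ (- nu) z) / Csin (nu * PI))
       (l - Ci * BesselJ (IZR n) z)).
    { eapply tends_ext; [apply _| |apply tends_minus; [apply _|exact Hl|
        apply tends_mult; [apply _|apply (tends_const _ Ci)|apply BesselJ_continuous_int]]].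
      apply locally'_Cmod. exists (1 / 2)%R. split; [lra|]. intros nu Hnu Hne. cbv beta.
      rewrite hankel_quot_BesselY; [ring|]. rewrite (fpart_near_int n) by easy. now apply Cminus_eq_contra. }
    rewrite (is_C_lim_unique _ _ (l - Ci * BesselJ (IZR n) z)).
    + transitivity (Ci * BesselJ (IZR n) z - (Ci * Ci) * (l - Ci * BesselJ (IZR n) z)); [ring|].
      rewrite Ci_sq. ring.
    + apply tends_filterlim; [apply _|exact Y].
Qed.

Lemma Cinv_0 : / RtoC 0 = 0.
Proof. apply C_ext; simpl; unfold Rdiv; ring. Qed.

Lemma Cinv_mult_any (a b : C) : / (a * b) = / a * / b.
Proof.
  destruct (Ceq_dec a 0) as [->|Ha]; [rewrite Cmult_0_l, Cinv_0; ring|].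
  destruct (Ceq_dec b 0) as [->|Hb]; [rewrite Cmult_0_r, Cinv_0; ring|].
  field. easy.
Qed.

Lemma Ccos_opp (w : C) : Ccos (- w) = Ccos w.
Proof.
  unfold Ccos. replace (Ci * - w) with (- (Ci * w)) by ring.
  replace (- - (Ci * w)) with (Ci * w) by ring. unfold Cdiv. ring.
Qed.

(** The condition excludes the case in which [fpart (- nu)] is [1 - fpart nu] instead of
    [- fpart nu]. It also keeps both exponents above [- 1 / 2], so that the two integrals converge
    separately and may be joined. *)
Lemma calH2_integral_eq (z nu : C) : Re (fpart nu) <> (1 / 2)%R ->
  calH2_integral z nu = calH2_quot z nu.
Proof.
  intros H. assert (Hb := fpart_bounds nu). set (a := fpart nu) in *.
  assert (Hna : Re (- a) = (- Re a)%R) by reflexivity.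
  assert (Fn : fpart (- nu) = - a).
  { apply (fpart_unique (- nu) (- a) (- nearest (Re nu))); [|lra].
    unfold a, fpart. rewrite opp_IZR, RtoC_opp. ring. }
  destruct (Pgamma_imp_int a nu z ltac:(lra)) as [L1 [_ H1]].
  destruct (Pgamma_imp_int (- a) nu z ltac:(lra)) as [L2 [_ H2]].
  set (I1 := Cexp (a * log_mi z) * Cexp (Ci * z) * L1) in *.
  set (I2 := Cexp (- a * log_mi z) * Cexp (Ci * z) * L2) in *.
  assert (B1 : B nu z = ipow nu / PI * I1).
  { unfold B. fold a. now rewrite (imp_int_CInt_0_PI _ _ H1). }
  assert (B2 : B (- nu) z = ipow (- nu) / PI * I2).
  { unfold B. rewrite Fn. f_equal. apply imp_int_CInt_0_PI. eapply imp_int_ext; [|exact H2].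
    intros t _. cbv beta. replace (- nu * t) with (- (nu * t)) by ring. now rewrite Ccos_opp. }
  assert (B3 := imp_int_plus _ _ _ _ (imp_int_scal _ (Cexp (Ci * nu * PI)) _ H1)
     (imp_int_scal _ (- Cexp (- Ci * nu * PI)) _ H2)).
  unfold calH2_integral, calH2_quot. fold a.
  rewrite (imp_int_CInt_0_PI _ (Cexp (Ci * nu * PI) * I1 + - Cexp (- Ci * nu * PI) * I2)).
  2:{ eapply imp_int_ext; [|exact B3]. intros t _. cbv beta. ring. }
  rewrite B1, B2.
  assert (X : ipow nu * Cexp (- Ci * nu * PI) = ipow (- nu)).
  { unfold ipow. rewrite <- Cexp_plus. f_equal. field. }
  (* The sine may be zero here; the inverse of the product is split by a rule that includes
     [/ 0 = 0]. *)
  rewrite <- X. unfold Cdiv. rewrite Cinv_mult_any. ring.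
Qed.

(** The two terms have limits at the integers separately, which gives the values of [int_ext] there
    their meaning. The last conjunct is the form with a single integral, for the [mu] at which both
    of its parts converge and [fpart (- mu) = - fpart mu]. *)
Theorem mainTheorem6 :
  forall mu z : C, ~ (Im z = 0%R /\ (Re z <= 0)%R) ->
    ex_int_ext (calH2_quot z) mu /\
    ex_int_ext (chi_quot z) mu /\
    Ci * HankelH2 mu z = calH2 mu z + int_ext (chi_quot z) mu /\
    (Re (fpart mu) <> (1 / 2)%R ->
      ex_int_ext (calH2_integral z) mu /\
      calH2 mu z = int_ext (calH2_integral z) mu).
Proof.
  intros mu z Hslit.
  assert (Hz : z <> 0).
  { intros ->. apply Hslit. simpl. split; [easy|lra]. }
  unfold ex_int_ext, calH2, int_ext.
  destruct (Ceq_dec (fpart mu) 0) as [E|E].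
  - set (n := nearest (Re mu)).
    assert (Hmu : mu = IZR n).
    { replace mu with (fpart mu + IZR n) by (unfold fpart; fold n; ring). rewrite E. ring. }
    clearbody n. subst mu. rename E into E0.
    destruct (hankel_quot_lim n z Hz) as [lh Hh]. destruct (chi_quot_lim n z Hz) as [lc Hc].
    assert (HB : tends (locally' (RtoC (IZR n))) (calH2_quot z) (lh - lc)).
    { eapply tends_ext; [apply _| |apply tends_minus; [apply _|exact Hh|exact Hc]].
      apply filter_forall. intros nu. cbv beta. rewrite hankel_quot_split by easy. ring. }
    (* Within distance [1 / 2] of [n] the fractional part is [nu - n], with real part below [1 / 2],
       so that the two forms of the integral term agree there. *)
    assert (HI : tends (locally' (RtoC (IZR n))) (calH2_integral z) (lh - lc)).
    { eapply tends_ext; [apply _| |exact HB].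
      apply locally'_Cmod. exists (1 / 2)%R. split; [lra|]. intros nu Hnu _. symmetry.
      apply calH2_integral_eq. rewrite (fpart_near_int n) by easy.
      assert (Q := re_le_Cmod (nu - IZR n)). apply Rabs_le_between in Q. lra. }
    apply tends_filterlim in HB; [|apply _]. apply tends_filterlim in HI; [|apply _].
    assert (Hc' := Hc). apply tends_filterlim in Hc'; [|apply _].
    rewrite (is_C_lim_unique _ _ _ HB), (is_C_lim_unique _ _ _ HI), (is_C_lim_unique _ _ _ Hc').
    rewrite (proj2 (HankelH2_eq (IZR n) z Hz) n lh eq_refl Hh).
    split; [now exists (lh - lc)|]. split; [now exists lc|]. split; [ring|].
    intros _. split; [now exists (lh - lc)|easy].
  - split; [easy|]. split; [easy|]. split.
    + rewrite (proj1 (HankelH2_eq mu z Hz) E). now apply hankel_quot_split.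
    + intros H. split; [easy|]. symmetry. now apply calH2_integral_eq.
Qed.
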